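(* Let $\varphi$ be an Orlicz $N$-function. (Function case) Let $w$ be a weight function on $I=[0,\gamma)$, $0<\gamma\le\infty$. If $\gamma=\infty$ and $\varphi$ does not satisfy $\Delta_2$, or $\gamma<\infty$ and $\varphi$ does not satisfy $\Delta_2^\infty$, then $(\Lambda^0_{\varphi,w})_a$ is not an $M$-ideal in $\Lambda^0_{\varphi,w}$ (with the Orlicz norm). (Sequence case) Let $w=(w(i))$ be a weight sequence. If $\varphi$ does not satisfy $\Delta_2^0$, then $(\lambda^0_{\varphi,w})_a$ is not an $M$-ideal in $\lambda^0_{\varphi,w}$ (with the Orlicz norm).
   Context: A closed subspace $Y$ of a Banach space $X$ is an $M$-ideal of $X$ if $Y^\perp$ is the range of a bounded projection $P:X^*\to X^*$ satisfying $\|x^*\|=\|Px^*\|+\|x^*-Px^*\|$ for all $x^*\in X^*$. An Orlicz function is a convex function $\varphi:[0,\infty)\to[0,\infty)$ with $\varphi(0)=0$ and $\varphi(t)>0$ for $t>0$. It is an $N$-function if $\lim_{t\to0}\varphi(t)/t=0$ and $\lim_{t\to\infty}\varphi(t)/t=\infty$. The complementary function is $\varphi_*(v)=\sup\{uv-\varphi(u):u\ge0\}$, $v\ge0$. $\varphi$ satisfies $\Delta_2$ (resp. $\Delta_2^\infty$; $\Delta_2^0$) if there exist $K>0$ (resp. $K>0$ and $u_0\ge0$; $K>0$ and $u_0>0$) such that $\varphi(2u)\le K\varphi(u)$ for all $u\ge0$ (resp. $u\ge u_0$; $0<u\le u_0$). Function case. $I=[0,\gamma)$, $0<\gamma\le\infty$,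 with Lebesgue measure $m$; $L^0$ is the set of (classes of) Lebesgue measurable functions $f:I\to\mathbb R$. For $f\in L^0$, $d_f(\lambda)=m\{t\in I:|f(t)|>\lambda\}$ for $\lambda>0$, and $f^*(t)=\inf\{\lambda>0:d_f(\lambda)\le t\}$, $t\in[0,\gamma)$. A weight function $w:I\to(0,\infty)$ is decreasing (non-increasing) and locally integrable, with $W(t)=\int_0^tw<\infty$ for $t\in I$, and $W(\infty)=\infty$ if $\gamma=\infty$. Put $\rho_{\varphi,w}(f)=\int_0^\gamma\varphi(f^*(t))w(t)\,dt$. $\Lambda^0_{\varphi,w}$ is the set of all $f\in L^0$ with $\rho_{\varphi,w}(\lambda f)<\infty$ for some $\lambda>0$, with the Orlicz norm $\|f\|^0=\sup\{\int_If^*g^*w:g\in L^0,\ \rho_{\varphi_*,w}(g)\le1\}$. Sequence case. For a real sequence $x=(x(i))$, $d_x(\lambda)=|\{i:|x(i)|>\lambda\}|$ and $x^*(i)=\inf\{\lambda>0:d_x(\lambda)<i\}$. A weight sequence $w=(w(i))$ is positive and decreasing (non-increasing) with $\sum_{i=1}^\infty w(i)=\infty$. Put $\alpha_{\varphi,w}(x)=\sum_{i=1}^\infty\varphi(x^*(i))w(i)$. $\lambda^0_{\varphi,w}$ is the set of real sequences $x$ with $\alpha_{\varphi,w}(\eta x)<\infty$ for some $\eta>0$, with the Orlicz norm $\|x\|^0=\sup\{\sum_ix^*(i)y^*(i)w(i):\alpha_{\varphi_*,w}(y)\le1\}$. For a Banach function (or sequence) lattice $X$, $X_a$ is the closed subspace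 of order-continuous elements: those $x\in X$ such that $\|x_n\|\downarrow0$ whenever $0\le x_n\le|x|$ and $x_n\downarrow0$ a.e. Here $(\Lambda^0_{\varphi,w})_a=\{f:\rho_{\varphi,w}(\lambda f)<\infty\ \text{for all}\ \lambda>0\}$ and $(\lambda^0_{\varphi,w})_a=\{x:\alpha_{\varphi,w}(\eta x)<\infty\ \text{for all}\ \eta>0\}$. *)

(* Defs.v *)
From HB Require Import structures.
From mathcomp Require Import all_boot all_order all_algebra.
From mathcomp Require Import all_classical all_reals all_analysis.
From mathcomp Require Import measurable_realfun.
Set Implicit Arguments.
Unset Strict Implicit.
Unset Printing Implicit Defensive.
Import Order.TTheory GRing.Theory Num.Theory.
Import numFieldNormedType.Exports.
Local Open Scope classical_set_scope.
Local Open Scope ring_scope.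

(* A normed space of classes of functions is given by the vector space V of all
   functions, the set X of representatives, and the norm N read on
   representatives (a seminorm on X). A functional that is bounded for N takes
   the same value on two representatives of a class, so no quotient is needed
   to describe the dual. *)
Section m_ideals.
Context {R : realType} {V : lmodType R}.
Variables (X : set V) (N : V -> \bar R).

Definition dual_norm (l : V -> R) : \bar R :=
  ereal_sup [set `|l x|%:E | x in [set x | X x /\ (N x <= 1)%E]].

(* The value 0 outside X makes a functional on X a unique element of V -> R. *)
Definition dual : set (V -> R) := [set l |
  [/\ forall (a : R) x y, X x -> X y -> l (a *: x + y) = a * l x + l y,
      forall x, ~ X x -> l x = 0
    & (dual_norm l < +oo)%E]].

Definition annihilator (Y : set V) : set (V -> R) :=
  [set l | dual l /\ forall y, Y y -> l y = 0].

(* Meant for subspaces Y of X. Closedness of Y is not included: Y and its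
   closure have the same annihilator, hence agree on this property. *)
Definition M_ideal (Y : set V) : Prop :=
  exists P : (V -> R) -> (V -> R),
    [/\ (forall l, dual l -> dual (P l)) /\
        (forall (a : R) l1 l2, dual l1 -> dual l2 ->
          P (a *: l1 + l2) = a *: P l1 + P l2),
        exists C : R, forall l, dual l ->
          (dual_norm (P l) <= C%:E * dual_norm l)%E,
        forall l, dual l -> P (P l) = P l,
        P @` dual = annihilator Y
      & forall l, dual l ->
          dual_norm l = (dual_norm (P l) + dual_norm (l - P l)%R)%E].

End m_ideals.

(* Elements x of X such that ||u_n|| decreases to 0 whenever 0 <= u_n <= |x|
   and u_n decreases to 0 almost everywhere on I. *)
Definition order_continuous_part {R : realType} {d} {T : measurableType d}
    (mu : {measure set T -> \bar R}) (I : set T)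
    (X : set (T -> R)) (N : (T -> R) -> \bar R) : set (T -> R) :=
  [set x | X x /\ forall u : nat -> T -> R,
    (forall n, X (u n)) ->
    (forall n, \forall t \ae mu, I t -> 0 <= u n t <= `|x t|) ->
    (\forall t \ae mu, I t ->
      nonincreasing_seq (u ^~ t) /\ u n t @[n --> \oo] --> (0 : R)) ->
    nonincreasing_seq (N \o u) /\ N (u n) @[n --> \oo] --> 0%E].

(* Functions on [0, +oo[ are represented by functions on R whose values at
   negative arguments are irrelevant. *)
Section orlicz_functions.
Context {R : realType}.
Implicit Type phi : R -> R.

Definition Orlicz_function phi : Prop :=
  [/\ convex_function (`[0, +oo[%classic : set R) phi,
      phi 0 = 0 & forall t : R, 0 < t -> 0 < phi t].

Definition N_function phi : Prop :=
  [/\ Orlicz_function phi,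
      phi t / t @[t --> 0^'+] --> 0
    & phi t / t @[t --> +oo] --> +oo].

Definition complementary phi (v : R) : \bar R :=
  ereal_sup [set (u * v - phi u)%:E | u in [set u : R | 0 <= u]].

Definition Delta2 phi : Prop :=
  exists K : R, 0 < K /\ forall u : R, 0 <= u -> phi (2 * u) <= K * phi u.

Definition Delta2_infty phi : Prop :=
  exists K u0 : R, [/\ 0 < K, 0 <= u0 &
    forall u : R, u0 <= u -> phi (2 * u) <= K * phi u].

Definition Delta2_zero phi : Prop :=
  exists K u0 : R, [/\ 0 < K, 0 < u0 &
    forall u : R, 0 < u <= u0 -> phi (2 * u) <= K * phi u].

(* Decreasing rearrangements may take the value +oo, where Orlicz functions
   are given their limit +oo. *)
Definition ext_at_infty (psi : R -> \bar R) (s : \bar R) : \bar R :=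
  if s is r%:E then psi r else +oo%E.

End orlicz_functions.

Section function_case.
Context {R : realType}.
Variables (gamma : \bar R) (w : R -> R).
Local Notation mu := (@lebesgue_measure R).

Definition domain : set R := [set t | 0 <= t /\ (t%:E < gamma)%E].

(* Monotonicity is not required at t = 0, so that weights that are unbounded
   near 0 are allowed; w is then measurable, being monotone on ]0, gamma[. *)
Definition weight_function : Prop :=
  [/\ forall t : R, domain t -> 0 < w t,
      forall s t : R, 0 < s -> s <= t -> domain t -> w t <= w s,
      forall t, domain t -> (\int[mu]_(s in `[0%R, t]) (w s)%:E < +oo)%E
    & gamma = +oo%E -> (\int[mu]_(s in domain) (w s)%:E = +oo)%E].

(* Lebesgue (not only Borel) measurable functions on the domain. *)
Definition L0 : set (R -> R) := [set f |
  measurable_fun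
    (domain : set (g_sigma_algebraType (completed_algebra_gen mu)))
    (f : _ -> measurableTypeR R)].

Definition distribution_fun (f : R -> R) (lambda : R) : \bar R :=
  mu [set t | domain t /\ lambda < `|f t|].

Definition rearrangement (f : R -> R) (t : R) : \bar R :=
  ereal_inf [set lambda%:E | lambda in
    [set lambda : R | 0 < lambda /\ (distribution_fun f lambda <= t%:E)%E]].

Definition rho (psi : R -> \bar R) (f : R -> R) : \bar R :=
  (\int[mu]_(t in domain) (ext_at_infty psi (rearrangement f t) * (w t)%:E))%E.

Definition Orlicz_Lorentz_space (phi : R -> R) : set (R -> R) := [set f |
  L0 f /\ exists2 lambda : R, 0 < lambda &
    (rho (EFin \o phi) (lambda *: f) < +oo)%E].

Definition Orlicz_Lorentz_norm (phi : R -> R) (f : R -> R) : \bar R :=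
  ereal_sup [set
    (\int[mu]_(t in domain)
       (rearrangement f t * rearrangement g t * (w t)%:E))%E
    | g in [set g | L0 g /\ (rho (complementary phi) g <= 1)%E]].

Definition Orlicz_Lorentz_oc (phi : R -> R) : set (R -> R) :=
  order_continuous_part mu domain
    (Orlicz_Lorentz_space phi) (Orlicz_Lorentz_norm phi).

End function_case.

(* Sequences are indexed from 0: x i stands for x(i + 1). *)
Section sequence_case.
Context {R : realType}.
Variable w : nat -> R.

Definition weight_sequence : Prop :=
  [/\ forall i, 0 < w i, nonincreasing_seq w
    & (\sum_(0 <= i <oo) (w i)%:E = +oo)%E].

Definition seq_distribution (x : nat -> R) (lambda : R) : \bar R :=
  counting [set i | lambda < `|x i|].

Definition seq_rearrangement (x : nat -> R) (i : nat) : \bar R :=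
  ereal_inf [set lambda%:E | lambda in
    [set lambda : R | 0 < lambda /\
       (seq_distribution x lambda < (i.+1)%:R%:E)%E]].

Definition alpha (psi : R -> \bar R) (x : nat -> R) : \bar R :=
  (\sum_(0 <= i <oo) (ext_at_infty psi (seq_rearrangement x i) * (w i)%:E))%E.

Definition seq_Orlicz_Lorentz_space (phi : R -> R) : set (nat -> R) := [set x |
  exists2 eta : R, 0 < eta & (alpha (EFin \o phi) (eta *: x) < +oo)%E].

Definition seq_Orlicz_Lorentz_norm (phi : R -> R) (x : nat -> R) : \bar R :=
  ereal_sup [set
    (\sum_(0 <= i <oo)
       (seq_rearrangement x i * seq_rearrangement y i * (w i)%:E))%E
    | y in [set y | (alpha (complementary phi) y <= 1)%E]].

Definition seq_Orlicz_Lorentz_oc (phi : R -> R) : set (nat -> R) :=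
  order_continuous_part counting [set: nat]
    (seq_Orlicz_Lorentz_space phi) (seq_Orlicz_Lorentz_norm phi).

End sequence_case.

(* Main.v *)
Require Import Defs.
From HB Require Import structures.
From mathcomp Require Import all_boot all_order all_algebra.
From mathcomp Require Import all_classical all_reals all_analysis.
From mathcomp Require Import measurable_realfun lra ring.

(* Let E be the order-continuous part of X. If E were an M-ideal, then
   |h + s| = |h| + |s| for every functional h whose norm is attained on E and
   every s vanishing on E. Take for h the integral over a set E0 of finite mass,
   and for s an ultralimit of normalized averages over disjoint sets A_k, which
   is nonzero at sum_k u_k 1_{A_k}; the failure of the Delta_2 condition provides
   u_k and A_k with phi(2 u_k) >= 2^(k+1) phi(u_k) for which this sum is in X.
   If |f| <= 1 and h(f) is close to |h|, then f differs by an element of E from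
   some g with |g| <= 1 - kappa, where kappa does not depend on f: in the
   supremum defining the Orlicz norm, replacing a test function y by
   max(eta 1_E0, (1 - tau) y) gains about eta h(f) and costs
   tau = phi_*(eta) W, where W is the integral of w up to the mass of E0; this is
   o(eta) as phi is an N-function. Hence
   |s(f)| <= (1 - kappa) |s| and |h + s| < |h| + |s|. *)

Set Implicit Arguments.
Unset Strict Implicit.
Unset Printing Implicit Defensive.
Import Order.TTheory GRing.Theory Num.Theory.
Import numFieldNormedType.Exports.
Local Open Scope classical_set_scope.
Local Open Scope ring_scope.

(** * Orlicz functions *)

Section orlicz_function_facts.
Context {R : realType} (phi : R -> R) (phiN : N_function phi).
Local Notation psi := (complementary phi).
Local Notation ext := ext_at_infty.

(** The blocks are normalized by 1/2 <= W(mu(A_k)) phi(2 u_k) <= 1, where W is the integral of w up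
    to a given mass. The upper bound makes the modulars of u_k 1_{A_k} summable. The lower bound
    keeps the averages over A_k, divided by u_k, below 4 on the unit ball, so that they have
    ultralimits. Candidate sets have masses in ratio 2: W(2c) <= 2 W(c) by concavity, so one of them
    fits any suitable u_k. The obstacle is that rearrangement is not additive, while the norm is
    only known as a supremum over rearranged test functions. Sums are therefore compared on
    superlevel sets, through the layer-cake formula and the subadditivity of W, and the modified
    test functions are built directly in rearranged form. Both cases are instances of one structure:
    a set with a position function whose initial segments have the right mass. The function case
    needs the completed Lebesgue measure, because functions are Lebesgue measurable; the integrals
    of the definitions are taken on the Borel side, where the monotone rearrangements are measurable
    anyway. *)

Lemma Orlicz0 : phi 0 = 0.
Proof. by case: phiN => -[]. Qed.

Lemma Orlicz_gt0 (t : R) : 0 < t -> 0 < phi t.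
Proof. by case: phiN => -[_ _ +] _ _; exact. Qed.

Lemma Orlicz_ge0 (t : R) : 0 <= t -> 0 <= phi t.
Proof. by rewrite le_eqVlt => /predU1P[<-|/Orlicz_gt0/ltW//]; rewrite Orlicz0. Qed.

Lemma Orlicz_convex (t x y : R) : 0 <= t <= 1 -> 0 <= x -> 0 <= y ->
  phi (t * x + (1 - t) * y) <= t * phi x + (1 - t) * phi y.
Proof.
move=> /andP[t0 t1] x0 y0; case: phiN => -[cphi _ _] _ _.
have := cphi (Itv01 t0 t1) x y.
rewrite !inE/= !in_itv/= !andbT => /(_ x0 y0).
by rewrite !convRE.
Qed.

Lemma Orlicz_scale (t x : R) : 0 <= t <= 1 -> 0 <= x -> phi (t * x) <= t * phi x.
Proof.
move=> t01 x0; have := Orlicz_convex t01 x0 (lexx 0).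
by rewrite mulr0 addr0 Orlicz0 mulr0 addr0.
Qed.

Lemma Orlicz_le (x y : R) : 0 <= x -> x <= y -> phi x <= phi y.
Proof.
move=> x0 xy; have [y0|y0] := leP y 0.
  by have -> : x = y by apply/eqP; rewrite eq_le xy (le_trans y0).
have xy01 : 0 <= x / y <= 1 by rewrite divr_ge0 ?(ltW y0)// ler_pdivrMr ?mul1r.
have := Orlicz_scale xy01 (ltW y0).
rewrite divfK ?gt_eqF// => /le_trans; apply.
by rewrite ler_piMl ?Orlicz_ge0 ?(ltW y0)//; case/andP: xy01.
Qed.

(** Left continuity drawn from convexity: [u] is a convex combination of [(1 - e) * u] and [2 * u]
    with weight [1 - s <= e] on the latter, so [phi u <= phi ((1 - e) * u) + e * phi (2 * u)]. The
    choice of [e] makes the last term at most half of [phi u - l]. *)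
Lemma Orlicz_left_open (l u : R) : 0 <= u -> 0 <= l -> l < phi u ->
  exists2 v : R, 0 <= v < u & l < phi v.
Proof.
move=> u0 l0 lu.
have {}u0 : 0 < u.
  by rewrite lt_neqAle u0 andbT; apply: contraTneq lu => <-; rewrite Orlicz0 -leNgt.
pose B := phi (2 * u).
have B0 : 0 < B by apply: Orlicz_gt0; rewrite mulr_gt0.
pose e := Num.min (1/2) ((phi u - l) / (2 * B)).
have e0 : 0 < e by rewrite lt_min; apply/andP; split; [lra|rewrite divr_gt0 ?subr_gt0 ?mulr_gt0].
have e1 : e <= 1/2 by rewrite ge_min lexx.
have eB : e * B <= (phi u - l) / 2.
  have : e <= (phi u - l) / (2 * B) by rewrite ge_min lexx orbT.
  rewrite -(ler_pM2r B0) => /le_trans; apply.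
  by rewrite invfM mulrA divfK ?gt_eqF.
exists ((1 - e) * u); first by rewrite mulr_ge0 ?(ltW u0)//; nra.
pose s := (1 + e)^-1.
have s1 : s * (1 + e) = 1 by rewrite mulVf//; lra.
have s0 : 0 < s by rewrite invr_gt0; lra.
have s01 : 0 <= s <= 1 by apply/andP; split; [exact: ltW|nra].
have := @Orlicz_convex s ((1 - e) * u) (2 * u) s01.
rewrite -/B (_ : s * ((1 - e) * u) + (1 - s) * (2 * u) = u); last first.
  rewrite (_ : _ + _ = u * (2 - s * (1 + e))); last by ring.
  by rewrite s1; ring.
have e1u : 0 <= (1 - e) * u by apply: mulr_ge0; lra.
have u2 : 0 <= 2 * u by lra.
move=> /(_ e1u u2).
have : (1 - s) <= e by nra.
have p0 : 0 <= phi ((1 - e) * u) by apply: Orlicz_ge0; apply: mulr_ge0; lra.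
move=> se.
have : (1 - s) * B <= e * B by rewrite ler_pM2r.
have : s * phi ((1 - e) * u) <= phi ((1 - e) * u) by rewrite ler_piMl//; lra.
lra.
Qed.

Lemma Orlicz_unbounded (A : R) : exists2 u : R, 1 <= u & forall v : R, u <= v -> A * v <= phi v.
Proof.
case: phiN => _ _ /cvgryPge/(_ A)[M [_ HM]].
exists (Num.max 1 (M + 1)); first by rewrite le_max lexx.
move=> v; rewrite ge_max => /andP[v1 vM].
have := HM v; rewrite -ler_pdivlMr; last lra.
by apply; lra.
Qed.

(** Turns superlevel sets of [phi] composed with a rearrangement into superlevel sets of the
    rearrangement itself, as the layer-cake formula requires. The level [c] is an infimum, and left
    continuity excludes the end point. *)
Lemma Orlicz_level (l : R) : 0 <= l ->
  exists2 c : R, 0 <= c & forall x : \bar R, (0 <= x)%E ->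
    (l%:E < ext (EFin \o phi) x)%E = (c%:E < x)%E.
Proof.
move=> l0; pose A := [set u : R | 0 <= u /\ l < phi u].
have A0 : A !=set0.
  have [u u1 Hu] := Orlicz_unbounded (l + 1); exists u; split; first lra.
  have := Hu _ (lexx u); nra.
have lbA : lbound A 0 by move=> u [].
have hA : has_inf A by split => //; exists 0.
exists (inf A); first by apply: lb_le_inf.
case=> [u| |]//=; last by rewrite !ltry.
rewrite !lee_fin !lte_fin => u0; apply/idP/idP => h.
  have [v /andP[v0 vu] lv] := Orlicz_left_open u0 l0 h.
  by apply: le_lt_trans vu; apply: ge_inf; [case: hA|].
have [v [v0 lv] vu] := inf_lt A0 h.
by apply: lt_le_trans lv _; apply: Orlicz_le => //; exact: ltW.
Qed.

Lemma complementary_ge0 (v : R) : (0 <= psi v)%E.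
Proof.
apply: ereal_sup_ubound; exists 0 => /=; first by [].
by rewrite mul0r Orlicz0 subr0.
Qed.

Lemma Young (u v : R) : 0 <= u -> ((u * v)%:E <= (phi u)%:E + psi v)%E.
Proof.
move=> u0; rewrite addeC -leeBlDr// -EFinB.
by apply: ereal_sup_ubound; exists u.
Qed.

(** Superlinear growth of [phi] makes [t * v - phi t] nonpositive for large [t], so only a bounded
    range of [t] matters. *)
Lemma complementary_fin (v : R) : psi v \is a fin_num.
Proof.
rewrite ge0_fin_numE ?complementary_ge0//.
have [u u1 Hu] := Orlicz_unbounded `|v|.
apply: (@le_lt_trans _ _ (u * `|v|)%:E); last by rewrite ltry.
apply: ge_ereal_sup => _ [t/= t0 <-]; rewrite lee_fin.
have tv : t * v <= t * `|v| by rewrite ler_wpM2l// ler_norm.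
have [tu|/ltW ut] := leP t u.
  have := Orlicz_ge0 t0; have : t * `|v| <= u * `|v| by rewrite ler_wpM2r.
  lra.
have := Hu _ ut; have : 0 <= u * `|v| by rewrite mulr_ge0//; lra.
lra.
Qed.

Lemma complementary_le (v1 v2 : R) : v1 <= v2 -> (psi v1 <= psi v2)%E.
Proof.
move=> v12; apply: ge_ereal_sup => _ [t/= t0 <-].
apply: (@le_trans _ _ (t * v2 - phi t)%:E).
  by rewrite lee_fin lerD2r ler_wpM2l.
by apply: ereal_sup_ubound; exists t.
Qed.

Lemma complementary_scale (t v : R) : 0 <= t <= 1 -> (psi (t * v) <= t%:E * psi v)%E.
Proof.
move=> /andP[t0 t1]; apply: ge_ereal_sup => _ [u/= u0 <-].
apply: (@le_trans _ _ (t%:E * (u * v - phi u)%:E)%E).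
  rewrite -EFinM lee_fin mulrBr mulrCA lerD2l lerN2.
  by rewrite ler_piMl// Orlicz_ge0.
by rewrite lee_wpmul2l ?lee_fin//; apply: ereal_sup_ubound; exists u.
Qed.

Lemma complementary0 : psi 0 = 0%E.
Proof.
apply/eqP; rewrite eq_le complementary_ge0 andbT.
apply: ge_ereal_sup => _ [u/= u0 <-].
by rewrite lee_fin mulr0 sub0r oppr_le0 Orlicz_ge0.
Qed.

Lemma Orlicz_slope (e u : R) : 0 < e -> e <= u -> u * (phi e / e) <= phi u.
Proof.
move=> e0 eu; have u0 : 0 < u by exact: lt_le_trans eu.
have : phi (e / u * u) <= e / u * phi u.
  by apply: Orlicz_scale (ltW u0); rewrite divr_ge0 ?(ltW e0) ?(ltW u0)// ler_pdivrMr// mul1r.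
rewrite divfK ?gt_eqF// -(ler_pM2l u0) => h.
rewrite mulrA ler_pdivrMr// (le_trans h)// mulrA mulrCA mulfV ?gt_eqF// mulr1.
by rewrite mulrC.
Qed.

(* As phi(t)/t is nondecreasing, t * v <= phi t for v = phi(u)/u and t >= u. *)
Lemma complementary_slope (u : R) : 0 < u -> (psi (phi u / u) <= (phi u)%:E)%E.
Proof.
move=> u0; apply: ge_ereal_sup => _ [t/= t0 <-]; rewrite lee_fin.
have p0 := Orlicz_gt0 u0.
have [tu|/ltW ut] := leP t u.
  have : t * (phi u / u) <= phi u.
    by rewrite mulrCA ler_piMr ?(ltW p0)// ler_pdivrMr// mul1r.
  by have := Orlicz_ge0 t0; lra.
by have := Orlicz_slope u0 ut; lra.
Qed.

(** This is psi(eta) = o(eta) near 0. The slope [v = phi e / e] satisfies psi(v) <= phi(e) = e v;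
    multiplying [v] by [t = 1 / (1 + v)] preserves such a bound by convexity and brings the point
    below 1. *)
Lemma complementary_small (e : R) : 0 < e ->
  exists2 eta : R, 0 < eta <= 1 & (psi eta <= (e * eta)%:E)%E.
Proof.
move=> e0; pose v := phi e / e.
have v0 : 0 < v by rewrite divr_gt0// Orlicz_gt0.
pose t := (1 + v)^-1; have t0 : 0 < t by rewrite invr_gt0 addr_gt0.
have t1 : t <= 1 by rewrite invf_le1; lra.
exists (t * v); first by rewrite mulr_gt0//= mulrC ler_pdivrMr; lra.
have t01 : 0 <= t <= 1 by rewrite ltW.
apply: le_trans (complementary_scale v t01) _.
rewrite mulrCA EFinM lee_pmul2l ?lte_fin//.
by rewrite mulrCA mulfV ?gt_eqF// mulr1; exact: complementary_slope.
Qed.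

End orlicz_function_facts.

(** * Infinite arguments, and where the Delta_2 condition can fail *)

Section extension_at_infinity.
Context {R : realType} (phi : R -> R) (phiN : N_function phi).
Local Notation psi := (complementary phi).
Local Notation ephi := (ext_at_infty (EFin \o phi)).
Local Notation epsi := (ext_at_infty psi).
Local Open Scope ereal_scope.

Lemma ephi_ge0 (x : \bar R) : 0 <= x -> 0 <= ephi x.
Proof. by case: x => [r| |]//=; rewrite !lee_fin; exact: Orlicz_ge0. Qed.

Lemma ephi_le (x y : \bar R) : 0 <= x -> x <= y -> ephi x <= ephi y.
Proof.
case: x y => [x| |] [y| |]//=; rewrite ?leey// !lee_fin.
by move=> *; exact: Orlicz_le.
Qed.

Lemma epsi_ge0 (x : \bar R) : 0 <= epsi x.
Proof. by case: x => [r| |]//=; exact: complementary_ge0. Qed.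

Lemma epsi_le (x y : \bar R) : 0 <= x -> x <= y -> epsi x <= epsi y.
Proof.
case: x y => [x| |] [y| |]//=; rewrite ?leey// !lee_fin.
by move=> *; exact: complementary_le.
Qed.

Lemma epsi_scale (t : R) (x : \bar R) : (0 < t <= 1)%R -> 0 <= x ->
  epsi (t%:E * x) <= t%:E * epsi x.
Proof.
move=> /andP[t0 t1]; case: x => [x| |]//=.
  by move=> _; apply: complementary_scale => //; rewrite ltW.
by rewrite gt0_muley ?lte_fin.
Qed.

Lemma ext_Young (x y : \bar R) : 0 <= x -> 0 <= y -> x * y <= ephi x + epsi y.
Proof.
have psifin v := complementary_fin phiN v.
case: x y => [x| |] [y| |]//= x0 y0; rewrite ?leey ?addye ?addey//=.
- by rewrite -EFinM; exact: Young.
- by rewrite leey.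
- by rewrite -ltNye (lt_le_trans _ (complementary_ge0 phiN y)).
Qed.

(** Bounds near 0 and near infinity glue together: on the range between [u1] and [u2], [phi (2 * u)]
    is bounded above and [phi u] is bounded below by a positive number, with ratio [K3]. *)
Lemma Delta2_failure : ~ Delta2 phi -> Delta2_zero phi -> ~ Delta2_infty phi.
Proof.
move=> nD [K1 [u1 [K10 u10 H1]]] [K2 [u2 [K20 u20 H2]]]; apply: nD.
pose K3 := (phi (2 * Num.max u2 u1) / phi u1)%R.
have M0 : (0 < Num.max u2 u1)%R by rewrite lt_max u10 orbT.
have K30 : (0 < K3)%R by rewrite divr_gt0 ?(Orlicz_gt0 phiN)// mulr_gt0.
exists (K1 + K2 + K3)%R; split; first by lra.
move=> u; rewrite le_eqVlt => /predU1P[<-|u0].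
  by rewrite mulr0 (Orlicz0 phiN) mulr0.
have p0 := Orlicz_gt0 phiN u0.
have [uu1|/ltW u1u] := leP u u1.
  have := H1 u; rewrite u0 uu1 => /(_ isT)/le_trans; apply.
  by rewrite ler_pM2r//; lra.
have [u2u|/ltW uu2] := leP u2 u.
  by apply: le_trans (H2 _ u2u) _; rewrite ler_pM2r//; lra.
apply: (@le_trans _ _ (K3 * phi u)%R); last by rewrite ler_pM2r//; lra.
have pu1 := Orlicz_gt0 phiN u10.
apply: (@le_trans _ _ (K3 * phi u1)%R); last first.
  by rewrite ler_pM2l// (Orlicz_le phiN)// ltW.
rewrite divfK ?gt_eqF// (Orlicz_le phiN)//; first by rewrite mulr_ge0// ltW.
by rewrite ler_pM2l// le_max uu2.
Qed.

End extension_at_infinity.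

(** * An obstruction to being an M-ideal *)

Section m_ideal_obstruction.
Context {R : realType} {V : lmodType R} (X : set V) (N : V -> \bar R) (Y : set V).
Local Open Scope ereal_scope.
Implicit Types h s l : V -> R.

Lemma dual_norm_ge l f : X f -> N f <= 1 -> `|l f|%:E <= dual_norm X N l.
Proof. by move=> Xf Nf; apply: ereal_sup_ubound; exists f. Qed.

Lemma dual_norm_le l (a : \bar R) :
  (forall f, X f -> N f <= 1 -> `|l f|%:E <= a) -> dual_norm X N l <= a.
Proof. by move=> H; apply: ge_ereal_sup => _ [f [Xf Nf] <-]; exact: H. Qed.

(* If Y were an M-ideal with L-projection P, then h would be in the kernel of P
   because h attains its norm on Y, whereas P s = s; hence
   |h + s| = |h| + |s|. *)
Lemma M_ideal_obstruction h s (kappa : R) :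
  (0 < kappa < 1)%R ->
  dual X N h -> annihilator X N Y s ->
  0 < dual_norm X N h -> 0 < dual_norm X N s ->
  (forall f e, X f -> N f <= 1 -> (0 < e)%R ->
    exists g, [/\ X g, Y g, N g <= 1 & (`|h f| - e <= `|h g|)%R]) ->
  (forall f, X f -> N f <= 1 -> dual_norm X N h <= (2 * `|h f|)%:E ->
    exists2 g, X g /\ N g <= 1 & (`|s f| <= (1 - kappa) * `|s g|)%R) ->
  ~ M_ideal X N Y.
Proof.
move=> /andP[k0 k1] dh [ds sY] h0 s0 hY hs [P [[Pd Plin] _ PP Prange Padd]].
have nfin l : dual X N l -> 0 < dual_norm X N l -> dual_norm X N l \is a fin_num.
  by move=> [_ _ lfin] l0; rewrite ge0_fin_numE// ltW.
have [H He] : exists H, dual_norm X N h = H%:E.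
  by exists (fine (dual_norm X N h)); rewrite fineK// nfin.
have [S Se] : exists S, dual_norm X N s = S%:E.
  by exists (fine (dual_norm X N s)); rewrite fineK// nfin.
have H0 : (0 < H)%R by rewrite -lte_fin -He.
have S0 : (0 < S)%R by rewrite -lte_fin -Se.
have hH f : X f -> N f <= 1 -> (`|h f| <= H)%R.
  by move=> Xf Nf; rewrite -lee_fin -He; exact: dual_norm_ge.
have sS f : X f -> N f <= 1 -> (`|s f| <= S)%R.
  by move=> Xf Nf; rewrite -lee_fin -Se; exact: dual_norm_ge.
have [f0 [Xf0 Nf0]] : exists f, X f /\ N f <= 1.
  apply: contrapT => nex; move: h0; apply/negP; rewrite -leNgt.
  by apply: dual_norm_le => f Xf Nf; exfalso; apply: nex; exists f.
have Ps : P s = s.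
  have : annihilator X N Y s by split.
  by rewrite -Prange => -[l dl <-]; exact: PP.
have PhY g : Y g -> P h g = 0%R.
  have : annihilator X N Y (P h) by rewrite -Prange; exists h.
  by move=> [_ +]; exact.
(* On [Y] the functionals [h] and [h - P h] agree, and [Y] suffices to compute the norm of [h]. *)
have hPh : H%:E <= dual_norm X N (h - P h)%R.
  apply/lee_addgt0Pr => e e0; rewrite -He.
  apply: dual_norm_le => f Xf Nf.
  have [g [Xg Yg Ng hg]] := hY f e Xf Nf e0.
  apply: (@le_trans _ _ (`|h g| + e)%:E); first by rewrite lee_fin -lerBlDr.
  rewrite EFinD leeD2r//.
  have -> : h g = (h - P h)%R g by rewrite !fctE PhY// subr0.
  exact: dual_norm_ge.
(* The norm of [h - P h] already exhausts [H], so the additivity formula leaves nothing for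
   [P h]. *)
have Ph0 f : X f -> N f <= 1 -> P h f = 0%R.
  move=> Xf Nf; have := Padd h dh; rewrite He.
  have := dual_norm_ge (P h) Xf Nf; move: hPh.
  have : dual_norm X N (P h) < +oo by case: (Pd _ dh).
  move: (dual_norm X N (P h)) (dual_norm X N (h - P h)%R) => [a| |] [b| |]//= _.
  rewrite !lee_fin => Hb Pa -[Hab].
  by apply/eqP; rewrite -normr_le0; lra.
have hsE : P (h + s)%R = (P h + s)%R.
  by have := Plin 1%R h s dh ds; rewrite !scale1r Ps.
have dhs : dual X N (h + s)%R.
  case: dh ds => [h1 h2 h3] [s1 s2 s3]; split.
  - by move=> a x y Xx Xy; rewrite !fctE h1// s1//; ring.
  - by move=> x Xx; rewrite !fctE h2// s2// addr0.
  - apply: (@le_lt_trans _ _ (H + S)%:E); last by rewrite ltry.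
    apply: dual_norm_le => f Xf Nf; rewrite lee_fin.
    by rewrite (le_trans (ler_normD _ _))// lerD ?hH ?sS.
have := Padd _ dhs; rewrite hsE.
have -> : (h + s - (P h + s) = h - P h)%R by rewrite opprD addrACA subrr addr0.
have -> : dual_norm X N (P h + s)%R = S%:E.
  rewrite -Se; congr ereal_sup; apply/seteqP; split=> _ [f [Xf Nf] <-];
  by exists f => //; rewrite !fctE Ph0// add0r.
(* A vector of the unit ball either loses half of [H] on [h] or the factor [1 - kappa] on [s]; both
   bounds are below [H + S]. *)
pose m := (Num.max (H / 2 + S) (H + (1 - kappa) * S))%R.
have hsm : dual_norm X N (h + s)%R <= m%:E.
  apply: dual_norm_le => f Xf Nf; rewrite lee_fin.
  apply: (le_trans (ler_normD _ _)); rewrite /m le_max.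
  have [h2|h2] := leP H (2 * `|h f|)%R.
    have := hs f Xf Nf; rewrite He lee_fin => /(_ h2)[g [Xg Ng]] sg.
    apply/orP; right; have := hH f Xf Nf; have := sS g Xg Ng; have := normr_ge0 (s f).
    have k1' : (0 <= 1 - kappa)%R by lra.
    by move=> _ /(ler_wpM2l k1'); lra.
  by apply/orP; left; have := sS f Xf Nf; lra.
move=> E; have := leeD (lexx S%:E) hPh; rewrite -E => /le_trans/(_ hsm).
rewrite lee_fin /m le_max => /orP[]; [lra|].
by have := mulr_gt0 k0 S0; lra.
Qed.

End m_ideal_obstruction.

(** * Ultralimits of bounded sequences of functionals *)

Section ultralimit_functional.
Context {R : realType}.

(** Compactness of the segment gives a cluster point, and a cluster point along an ultrafilter is a
    limit. *)
Lemma ultra_cvg_bounded (G : set_system nat) (u : nat -> R) (M : R) :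
  UltraFilter G -> (forall n, `|u n| <= M) -> cvg (u @ G).
Proof.
move=> GU uM.
have : (u @ G) `[(- M), M]%classic.
  by apply: (@filterS _ G _ setT); [move=> n _ /=; rewrite in_itv/= -ler_norml|exact: filterT].
move=> /(@segment_compact _ (- M) M (u @ G) _)[p [_ clp]].
apply/cvg_ex; exists p => A pA.
have [//|GA] := in_ultra_setVsetC (u @^-1` A) GU.
by have [x []] := clp (~` A) A GA pA.
Qed.

Context {V : lmodType R} (X : set V) (N : V -> \bar R) (Y : set V).

(** The ultralimit is linear and keeps the bound [C]. The ultrafilter refines convergence at
    infinity, so ordinary limits 0 on [Y] survive, while the constant value at [x0] prevents [s]
    from vanishing. *)
Lemma ultralimit_annihilator (hk : nat -> V -> R) (C : R) (x0 : V) :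
  (forall a x y, X x -> X y -> X (a *: x + y)) ->
  (forall k a x y, X x -> X y -> hk k (a *: x + y) = a * hk k x + hk k y) ->
  (forall x, X x -> exists M, forall k, `|hk k x| <= M) ->
  (forall k x, X x -> (N x <= 1)%E -> `|hk k x| <= C) ->
  (forall y, Y y -> X y /\ hk ^~ y @ \oo --> 0) ->
  X x0 -> (N x0 <= 1)%E -> hk ^~ x0 = cst (hk 0 x0) -> hk 0 x0 != 0 ->
  exists2 s, annihilator X N Y s & (0 < dual_norm X N s)%E.
Proof.
move=> Xlin hlin hfin hC hY Xx0 Nx0 hx0 hx0N.
have [G [GU GF]] := @ultraFilterLemma _ (@nbhs nat _ \oo) _.
have Gcvg x : X x -> cvg (hk ^~ x @ G).
  by move=> /hfin[M HM]; exact: (ultra_cvg_bounded GU HM).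
pose s x : R := if pselect (X x) then lim (hk ^~ x @ G) else 0.
have sE x : X x -> s x = lim (hk ^~ x @ G) by rewrite /s; case: pselect.
have sC x : X x -> (N x <= 1)%E -> `|s x| <= C.
  move=> Xx Nx; rewrite sE// ler_norml; apply/andP; split.
    apply: limr_ge; first exact: Gcvg.
    by apply: filterE => k; have := hC k x Xx Nx; rewrite ler_norml => /andP[].
  apply: limr_le; first exact: Gcvg.
  by apply: filterE => k; have := hC k x Xx Nx; rewrite ler_norml => /andP[].
exists s.
  split; first split.
  - move=> a x y Xx Xy; rewrite !sE//; last exact: Xlin.
    rewrite (_ : hk ^~ (a *: x + y) = fun k => a *: hk k x + hk k y); last first.
      by apply/funext => k; rewrite hlin.
    apply/cvg_lim => //; apply: cvgD; last exact: Gcvg.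
    by apply: cvgZr; exact: Gcvg.
  - by move=> x nXx; rewrite /s; case: pselect.
  - apply: (@le_lt_trans _ _ C%:E); last by rewrite ltry.
    by apply: dual_norm_le => x Xx Nx; rewrite lee_fin; exact: sC.
  - move=> y /hY[Xy y0]; rewrite sE//; apply/cvg_lim => //.
    by move=> A /y0 yA; apply: GF.
apply: lt_le_trans (dual_norm_ge s Xx0 Nx0).
by rewrite lte_fin normr_gt0 sE// hx0 lim_cst.
Qed.

End ultralimit_functional.

(** * Rearrangements on a weighted line *)

Section ereal_comparison.
Context {R : realType}.
Local Open Scope ereal_scope.

Lemma le_of_superlevel (x y : \bar R) : 0 <= y ->
  (forall l : R, (0 <= l)%R -> l%:E < x -> l%:E < y) -> x <= y.
Proof.
move=> y0 H; rewrite leNgt; apply/negP => yx.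
have yfin : y \is a fin_num by rewrite ge0_fin_numE// (lt_le_trans yx)// leey.
by have := H (fine y); rewrite fineK// => /(_ (fine_ge0 y0) yx); rewrite ltxx.
Qed.

Lemma eq_of_superlevel (x y : \bar R) : 0 <= x -> 0 <= y ->
  (forall l : R, (0 <= l)%R -> (l%:E < x) = (l%:E < y)) -> x = y.
Proof.
move=> x0 y0 H; apply: le_anti; apply/andP.
by split; apply: le_of_superlevel => // l l0; rewrite H.
Qed.

(** A superlevel set of [G] is the preimage under [m] of a down-closed set of reals, which is an
    interval. *)
Lemma measurable_antitone {d} {T : measurableType d} (I : set T) (m : T -> R) (G : T -> \bar R) :
  measurable I -> measurable_fun I m ->
  (forall s t, I s -> I t -> (m s <= m t)%R -> G t <= G s) -> measurable_fun I G.
Proof.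
move=> mI mm dG mD; apply: (measurability _ (ErealGenOInfty.measurableE R)) => //.
move=> _ [_ [x ->] <-].
pose J := [set r : R | exists2 t, I t & (r <= m t)%R /\ x%:E < G t].
have -> : I `&` G @^-1` `]x%:E, +oo[%classic = I `&` m @^-1` J.
  apply/seteqP; split => t [It]; rewrite /= ?in_itv/= ?andbT => h.
    by split => //; exists t.
  case: h => s Is [ms xs]; split => //; rewrite /= ?in_itv/= ?andbT.
  exact: lt_le_trans (dG t s It Is ms).
have mJ : measurable J.
  apply: is_interval_measurable => a b _ [t It [bt xt]] c /andP[_ cb].
  by exists t => //; split => //; exact: le_trans bt.
exact: (mm mI _ mJ).
Qed.

End ereal_comparison.

(** * A common frame for intervals and for the natural numbers *)

Section generic_definitions.
Context {R : realType} {d} {T : measurableType d}.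
Variables (mu : {sigma_finite_measure set T -> \bar R}) (I : set T) (m w : T -> R).
Local Open Scope ereal_scope.

(** The initial piece of length [c]. Its mass is required to be [c] only when [c] is the mass of
    some measurable subset of [I]: on the natural numbers a fractional [c >= 0] is rounded up. *)
Definition segment (c : \bar R) : set T := I `&` [set t | (m t)%:E < c].

Definition superlevel (f : T -> R) (l : R) : set T := [set t | I t /\ (l < `|f t|)%R].

Definition rearr (f : T -> R) (t : T) : \bar R :=
  ereal_inf [set l%:E | l in [set l : R | (0 < l)%R /\ mu (superlevel f l) <= (m t)%:E]].

Definition modular (psi : R -> \bar R) (f : T -> R) : \bar R :=
  \int[mu]_(t in I) (ext_at_infty psi (rearr f t) * (w t)%:E).

Definition Lorentz_space (phi : R -> R) : set (T -> R) := [set f : T -> R |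
  measurable_fun I f /\ exists2 l : R, (0 < l)%R &
    modular (EFin \o phi) (l *: f)%R < +oo].

Definition pairing (f g : T -> R) : \bar R :=
  \int[mu]_(t in I) (rearr f t * rearr g t * (w t)%:E).

Definition Lorentz_norm (phi : R -> R) (f : T -> R) : \bar R :=
  ereal_sup [set pairing f g | g in
    [set g | measurable_fun I g /\ modular (complementary phi) g <= 1]].

Definition cumulated_weight (c : \bar R) : \bar R := \int[mu]_(t in segment c) (w t)%:E.

(* [m t] is the mass located before [t]: [m t = t] on an interval, and [m i = i]
   for the counting measure on nat. The last field says that w is a
   nonincreasing function of m, up to a null set. *)
Record weighted_line : Prop := WeightedLine {
  wl_dom : measurable I ;
  wl_pos : measurable_fun I m ;
  wl_pos_ge0 : forall t, I t -> (0 <= m t)%R ;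
  wl_weight : measurable_fun I w ;
  wl_weight_gt0 : forall t, I t -> (0 < w t)%R ;
  wl_segment : forall E, measurable E -> E `<=` I -> mu (segment (mu E)) = mu E ;
  wl_cumulated_fin : forall c : R, cumulated_weight c%:E < +oo ;
  wl_cumulated_infty : mu I = +oo -> \int[mu]_(t in I) (w t)%:E = +oo ;
  wl_threshold : forall c : R, (0 < c)%R -> exists c0 : R, [/\ (0 <= c0)%R,
    forall t, I t -> (c <= m t)%R -> (w t <= c0)%R &
    {ae mu, forall t, I t -> (m t < c)%R -> (c0 <= w t)%R}] }.

End generic_definitions.

(** * Decreasing rearrangement and distribution function *)

Section rearrangement.
Context {R : realType} {d} {T : measurableType d}.
Context {mu : {sigma_finite_measure set T -> \bar R}} {I : set T} {m w : T -> R}.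
Hypothesis H : weighted_line mu I m w.
Local Open Scope ereal_scope.
Local Notation segment := (segment I m).
Local Notation superlevel := (superlevel I).
Local Notation rearr := (rearr mu I m).
Let mI := wl_dom H.
Implicit Types (f g u : T -> R) (t : T) (c : \bar R).

Lemma measurable_segment c : measurable (segment c).
Proof.
have mm : measurable_fun I (EFin \o m) by apply/measurable_EFinP; exact: wl_pos H.
exact: emeasurable_fun_infty_o.
Qed.

Lemma le_segment (c c' : \bar R) : c <= c' -> segment c `<=` segment c'.
Proof. by move=> cc t [It /= mt]; split => //=; exact: lt_le_trans cc. Qed.

Lemma segment_sub c : segment c `<=` I.
Proof. by move=> t []. Qed.

Lemma measurable_decr (G : T -> \bar R) :
  (forall s t, I s -> I t -> (m s <= m t)%R -> G t <= G s) -> measurable_fun I G.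
Proof. exact: (measurable_antitone mI (wl_pos H)). Qed.

Lemma measurable_superlevel f l : measurable_fun I f -> measurable (superlevel f l).
Proof.
move=> mf; have : measurable_fun I (fun t => `|f t|%R).
  exact: measurableT_comp.
move=> /(_ mI `]l, +oo[%classic (measurable_itv _)).
rewrite (_ : _ `&` _ = superlevel f l)//.
by apply/seteqP; split => t []; rewrite /= in_itv/= andbT.
Qed.

Lemma superlevel_sub f l : superlevel f l `<=` I.
Proof. by move=> t []. Qed.

Lemma le_mu_superlevel f (l l' : R) : measurable_fun I f -> (l <= l')%R ->
  mu (superlevel f l') <= mu (superlevel f l).
Proof.
move=> mf ll'; apply: le_measure; rewrite ?inE; try exact: measurable_superlevel.
by move=> t [It /= lt]; split => //; exact: le_lt_trans lt.
Qed.

(** The Galois connection between rearrangement and distribution function, through which every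
    property of [rearr] is obtained. The direction from right to left is the right continuity of the
    distribution function: the levels [l + 1 / (n + 1)] exhaust the superlevel set at [l]. *)
Lemma rearr_gt f t (l : R) : I t -> (0 <= l)%R -> measurable_fun I f ->
  (l%:E < rearr f t) = ((m t)%:E < mu (superlevel f l)).
Proof.
move=> It l0 mf; apply/idP/idP; last first.
  move=> mtl; pose F n := superlevel f (l + n.+1%:R^-1).
  have UF : \bigcup_n F n = superlevel f l.
    apply/seteqP; split => [s [n _ [Is ls]]|s [Is ls]].
      by split => //; apply: le_lt_trans ls; rewrite lerDl.
    have fsl : (0 < `|f s| - l)%R by rewrite subr_gt0.
    have [n _ Hn] := near_infty_natSinv_lt (PosNum fsl).
    by exists n => //; split => //; have := Hn n (leqnn n); rewrite /= ltrBrDl.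
  have mF n : measurable (F n) by exact: measurable_superlevel.
  have ndF : nondecreasing_seq F.
    move=> a b ab; apply/subsetPset => s [Is ls]; split => //.
    by apply: le_lt_trans ls; rewrite lerD2l lef_pV2 ?posrE// ler_nat.
  have cF := @nondecreasing_cvg_mu _ _ _ mu F mF (bigcup_measurable (fun n _ => mF n)) ndF.
  have [n mn] : exists n, (m t)%:E < mu (F n).
    apply: contrapT => nex; move: mtl; apply/negP; rewrite -leNgt -UF.
    rewrite -(cvg_lim _ cF)//; apply: lime_le; first by apply/cvg_ex; eexists; exact: cF.
    by apply: nearW => n /=; rewrite leNgt; apply/negP => h; apply: nex; exists n.
  apply: (@lt_le_trans _ _ (l + n.+1%:R^-1)%:E); first by rewrite lte_fin ltrDl.
  apply: le_ereal_inf_tmp => _ [k [k0 kt] <-]; rewrite lee_fin leNgt; apply/negP => kl.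
  have := le_mu_superlevel mf (ltW kl).
  by move=> /(lt_le_trans mn)/lt_le_trans/(_ kt); rewrite ltxx.
apply: contraTT; rewrite -!leNgt => h.
apply/lee_addgt0Pr => e e0; apply: ereal_inf_lbound; exists (l + e)%R; last first.
  by rewrite EFinD.
split; first by rewrite ltr_wpDl.
by apply: le_trans (le_mu_superlevel mf _) h; rewrite lerDl ltW.
Qed.

Lemma rearr_ge0 f t : 0 <= rearr f t.
Proof. by apply: le_ereal_inf_tmp => _ [l [l0 _] <-]; rewrite lee_fin ltW. Qed.

Lemma le_rearr f g t : measurable_fun I f -> measurable_fun I g -> I t ->
  (forall l : R, (0 <= l)%R -> mu (superlevel f l) <= mu (superlevel g l)) ->
  rearr f t <= rearr g t.
Proof.
move=> mf mg It fg; apply: le_of_superlevel; first exact: rearr_ge0.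
by move=> l l0; rewrite !rearr_gt// => /lt_le_trans; apply; exact: fg.
Qed.

Lemma le_mu_superlevel_ae f g l : measurable_fun I f -> measurable_fun I g ->
  {ae mu, forall t, I t -> (`|f t| <= `|g t|)%R} ->
  mu (superlevel f l) <= mu (superlevel g l).
Proof.
move=> mf mg [N [mN N0 fgN]].
rewrite -(measureU0 (measurable_superlevel l mg) mN N0).
apply: le_measure; rewrite ?inE; [exact: measurable_superlevel|apply: measurableU => //;exact: measurable_superlevel|].
move=> t [It /= lt]; have [fg|fg] := leP `|f t|%R `|g t|%R.
  by left; split => //; exact: lt_le_trans fg.
by right; apply: fgN => /(_ It); rewrite leNgt fg.
Qed.

Lemma le_rearr_ae f g t : measurable_fun I f -> measurable_fun I g -> I t ->
  {ae mu, forall t, I t -> (`|f t| <= `|g t|)%R} -> rearr f t <= rearr g t.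
Proof. by move=> mf mg It fg; apply: le_rearr => // l l0; exact: le_mu_superlevel_ae. Qed.

Lemma le_rearr_norm f g t : measurable_fun I f -> measurable_fun I g -> I t ->
  (forall t, I t -> (`|f t| <= `|g t|)%R) -> rearr f t <= rearr g t.
Proof. by move=> mf mg It fg; apply: le_rearr_ae => //; exact: aeW. Qed.

Lemma measurable_funZ f (k : R) : measurable_fun I f -> measurable_fun I (k *: f)%R.
Proof. by move=> mf; apply: measurable_funM. Qed.

Lemma rearrZ f t (k : R) : measurable_fun I f -> I t ->
  rearr (k *: f)%R t = `|k|%:E * rearr f t.
Proof.
move=> mf It; have [->|k0] := eqVneq k 0%R.
  rewrite normr0 mul0e; apply/eqP; rewrite eq_le rearr_ge0 andbT.
  apply: le_of_superlevel => // l l0; rewrite rearr_gt//; last exact: measurable_funZ.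
  rewrite (_ : superlevel _ _ = set0) ?measure0; last first.
    by apply/seteqP; split => // s [_]; rewrite scale0r/= normr0 ltNge l0.
  by rewrite lte_fin ltNge (wl_pos_ge0 H).
have ak0 : (0 < `|k|)%R by rewrite normr_gt0.
apply: eq_of_superlevel; rewrite ?mule_ge0 ?rearr_ge0// => l l0.
rewrite rearr_gt//; last exact: measurable_funZ.
rewrite -(@lte_pdivrMl _ `|k|)// -EFinM rearr_gt//; last by rewrite mulr_ge0// invr_ge0.
congr (_ < mu _); apply/seteqP; split => s [Is ls]; split => //; move: ls;
by rewrite /GRing.scale/= normrM -ltr_pdivrMl// mulrC.
Qed.

Lemma superlevel_rearr f (l : R) : (0 <= l)%R -> measurable_fun I f ->
  I `&` [set t | l%:E < rearr f t] = segment (mu (superlevel f l)).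
Proof.
move=> l0 mf; apply/seteqP; split => t [It /= h]; split => //=.
  by rewrite -rearr_gt.
by rewrite rearr_gt.
Qed.

Lemma rearr_decr f s t : measurable_fun I f -> I s -> I t -> (m s <= m t)%R ->
  rearr f t <= rearr f s.
Proof.
move=> mf Is It st; apply: le_of_superlevel; first exact: rearr_ge0.
by move=> l l0; rewrite !rearr_gt//; apply: le_lt_trans; rewrite lee_fin.
Qed.

Lemma measurable_rearr f : measurable_fun I f -> measurable_fun I (rearr f).
Proof. by move=> mf; apply: measurable_decr => s t Is It; exact: rearr_decr. Qed.

Lemma measurable_comp_rearr (G : \bar R -> \bar R) f : measurable_fun I f ->
  (forall x y, 0 <= x -> x <= y -> G x <= G y) -> measurable_fun I (G \o rearr f).
Proof.
move=> mf GG; apply: measurable_decr => s t Is It st /=.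
by apply: GG; rewrite ?rearr_ge0// rearr_decr.
Qed.

Lemma segment_max (c c' : \bar R) : segment c `|` segment c' = segment (maxe c c').
Proof.
apply/seteqP; split => t.
  by move=> [[It /= h]|[It /= h]]; split => //=; rewrite lt_max h ?orbT.
by move=> [It]; rewrite /= lt_max => /orP[h|h]; [left|right].
Qed.

(* A function whose superlevel sets are initial segments is its own
   rearrangement. *)
Lemma rearr_segment (u : T -> R) (G : T -> \bar R) (c : R -> \bar R) t :
  measurable_fun I u -> (forall s, I s -> 0 <= G s) ->
  {ae mu, forall s, I s -> `|u s|%:E = G s} ->
  (forall l, (0 <= l)%R -> I `&` [set s | l%:E < G s] = segment (c l)) ->
  (forall l, (0 <= l)%R -> mu (segment (c l)) = c l) ->
  I t -> rearr u t = G t.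
Proof.
move=> mu_ G0 uG Gc cmu It; apply: eq_of_superlevel; rewrite ?rearr_ge0 ?G0// => l l0.
rewrite rearr_gt//.
have -> : mu (superlevel u l) = mu (I `&` [set s | l%:E < G s]).
  case: uG => N [mN N0 uGN].
  have e : I `&` [set s | l%:E < G s] `|` N = superlevel u l `|` N.
    apply/seteqP; split => s [[Is /= h]|]; try (by right);
    (have [Ns|Ns] := pselect (N s); [by right|left]); split => //=;
    have := contra_notP (uGN s) Ns => /(_ Is).
      by rewrite -lte_fin => ->.
    by move=> <-; rewrite lte_fin.
  rewrite -(measureU0 (measurable_superlevel l mu_) mN N0) -e measureU0//.
  by rewrite Gc//; exact: measurable_segment.
rewrite Gc// cmu//; have := Gc l l0 => /seteqP[/(_ t) h1 /(_ t) h2].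
by apply/idP/idP => h; [have [] := h2 (conj It h)|have [] := h1 (conj It h)].
Qed.

End rearrangement.

(** * Layer-cake formula and smallness of tails *)

Section layer_cake.
Context {R : realType} {d} {T : measurableType d}.
Variable mu : {sigma_finite_measure set T -> \bar R}.
Local Open Scope ereal_scope.
Local Notation leb := (@lebesgue_measure R).

Lemma lebesgue_ray (x : \bar R) : 0 <= x ->
  leb [set l : R | (0 <= l)%R /\ l%:E < x] = x.
Proof.
case: x => [x| |]//; rewrite ?lee_fin => x0.
  rewrite (_ : [set _ | _] = `[0%R, x[%classic).
    rewrite lebesgue_measure_itv/= lte_fin; case: ltP => [_|x0']; first by rewrite sube0.
    by congr EFin; apply/eqP; rewrite eq_le x0 x0'.
  apply/seteqP; split => l /=; rewrite in_itv/= lte_fin; first by move=> [-> ->].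
  by move/andP.
rewrite (_ : [set _ | _] = `[0%R, +oo[%classic).
  by rewrite lebesgue_measure_itv/= ltry oppr0 ?adde0 ?addye.
apply/seteqP; split => l /=; rewrite in_itv/= andbT; first by case.
by move=> ->; rewrite ltry.
Qed.

(** Tonelli on the subgraph [K] of [F], weighted by [v]. Points where [F] is infinite are covered, a
    vertical ray having infinite length. *)
Lemma layer_cake (D : set T) (F : T -> \bar R) (v : T -> R) : measurable D ->
  measurable_fun D F -> (forall t, D t -> 0 <= F t) ->
  measurable_fun D v -> (forall t, D t -> (0 <= v t)%R) ->
  \int[mu]_(t in D) (F t * (v t)%:E) =
  \int[leb]_(l in `[0%R, +oo[) \int[mu]_(t in D `&` [set t | l%:E < F t]) (v t)%:E.
Proof.
move=> mD mF F0 mv v0.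
pose GR := measurableTypeR R.
pose F' := F \_ D; pose v' := (EFin \o v) \_ D.
have F'0 t : 0 <= F' t by rewrite /F'; exact: erestrict_ge0.
have v'0 t : 0 <= v' t by rewrite /v'; apply: erestrict_ge0 => s Ds /=; rewrite lee_fin v0.
have mF' : measurable_fun setT F' by exact: (measurable_restrictT _ mD).1 mF.
have mv' : measurable_fun setT v'.
  by apply: (measurable_restrictT _ mD).1; exact/measurable_EFinP.
pose K : set (T * GR) := [set p | (0 <= p.2)%R /\ p.2%:E < F' p.1].
have mK : measurable K.
  have mK1 : measurable [set p : T * GR | (0 <= p.2)%R].
    have : measurable_fun setT (snd : T * GR -> GR) by exact: measurable_snd.
    move=> /(_ measurableT `[0%R, +oo[%classic (measurable_itv _)).
    rewrite setTI; congr measurable; apply/seteqP.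
    by split => p; rewrite /= in_itv/= andbT.
  have mK2 : measurable [set p : T * GR | p.2%:E < F' p.1].
    rewrite -[X in measurable X]setTI; apply: measurable_lte => //.
      by apply/measurable_EFinP; exact: measurable_snd.
    exact: measurableT_comp mF' measurable_fst.
  rewrite (_ : K = [set p : T * GR | (0 <= p.2)%R] `&` [set p : T * GR | p.2%:E < F' p.1]).
    exact: measurableI.
  by [].
pose f (p : T * GR) : \bar R := v' p.1 * (\1_K p)%:E.
have mf : measurable_fun setT f.
  apply: emeasurable_funM; first exact: measurableT_comp mv' measurable_fst.
  by apply/measurable_EFinP; exact: measurable_indic.
have f0 p : 0 <= f p by rewrite mule_ge0// lee_fin.
transitivity (\int[mu]_t \int[leb]_l f (t, l)).
  rewrite [LHS]integral_mkcond; apply: eq_integral => t _.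
  have mKt : measurable [set l : GR | K (t, l)].
    by have := measurable_xsection t mK; rewrite xsectionE.
  transitivity (v' t * \int[leb]_l (\1_[set l : GR | K (t, l)] l)%:E).
    rewrite integral_indic// setIT /K/= lebesgue_ray// muleC /F' /v' !patchE.
    by case: ifPn => //; rewrite mule0.
  rewrite -ge0_integralZl//.
  by apply/measurable_EFinP; exact: measurable_indic.
rewrite (fubini_tonelli f mf f0) [RHS]integral_mkcond.
apply: eq_integral => l _; rewrite patchE; case: ifPn => [|].
  rewrite inE/= in_itv/= andbT => l0; rewrite [RHS]integral_mkcond.
  apply: eq_integral => t _; rewrite /f/= /v' !patchE indicE.
  have [Dt|Dt] := pselect (D t).
    rewrite (mem_set Dt).
    have [lF|lF] := ltP l%:E (F t).
      rewrite !mem_set ?mule1//; split => //=; by rewrite /F' patchE mem_set.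
    rewrite [(t, l) \in K]memNset; last first.
      by move=> [_] /=; rewrite /F' patchE mem_set//; apply/negP; rewrite -leNgt.
    by rewrite mule0 memNset// => -[_] /=; apply/negP; rewrite -leNgt.
  rewrite (memNset Dt) mul0e memNset//; by case.
rewrite notin_setE/= in_itv/= andbT => l0.
apply: integral0_eq => t _; rewrite /f/= indicE memNset ?mule0// => -[].
by move=> /=.
Qed.

(** Dominated convergence: [G] is finite almost everywhere, so the restrictions of [F] to the sets
    [G > n] tend to 0. The two functions are distinct because the integral of a weighted
    rearrangement has to be cut at levels of the unweighted one. *)
Lemma tail_integral_small (D : set T) (F G : T -> \bar R) (e : R) : measurable D ->
  measurable_fun D F -> (forall t, D t -> 0 <= F t) ->
  measurable_fun D G -> {ae mu, forall t, D t -> G t < +oo} ->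
  \int[mu]_(t in D) F t < +oo -> (0 < e)%R ->
  exists n : nat, \int[mu]_(t in D `&` [set t | n%:R%:E < G t]) F t <= e%:E.
Proof.
move=> mD mF F0 mG Gfin Ffin e0.
have iF : mu.-integrable D F.
  apply/integrableP; split => //; rewrite (_ : \int[mu]_(x in D) `|F x| = \int[mu]_(x in D) F x)//.
  by apply: eq_integral => t; rewrite inE => Dt; rewrite gee0_abs// F0.
pose E n := D `&` [set t | n%:R%:E < G t].
have mE n : measurable (E n) by exact: emeasurable_fun_o_infty.
pose g n := F \_ (E n).
have [|||_ _] := @dominated_convergence _ _ _ mu D mD g (cst 0) F _ (measurable_cst _) _ iF _.
- move=> n; apply/(measurable_restrict _ (mE n) mD) => //.
  by apply: measurable_funS mF => //; exact: subIsetl.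
- apply: filterS Gfin => t /[swap] Dt /(_ Dt) Gt.
  apply: cvg_near_cst; exists (Num.truncn (fine (G t))).+1 => // n /= Nn.
  rewrite /g patchE memNset// => -[_ /=].
  apply/negP; rewrite -leNgt; case: (G t) Gt Nn => [r| |]//= _ Nn; last by rewrite leNye.
  by rewrite lee_fin (le_trans (ltW (truncnS_gt _)))// ler_nat.
- apply: aeW => t n Dt; rewrite /g patchE; case: ifPn => _; first by rewrite gee0_abs ?F0.
  by rewrite abse0 F0.
rewrite integral_cst// mul0e => /fine_cvgP[[M _ HM] cg].
have [N _ HN] : \forall n \near \oo, (`|0 - fine (\int[mu]_(x in D) g n x)| < e)%R.
  by move/cvgrPdist_lt : cg => /(_ e e0).
exists (maxn N M); rewrite -/(E _).
have -> : \int[mu]_(t in E (maxn N M)) F t = \int[mu]_(x in D) g (maxn N M) x.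
  rewrite /g -integral_mkcondr; congr (integral _ _ _).
  by rewrite /E setIA setIid.
have fg : \int[mu]_(x in D) g (maxn N M) x \is a fin_num := HM _ (leq_maxr N M).
rewrite -(fineK fg) lee_fin.
by have := HN _ (leq_maxl N M); rewrite /= sub0r normrN => /ltW/(le_trans (ler_norm _)).
Qed.

End layer_cake.

(** * Positivity, concavity and continuity of the cumulated weight *)

Section weights.
Context {R : realType} {d} {T : measurableType d}.
Context {mu : {sigma_finite_measure set T -> \bar R}} {I : set T} {m w : T -> R}.
Hypothesis H : weighted_line mu I m w.
Local Open Scope ereal_scope.
Local Notation segment := (segment I m).
Local Notation superlevel := (superlevel I).
Local Notation rearr := (rearr mu I m).
Local Notation W := (cumulated_weight mu I m w).
Let mI := wl_dom H.
Let mseg c := measurable_segment H c.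
Implicit Types (f g u : T -> R) (t : T) (c : \bar R) (E F : set T).

Lemma wl_weight_ge0 t : I t -> 0 <= (w t)%:E.
Proof. by move=> It; rewrite lee_fin ltW// (wl_weight_gt0 H). Qed.
Local Hint Resolve wl_weight_ge0 : core.

Lemma measurable_weight E : measurable E -> E `<=` I -> measurable_fun E (EFin \o w).
Proof.
by move=> mE EI; apply/measurable_EFinP; apply: measurable_funS EI (wl_weight H).
Qed.

Lemma measurable_weight_segment c : measurable_fun (segment c) (EFin \o w).
Proof. by apply: measurable_weight; [exact: mseg|exact: segment_sub]. Qed.

Lemma cumulated_weight_ge0 c : 0 <= W c.
Proof. by apply: integral_ge0 => t [It _]; exact: wl_weight_ge0. Qed.

Lemma le_cumulated_weight c c' : c <= c' -> W c <= W c'.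
Proof.
move=> cc'; apply: ge0_subset_integral => //.
- exact: measurable_weight_segment.
- by move=> t [It _]; exact: wl_weight_ge0.
- exact: le_segment.
Qed.

Lemma cumulated_weight_fin c : c < +oo -> W c \is a fin_num.
Proof.
move=> coo; rewrite ge0_fin_numE ?cumulated_weight_ge0//.
case: c coo => [c| |]// _; first exact: wl_cumulated_fin H c.
apply: le_lt_trans (wl_cumulated_fin H 0); exact: le_cumulated_weight (leNye _).
Qed.

Lemma segment0 : segment 0 = set0.
Proof.
apply/seteqP; split => // t [It] /=.
by rewrite lte_fin ltNge (wl_pos_ge0 H).
Qed.

Lemma cumulated_weight0 : W 0 = 0.
Proof. by rewrite /cumulated_weight segment0 integral_set0. Qed.

Lemma segmenty : segment +oo = I.
Proof. by apply/seteqP; split => t; [case|move=> It; split => //=; rewrite ltry]. Qed.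

Lemma cumulated_weight_infty : mu I = +oo -> W +oo = +oo.
Proof. by move=> Ioo; rewrite /cumulated_weight segmenty (wl_cumulated_infty H). Qed.

Lemma cumulated_weight_gt0 E : measurable E -> E `<=` I -> 0 < mu E -> 0 < W (mu E).
Proof.
move=> mE EI E0; rewrite lt0e cumulated_weight_ge0 andbT.
apply: contraTneq E0 => W0; rewrite -leNgt -(wl_segment H mE EI) measure_le0.
have : \int[mu]_(t in segment (mu E)) `|(EFin \o w) t| = 0.
  rewrite -[RHS]W0; apply: eq_integral => t; rewrite inE => -[It _] /=.
  by rewrite ger0_norm// ltW// (wl_weight_gt0 H).
move=> /ae_eq_integral_abs => /(_ (mseg _) (@measurable_weight_segment _))[N [mN N0 sN]].
apply/eqP/(subset_measure0 _ mN _ N0); first exact: mseg.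
move=> t St; apply: sN => /= /(_ St) [] /eqP; rewrite gt_eqF// (wl_weight_gt0 H)//.
by case: St.
Qed.

(** Concavity of W in the form [W c / c] nonincreasing, for masses that sets realize. With the
    threshold [th] of [w] at position [c], the mean of [w] is at least [th] before [c] and at most
    [th] between [c] and [b]. *)
Lemma cumulated_weight_concave E F : measurable E -> E `<=` I -> measurable F -> F `<=` I ->
  mu E <= mu F -> mu F < +oo -> mu E * W (mu F) <= mu F * W (mu E).
Proof.
move=> mE EI mF FI EF Foo.
have Eoo : mu E < +oo by exact: le_lt_trans Foo.
have bfin : mu F \is a fin_num by rewrite ge0_fin_numE.
have cfin : mu E \is a fin_num by rewrite ge0_fin_numE.
have [->|E0] := eqVneq (mu E) 0.
  by rewrite mul0e mule_ge0// cumulated_weight_ge0.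
have segE := wl_segment H mE EI; have segF := wl_segment H mF FI.
move: segE segF; rewrite -(fineK bfin) -(fineK cfin).
set b := fine (mu F); set c := fine (mu E) => segE segF.
have c0 : (0 < c)%R by apply: fine_gt0; rewrite lt0e E0 Eoo measure_ge0.
have cb : (c <= b)%R by rewrite -lee_fin !fineK.
have [th [th0 wle wge]] := wl_threshold H c0.
set A := segment c%:E; set B := segment b%:E.
have {}segE : mu A = c%:E by exact: segE.
have {}segF : mu B = b%:E by exact: segF.
have AB : A `<=` B by apply: le_segment; rewrite lee_fin.
have mBA : measurable (B `\` A) by apply: measurableD; exact: mseg.
have muBA : mu (B `\` A) = (b - c)%:E.
  rewrite EFinB -segF -segE -[in RHS](setIidr AB) measureD//; [exact: mseg|exact: mseg|].
  by rewrite [X in X < _]segF ltry.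
have BAI : B `\` A `<=` I by move=> t [[]].
have WB : W b%:E = W c%:E + \int[mu]_(t in B `\` A) (w t)%:E.
  rewrite /W -/A -/B -ge0_integral_setU//; last 3 first.
  - by rewrite setDUK//; exact: measurable_weight_segment.
  - by move=> t; rewrite setDUK// => -[It _]; exact: wl_weight_ge0.
  - by rewrite disj_set2E setDIK.
  - by rewrite setDUK.
  - exact: mseg.
have W1 : \int[mu]_(t in B `\` A) (w t)%:E <= (th * (b - c))%:E.
  apply: (@le_trans _ _ (\int[mu]_(t in B `\` A) (cst th%:E t))).
    apply: ge0_le_integral => //.
    - by move=> t /BAI; exact: wl_weight_ge0.
    - exact: measurable_weight.
    - move=> t [[It _] nA]; rewrite lee_fin wle//.
      by rewrite leNgt; apply/negP => mc; apply: nA; split => //=; rewrite lte_fin.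
  by rewrite integral_cst//= muBA -EFinM.
have W2 : (th * c)%:E <= W c%:E.
  apply: (@le_trans _ _ (\int[mu]_(t in A) (cst th%:E t))).
    by rewrite EFinM -segE integral_cst//; exact: mseg.
  apply: ae_ge0_le_integral.
  - exact: mseg.
  - by [].
  - by [].
  - by move=> t [It _]; exact: wl_weight_ge0.
  - exact: measurable_weight_segment.
  - apply: filterS wge => t wt [It mt]; by rewrite /cst lee_fin wt.
have W1fin : \int[mu]_(t in B `\` A) (w t)%:E \is a fin_num.
  rewrite ge0_fin_numE; first by apply: le_lt_trans W1 _; rewrite ltry.
  by apply: integral_ge0 => t /BAI; exact: wl_weight_ge0.
rewrite WB; move: W1 W2.
rewrite -(fineK W1fin) -(fineK (cumulated_weight_fin (ltry c))).
set r := fine (integral _ _ _); set v := fine (W _).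
rewrite -EFinD -!EFinM !lee_fin => W1 W2.
have : (c * r <= c * (th * (b - c)))%R by rewrite ler_pM2l.
have : (th * c * (b - c) <= v * (b - c))%R by rewrite ler_wpM2r// subr_ge0.
nra.
Qed.

(** Continuity from below, used twice: for the masses of the [F n], then for the integral of [w]
    over the increasing segments of these lengths. *)
Lemma cumulated_weight_bigcup_le (F : nat -> set T) (B : \bar R) :
  (forall n, measurable (F n)) -> (forall n, F n `<=` I) -> nondecreasing_seq F ->
  (forall n, W (mu (F n)) <= B) -> W (mu (\bigcup_n F n)) <= B.
Proof.
move=> mF FI ndF WB; rewrite /W.
have mUF : measurable (\bigcup_n F n) by exact: bigcup_measurable.
have cmu : mu (F n) @[n --> \oo] --> mu (\bigcup_n F n) by exact: nondecreasing_cvg_mu.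
have nmu : {homo (mu \o F) : n k / (n <= k)%N >-> n <= k}.
  by move=> n k nk; apply: le_measure; rewrite ?inE//; apply/subsetPset; exact: ndF.
have -> : segment (mu (\bigcup_n F n)) = \bigcup_n segment (mu (F n)).
  apply/seteqP; split => [t [It /= mt]|t [n _ [It /= mt]]].
    have [n mn] : exists n, (m t)%:E < mu (F n).
      apply: contrapT => nex; move: mt; apply/negP; rewrite -leNgt.
      rewrite -(cvg_lim _ cmu)//; apply: lime_le; first by apply/cvg_ex; eexists; exact: cmu.
      by apply: nearW => n /=; rewrite leNgt; apply/negP => h; apply: nex; exists n.
    by exists n.
  split => //=; apply: (lt_le_trans mt); apply: le_measure; rewrite ?inE//.
  exact: bigcup_sup.
pose S n := segment (mu (F n)).
have ndS : nondecreasing_seq S.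
  by move=> n k nk; apply/subsetPset; apply: le_segment; exact: nmu.
have mS n : measurable (S n) by exact: mseg.
have mwS n : measurable_fun (S n) (EFin \o w) by exact: measurable_weight_segment.
have wS n t : S n t -> 0 <= (EFin \o w) t by move=> [It _]; exact: wl_weight_ge0.
have cW := ge0_nondecreasing_set_cvg_integral (mu := mu) ndS mS mwS wS.
rewrite -(cvg_lim _ cW)//; apply: lime_le; last exact: nearW.
by apply/cvg_ex; eexists; exact: cW.
Qed.
End weights.

(** * Subadditivity of W and of the modular, and a Hardy-Littlewood inequality *)

Section modulars.
Context {R : realType} {d} {T : measurableType d}.
Context {mu : {sigma_finite_measure set T -> \bar R}} {I : set T} {m w : T -> R}.
Hypothesis H : weighted_line mu I m w.
Local Open Scope ereal_scope.
Local Notation segment := (segment I m).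
Local Notation superlevel := (superlevel I).
Local Notation rearr := (rearr mu I m).
Local Notation W := (cumulated_weight mu I m w).
Let mI := wl_dom H.
Let mseg c := measurable_segment H c.
Implicit Types (f g u : T -> R) (t : T) (c : \bar R) (E : set T) (F : nat -> set T).

(** If one [F i] has at least the mass of [E], monotonicity suffices. Otherwise concavity bounds
    each [W (mu (F i))] below by the fraction [mu (F i) / mu E] of [W (mu E)], and these fractions
    add up to at least 1. *)
Lemma cumulated_weight_sum_le E F n : measurable E -> E `<=` I ->
  (forall i, measurable (F i)) -> (forall i, F i `<=` I) -> mu E < +oo ->
  mu E <= \sum_(i < n) mu (F i) -> W (mu E) <= \sum_(i < n) W (mu (F i)).
Proof.
move=> mE EI mF FI Eoo EF.
have W0 c : 0 <= W c by exact: cumulated_weight_ge0 H c.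
have [[i Ei]|nEi] := pselect (exists i : 'I_n, mu E <= mu (F i)).
  rewrite (bigD1 i)//=; apply: (le_trans (le_cumulated_weight H Ei)).
  by rewrite leeDl// sume_ge0.
have [->|E0] := eqVneq (mu E) 0; first by rewrite (cumulated_weight0 H) sume_ge0.
have Efin : mu E \is a fin_num by rewrite ge0_fin_numE.
rewrite -(@lee_pmul2l _ (mu E))//; last by rewrite lt0e E0 measure_ge0.
apply: (@le_trans _ _ ((\sum_(i < n) mu (F i)) * W (mu E))).
  by rewrite lee_wpmul2r.
rewrite ge0_sume_distrl// ge0_sume_distrr//.
apply: lee_sum => i _; apply: (cumulated_weight_concave H) => //.
by rewrite ltW// ltNge; apply/negP => h; apply: nEi; exists i.
Qed.

Lemma cumulated_weight_subadditive E F : measurable E -> E `<=` I ->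
  (forall i, measurable (F i)) -> (forall i, F i `<=` I) -> E `<=` \bigcup_i F i ->
  W (mu E) <= \sum_(i <oo) W (mu (F i)).
Proof.
move=> mE EI mF FI EF.
have W0 c : 0 <= W c by exact: cumulated_weight_ge0 H c.
(* A set of infinite mass dominates alone; once this is excluded the sets [G n] have finite mass. *)
have [[i Fioo]|Ffin] := pselect (exists i, mu (F i) = +oo).
  apply: (@le_trans _ _ (W (mu (F i)))).
    by rewrite Fioo; apply: le_cumulated_weight H _ _ (leey _).
  apply: le_trans (nneseries_lim_ge i.+1 _); last by move=> *; exact: W0.
  by rewrite big_nat_recr//= leeDr// sume_ge0.
pose G n := E `&` \bigcup_(i < n) F i.
have mG n : measurable (G n) by apply: measurableI => //; exact: bigcup_measurable.
have GI n : G n `<=` I by move=> t [/EI].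
have -> : E = \bigcup_n G n.
  apply/seteqP; split => [t Et|t [n _ []]//].
  by have [i _ Fit] := EF t Et; exists i.+1 => //; split => //; exists i => /=.
apply: (cumulated_weight_bigcup_le H) => //.
  move=> a b ab; apply/subsetPset => t [Et [i /= ia Fit]].
  by split => //; exists i => //=; exact: leq_trans ab.
move=> n; apply: le_trans (nneseries_lim_ge n _); last by move=> *; exact: W0.
have GF : mu (G n) <= \sum_(i < n) mu (F i).
  have : G n `<=` \big[setU/set0]_(i < n) F i by rewrite -bigcup_mkord; exact: subIsetr.
  by move=> /content_subadditive; apply.
rewrite big_mkord; apply: cumulated_weight_sum_le => //.
apply: le_lt_trans GF _; apply: lte_sum_pinfty => i _.
by rewrite ltey; apply/eqP => Fioo; apply: Ffin; exists i.
Qed.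

Lemma superlevel_level (G : \bar R -> \bar R) f (l c : R) : measurable_fun I f ->
  (0 <= c)%R -> (forall x, 0 <= x -> (l%:E < G x) = (c%:E < x)) ->
  I `&` [set t | l%:E < G (rearr f t)] = segment (mu (superlevel f c)).
Proof.
move=> mf c0 Gc; rewrite -(superlevel_rearr H)//.
by apply/seteqP; split => t [It /=]; rewrite Gc ?rearr_ge0//.
Qed.

Lemma measurable_tail (D : set T) (F : T -> \bar R) : measurable D -> D `<=` I ->
  measurable_fun D F ->
  measurable_fun (`[0%R, +oo[%classic : set R)
    (fun l : R => \int[mu]_(t in D `&` [set t | l%:E < F t]) (w t)%:E).
Proof.
move=> mD DI mF; apply: (@measurable_antitone R _ _ _ id) => //.
move=> a b _ _ ab; apply: ge0_subset_integral.
- exact: emeasurable_fun_o_infty.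
- exact: emeasurable_fun_o_infty.
- apply: (measurable_weight H); first exact: emeasurable_fun_o_infty.
  by move=> t [/DI].
- by move=> t [/DI It _]; exact: wl_weight_ge0 H t It.
- by move=> t [Dt /= bt]; split => //=; apply: le_lt_trans bt; rewrite lee_fin.
Qed.

(** By the layer-cake formula the modular is the integral over [l] of W at the mass of a superlevel
    set, so inclusion of superlevel sets and subadditivity of W replace the missing additivity of
    rearrangements. It serves both for stability of the space under sums and for the infinite sum of
    blocks. *)
Lemma modular_le_series (phi : R -> R) (k : T -> R) (f : nat -> T -> R) :
  N_function phi -> measurable_fun I k -> (forall i, measurable_fun I (f i)) ->
  (forall l, (0 <= l)%R -> superlevel k l `<=` \bigcup_i superlevel (f i) l) ->
  modular mu I m w (EFin \o phi) k <=
  \sum_(i <oo) modular mu I m w (EFin \o phi) (f i).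
Proof.
move=> phiN mk mf kf.
pose G := ext_at_infty (EFin \o phi).
have mG g : measurable_fun I g -> measurable_fun I (G \o rearr g).
  move=> mg; apply: (measurable_comp_rearr H) => // x y; exact: ephi_le.
have cake g : measurable_fun I g -> modular mu I m w (EFin \o phi) g =
    \int[@lebesgue_measure R]_(l in `[0%R, +oo[)
      \int[mu]_(t in I `&` [set t | l%:E < (G \o rearr g) t]) (w t)%:E.
  move=> mg; rewrite -layer_cake//.
  - exact: mG.
  - by move=> t It /=; apply: ephi_ge0 => //; exact: rearr_ge0.
  - exact: wl_weight H.
  - by move=> t It; rewrite ltW// (wl_weight_gt0 H).
have nn g l : 0 <= \int[mu]_(t in I `&` [set t | l%:E < (G \o rearr g) t]) (w t)%:E.
  by apply: integral_ge0 => t [It _]; exact: wl_weight_ge0 H t It.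
rewrite cake//; under eq_eseriesr do rewrite cake//.
rewrite -integral_nneseries//; last first.
  by move=> i; apply: measurable_tail => //; exact: mG.
apply: ge0_le_integral => //.
- by apply: measurable_tail => //; exact: mG.
- apply: ge0_emeasurable_sum => // i _ _.
  by apply: measurable_tail => //; exact: mG.
move=> l; rewrite /= in_itv/= andbT => l0.
have [c c0 Gc] := Orlicz_level phiN l0.
rewrite (superlevel_level mk c0 Gc).
under eq_eseriesr do rewrite (superlevel_level (mf _) c0 Gc).
apply: cumulated_weight_subadditive; first exact: (measurable_superlevel H).
- exact: superlevel_sub.
- by move=> i; exact: (measurable_superlevel H).
- by move=> i; exact: superlevel_sub.
- exact: kf.
Qed.

(** The mean of [|f|] over [E] is compared with the [w]-mean of its rearrangement. Level by level,
    the part [A] of [E] where [|f| > l] satisfies [mu A * W (mu E) <= mu E * W (mu A)] by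
    concavity. *)
Lemma Hardy_Littlewood f E : measurable_fun I f -> measurable E -> E `<=` I ->
  mu E < +oo ->
  W (mu E) * \int[mu]_(t in E) `|f t|%:E <=
  mu E * \int[mu]_(t in segment (mu E)) (rearr f t * (w t)%:E).
Proof.
move=> mf mE EI Eoo.
have segI c : segment c `<=` I by exact: segment_sub.
have mabs : measurable_fun E (fun t => `|f t|%:E).
  apply/measurable_EFinP; apply: measurableT_comp => //.
  exact: measurable_funS EI mf.
have -> : \int[mu]_(t in E) `|f t|%:E = \int[mu]_(t in E) (`|f t|%:E * (cst 1%R t)%:E).
  by apply: eq_integral => t _; rewrite mule1.
rewrite (layer_cake mu mE mabs (v := cst 1%R)); last 3 first.
- by move=> t _; rewrite lee_fin.
- exact: measurable_cst.
- by move=> t _; exact: ler01.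
have mr : measurable_fun (segment (mu E)) (rearr f).
  by apply: measurable_funS (segI _) _ => //; exact: (measurable_rearr H).
rewrite (layer_cake mu (mseg _) mr); last 3 first.
- by move=> t _; exact: rearr_ge0.
- exact: measurable_funS (segI _) (wl_weight H).
- by move=> t [It _]; rewrite ltW// (wl_weight_gt0 H).
have W0 c : 0 <= W c by exact: cumulated_weight_ge0 H c.
have mtail1 : measurable_fun (`[0%R, +oo[%classic : set R)
    (fun l : R => \int[mu]_(t in E `&` [set t | l%:E < `|f t|%:E]) (cst 1%R t)%:E).
  apply: (@measurable_antitone R _ _ _ id) => // a b _ _ ab.
  apply: ge0_subset_integral => //; try exact: emeasurable_fun_o_infty.
    by apply/measurable_EFinP; exact: measurable_cst.
  by move=> t [Dt /= bt]; split => //=; apply: le_lt_trans bt; rewrite lee_fin.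
have mtail2 : measurable_fun (`[0%R, +oo[%classic : set R)
    (fun l : R => \int[mu]_(t in segment (mu E) `&` [set t | l%:E < rearr f t]) (w t)%:E).
  exact: measurable_tail.
have nn2 l : 0 <= \int[mu]_(t in segment (mu E) `&` [set t | l%:E < rearr f t]) (w t)%:E.
  by apply: integral_ge0 => t [[It _] _]; exact: wl_weight_ge0 H t It.
rewrite -ge0_integralZl//; last by move=> l _; exact: integral_ge0.
rewrite -ge0_integralZl//.
apply: ge0_le_integral => //.
- by move=> l _; rewrite mule_ge0// integral_ge0.
- by apply: emeasurable_funM.
- by apply: emeasurable_funM.
move=> l; rewrite /= in_itv/= andbT => l0.
set A := E `&` _.
have mA : measurable A by exact: emeasurable_fun_o_infty.
have AI : A `<=` I by move=> t [/EI].
have AE : mu A <= mu E by apply: le_measure; rewrite ?inE//; exact: subIsetl.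
rewrite integral_cst// mul1e muleC.
apply: le_trans (cumulated_weight_concave H mA AI mE EI AE Eoo) _.
rewrite lee_wpmul2l//; apply: ge0_subset_integral => //.
- exact: emeasurable_fun_o_infty.
- apply: (measurable_weight H); first exact: emeasurable_fun_o_infty.
  by move=> t [[]].
- by move=> t [[It _] _]; exact: wl_weight_ge0 H t It.
- move=> t [It /= mt]; split; first by split => //=; exact: lt_le_trans AE.
  rewrite /= (rearr_gt H)//; apply: (lt_le_trans mt); apply: le_measure; rewrite ?inE//.
    exact: (measurable_superlevel H).
  by move=> s [/EI Is /=]; rewrite lte_fin.
Qed.

End modulars.

(** * The Orlicz norm *)

Section Lorentz_norms.
Context {R : realType} {d} {T : measurableType d}.
Context {mu : {sigma_finite_measure set T -> \bar R}} {I : set T} {m w : T -> R}.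
Context {phi : R -> R}.
Hypotheses (H : weighted_line mu I m w) (phiN : N_function phi).
Local Open Scope ereal_scope.
Local Notation segment := (segment I m).
Local Notation superlevel := (superlevel I).
Local Notation rearr := (rearr mu I m).
Local Notation W := (cumulated_weight mu I m w).
Local Notation psi := (complementary phi).
Local Notation rho := (modular mu I m w (EFin \o phi)).
Local Notation rhos := (modular mu I m w psi).
Local Notation X := (Lorentz_space mu I m w phi).
Local Notation N := (Lorentz_norm mu I m w phi).
Local Notation pairing := (pairing mu I m w).
Let mI := wl_dom H.
Let mseg c := measurable_segment H c.
Let mw : measurable_fun I (EFin \o w).
Proof. exact: (measurable_weight H mI). Qed.
Implicit Types (f g u : T -> R) (t : T) (c : \bar R) (E : set T).

Lemma measurable_ephi_rearr f : measurable_fun I f ->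
  measurable_fun I (fun t => ext_at_infty (EFin \o phi) (rearr f t) * (w t)%:E).
Proof.
move=> mf; apply: emeasurable_funM; last exact: mw.
by apply: (measurable_comp_rearr H) => // x y; exact: ephi_le.
Qed.

Lemma measurable_epsi_rearr f : measurable_fun I f ->
  measurable_fun I (fun t => ext_at_infty psi (rearr f t) * (w t)%:E).
Proof.
move=> mf; apply: emeasurable_funM; last exact: mw.
by apply: (measurable_comp_rearr H) => // x y; exact: epsi_le.
Qed.

Lemma measurable_rearr_weight f : measurable_fun I f ->
  measurable_fun I (fun t => rearr f t * (w t)%:E).
Proof.
move=> mf; apply: emeasurable_funM; last exact: mw.
exact: (measurable_rearr H).
Qed.

Lemma measurable_pairing f g : measurable_fun I f -> measurable_fun I g ->
  measurable_fun I (fun t => rearr f t * rearr g t * (w t)%:E).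
Proof.
move=> mf mg; apply: emeasurable_funM; last exact: mw.
by apply: emeasurable_funM; exact: (measurable_rearr H).
Qed.

Lemma ephi_rearr_ge0 f t : I t -> 0 <= ext_at_infty (EFin \o phi) (rearr f t) * (w t)%:E.
Proof.
by move=> It; rewrite mule_ge0 ?(wl_weight_ge0 H)//; apply: ephi_ge0 => //; exact: rearr_ge0.
Qed.

Lemma epsi_rearr_ge0 f t : I t -> 0 <= ext_at_infty psi (rearr f t) * (w t)%:E.
Proof. by move=> It; rewrite mule_ge0 ?(wl_weight_ge0 H)//; exact: epsi_ge0. Qed.

Lemma rearr_weight_ge0 f t : I t -> 0 <= rearr f t * (w t)%:E.
Proof. by move=> It; rewrite mule_ge0 ?(wl_weight_ge0 H)// rearr_ge0. Qed.

Lemma pairing_term_ge0 f g t : I t -> 0 <= rearr f t * rearr g t * (w t)%:E.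
Proof. by move=> It; rewrite !mule_ge0 ?(wl_weight_ge0 H)// rearr_ge0. Qed.

Lemma le_modular f g : measurable_fun I f -> measurable_fun I g ->
  {ae mu, forall t, I t -> (`|f t| <= `|g t|)%R} -> rho f <= rho g.
Proof.
move=> mf mg fg; apply: ge0_le_integral => //.
- by move=> t; exact: ephi_rearr_ge0.
- exact: measurable_ephi_rearr.
- exact: measurable_ephi_rearr.
- move=> t It; rewrite lee_wpmul2r ?(wl_weight_ge0 H)//.
  by apply: ephi_le; rewrite ?rearr_ge0//; exact: (le_rearr_ae H).
Qed.

Lemma le_Lorentz_norm f g : measurable_fun I f -> measurable_fun I g ->
  {ae mu, forall t, I t -> (`|f t| <= `|g t|)%R} -> N f <= N g.
Proof.
move=> mf mg fg; apply: ge_ereal_sup => _ [h [mh hh] <-].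
apply: (@le_trans _ _ (pairing g h)); last by apply: ereal_sup_ubound; exists h.
apply: ge0_le_integral => //.
- by move=> t; exact: pairing_term_ge0.
- exact: measurable_pairing.
- exact: measurable_pairing.
- move=> t It; rewrite lee_wpmul2r ?(wl_weight_ge0 H)//.
  by rewrite lee_wpmul2r ?rearr_ge0//; exact: (le_rearr_ae H).
Qed.

Lemma rearr0 t : I t -> rearr 0%R t = 0.
Proof.
move=> It; have := rearrZ H 0%R (measurable_cst (0%R : R)) It (f := cst 0%R).
by rewrite scale0r normr0 mul0e.
Qed.

Lemma modular_cst0 (G : R -> \bar R) : G 0%R = 0 -> modular mu I m w G 0%R = 0.
Proof. by move=> G0; apply: integral0_eq => t It; rewrite rearr0//= G0 mul0e. Qed.

Lemma Lorentz_norm_ge0 f : 0 <= N f.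
Proof.
apply: (@le_trans _ _ (pairing f 0%R)); first by apply: integral_ge0 => t; exact: pairing_term_ge0.
apply: ereal_sup_ubound; exists 0%R => //; split => /=; first exact: measurable_cst.
by rewrite modular_cst0 ?complementary0.
Qed.

Lemma Lorentz_normZ_le f (k : R) : measurable_fun I f -> N (k *: f)%R <= `|k|%:E * N f.
Proof.
move=> mf; apply: ge_ereal_sup => _ [g [mg hg] <-].
apply: (@le_trans _ _ (`|k|%:E * pairing f g)).
  rewrite -ge0_integralZl//; first last.
  - by move=> t; exact: pairing_term_ge0.
  - exact: measurable_pairing.
  rewrite le_eqVlt; apply/orP; left; apply/eqP; apply: eq_integral => t.
  by rewrite inE => It; rewrite (rearrZ H)// !muleA.
by rewrite lee_wpmul2l// ?lee_fin//; apply: ereal_sup_ubound; exists g.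
Qed.

Lemma Lorentz_space_le f g : measurable_fun I f -> X g ->
  (forall t, I t -> (`|f t| <= `|g t|)%R) -> X f.
Proof.
move=> mf [mg [l l0 gfin]] fg; split; [exact: mf|exists l; first exact: l0].
apply: le_lt_trans gfin; apply: le_modular; [exact: measurable_funZ|exact: measurable_funZ|].
by apply: aeW => t It; rewrite !fctE !normrM ler_wpM2l ?fg.
Qed.

Lemma Lorentz_space_lin (a : R) f g : X f -> X g -> X (a *: f + g)%R.
Proof.
move=> [mf [l1 l10 ffin]] [mg [l2 l20 gfin]].
have mafg : measurable_fun I (a *: f + g)%R.
  by apply: measurable_funD => //; exact: measurable_funZ.
(* [l * (a f + g)] is the mean of [2 l a f] and [2 l g], so it exceeds a level only where one of
   them does. The choice of [l] ensures [2 l |a| <= l1] and [2 l <= l2]. *)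
split => //; pose l := Num.min (l1 / (2 * (`|a| + 1)))%R (l2 / 2)%R.
have a1 : (0 < 2 * (`|a| + 1))%R by rewrite mulr_gt0// ltr_wpDl.
have l0 : (0 < l)%R by rewrite lt_min !divr_gt0.
exists l; first exact: l0.
(* The two functions are padded with zeros to fit the countable estimate. *)
pose h i := if i is 0 then (2 * l * a) *: f else if i is 1 then (2 * l) *: g else 0%R.
have mh i : measurable_fun I (h i).
  case: i => [|[|i]]; [exact: measurable_funZ|exact: measurable_funZ|exact: measurable_cst].
have rho0 i : 0 <= rho (h i) by apply: integral_ge0 => t; exact: ephi_rearr_ge0.
apply: (@le_lt_trans _ _ (\sum_(i <oo) rho (h i))).
  apply: (modular_le_series H phiN) => //; first exact: measurable_funZ.
  move=> r r0 t [It rt].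
  have [h1|h1] := ltP r `|h 0%N t|%R; first by exists 0%N.
  have [h2|h2] := ltP r `|h 1%N t|%R; first by exists 1%N.
  move: rt h1 h2; rewrite /h /GRing.scale/= => rt h1 h2.
  have e : (2 * (l * (a * f t + g t)) = 2 * l * a * f t + 2 * l * g t)%R by ring.
  have := ler_normD (2 * l * a * f t)%R (2 * l * g t)%R.
  by rewrite -e normrM (ger0_norm (_ : 0 <= 2)%R)//; lra.
rewrite (nneseries_split 0 2)// big_mkord !big_ord_recr/= big_ord0 add0e.
rewrite ereal_series_cond eseries0 ?adde0; last first.
  move=> [//|[//|i]] _ _; rewrite [h _]/(0%R : T -> R) modular_cst0//=.
  by rewrite (Orlicz0 phiN).
apply: lte_add_pinfty.
  apply: le_lt_trans ffin; apply: le_modular; [exact: measurable_funZ|exact: measurable_funZ|].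
  apply: aeW => t _; rewrite !fctE /GRing.scale/= !normrM ler_wpM2r//.
  rewrite (ger0_norm (_ : 0 <= 2)%R)// (gtr0_norm l0) (gtr0_norm l10).
  have : (l <= l1 / (2 * (`|a| + 1)))%R by rewrite ge_min lexx.
  rewrite ler_pdivlMr// => ll1; have := normr_ge0 a; nra.
apply: le_lt_trans gfin; apply: le_modular; [exact: measurable_funZ|exact: measurable_funZ|].
apply: aeW => t _; rewrite !fctE /GRing.scale/= !normrM ler_wpM2r//.
rewrite (ger0_norm (_ : 0 <= 2)%R)// (gtr0_norm l0) (gtr0_norm l20).
have : (l <= l2 / 2)%R by rewrite ge_min lexx orbT.
by rewrite ler_pdivlMr//; lra.
Qed.

Lemma Young_rearr f g (l : R) t : measurable_fun I f -> I t -> (0 < l)%R ->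
  l%:E * (rearr f t * rearr g t * (w t)%:E) <=
  ext_at_infty (EFin \o phi) (rearr (l *: f)%R t) * (w t)%:E +
  ext_at_infty psi (rearr g t) * (w t)%:E.
Proof.
move=> mf It l0; rewrite !muleA -ge0_muleDl; first last.
- exact: epsi_ge0.
- by apply: ephi_ge0 => //; exact: rearr_ge0.
rewrite lee_wpmul2r ?(wl_weight_ge0 H)//.
have -> : l%:E * rearr f t = rearr (l *: f)%R t by rewrite (rearrZ H)// gtr0_norm.
by apply: ext_Young; rewrite ?rearr_ge0.
Qed.

Lemma pairing_Young f g (l : R) : measurable_fun I f -> measurable_fun I g ->
  (0 < l)%R -> l%:E * pairing f g <= rho (l *: f)%R + rhos g.
Proof.
move=> mf mg l0; rewrite -ge0_integralD//; first last.
- exact: measurable_epsi_rearr.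
- by move=> t; exact: epsi_rearr_ge0.
- by apply: measurable_ephi_rearr; exact: measurable_funZ.
- by move=> t; exact: ephi_rearr_ge0.
rewrite -ge0_integralZl ?lee_fin ?(ltW l0)//; first last.
- by move=> t; exact: pairing_term_ge0.
- exact: measurable_pairing.
apply: ge0_le_integral => //.
- by move=> t It; rewrite mule_ge0 ?lee_fin ?(ltW l0)// pairing_term_ge0.
- by apply: emeasurable_funM => //; exact: measurable_pairing.
- apply: emeasurable_funD; last exact: measurable_epsi_rearr.
  by apply: measurable_ephi_rearr; exact: measurable_funZ.
- by move=> t It; exact: Young_rearr.
Qed.

Lemma Lorentz_norm_fin f : X f -> N f < +oo.
Proof.
move=> [mf [l l0 ffin]].
apply: (@le_lt_trans _ _ (l^-1%:E * (rho (l *: f)%R + 1))).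
  apply: ge_ereal_sup => _ [g [mg hg] <-].
  rewrite lee_pdivlMl//; apply: (le_trans (pairing_Young mf mg l0)).
  by rewrite leeD2l.
by rewrite lte_mul_pinfty ?lee_fin ?invr_ge0 ?(ltW l0)// lte_add_pinfty// ltry.
Qed.

(** Young's inequality with the constant [K] as first factor. [K = 1] bounds all test functions
    uniformly on a segment; a large [K] makes their integral small over a segment of small
    weight. *)
Lemma rearr_segment_weight_le g c (K : R) : measurable_fun I g -> (0 < K)%R -> rhos g <= 1 ->
  K%:E * \int[mu]_(t in segment c) (rearr g t * (w t)%:E) <= (phi K)%:E * W c + 1.
Proof.
move=> mg K0 g1.
have segI : segment c `<=` I by exact: segment_sub.
apply: (@le_trans _ _ (\int[mu]_(t in segment c)
    ((phi K)%:E * (w t)%:E + ext_at_infty psi (rearr g t) * (w t)%:E))).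
  rewrite -ge0_integralZl ?lee_fin ?(ltW K0)//; first last.
  - by move=> t /segI; exact: rearr_weight_ge0.
  - exact: measurable_funS segI (measurable_rearr_weight mg).
  apply: ge0_le_integral => //.
  - by move=> t /segI It; rewrite mule_ge0 ?lee_fin ?(ltW K0)// rearr_weight_ge0.
  - by apply: emeasurable_funM => //; exact: measurable_funS segI (measurable_rearr_weight mg).
  - apply: emeasurable_funD; last exact: measurable_funS segI (measurable_epsi_rearr mg).
    by apply: emeasurable_funM => //; exact: (measurable_weight_segment H).
  - move=> t /segI It; rewrite muleA -ge0_muleDl; first last.
    + exact: epsi_ge0.
    + by rewrite lee_fin (Orlicz_ge0 phiN)// ltW.
    rewrite lee_wpmul2r ?(wl_weight_ge0 H)//.
    by have := ext_Young phiN (x := K%:E) (y := rearr g t); apply; rewrite ?rearr_ge0// lee_fin ltW.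
rewrite ge0_integralD//; first last.
- exact: measurable_funS segI (measurable_epsi_rearr mg).
- by move=> t /segI; exact: epsi_rearr_ge0.
- by apply: emeasurable_funM => //; exact: (measurable_weight_segment H).
- by move=> t /segI It; rewrite mule_ge0 ?(wl_weight_ge0 H)// lee_fin (Orlicz_ge0 phiN)// ltW.
rewrite ge0_integralZl//; first last.
- by rewrite lee_fin (Orlicz_ge0 phiN)// ltW.
- by move=> t /segI It; exact: wl_weight_ge0 H t It.
- exact: (measurable_weight_segment H).
rewrite leeD2l//; apply: le_trans g1.
apply: ge0_subset_integral => //; first exact: measurable_epsi_rearr.
by move=> t; exact: epsi_rearr_ge0.
Qed.

(** Young's inequality again, now with the constant 1 in the place of the test function. *)
Lemma rearr_segment_weight_fin f (c : R) : X f ->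
  \int[mu]_(t in segment c%:E) (rearr f t * (w t)%:E) < +oo.
Proof.
move=> [mf [l l0 ffin]].
have segI : segment c%:E `<=` I by exact: segment_sub.
rewrite -(@lte_pmul2l _ l%:E)// ?lte_fin// gt0_muley ?lte_fin//.
rewrite -ge0_integralZl ?lee_fin ?(ltW l0)//; first last.
- by move=> t /segI; exact: rearr_weight_ge0.
- exact: measurable_funS segI (measurable_rearr_weight mf).
have mlf : measurable_fun I (l *: f)%R by exact: measurable_funZ.
apply: (@le_lt_trans _ _ (\int[mu]_(t in segment c%:E)
    (ext_at_infty (EFin \o phi) (rearr (l *: f)%R t) * (w t)%:E + psi 1%R * (w t)%:E))).
  apply: ge0_le_integral => //.
  - by move=> t /segI It; rewrite mule_ge0 ?lee_fin ?(ltW l0)// rearr_weight_ge0.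
  - by apply: emeasurable_funM => //; exact: measurable_funS segI (measurable_rearr_weight mf).
  - apply: emeasurable_funD; first exact: measurable_funS segI (measurable_ephi_rearr mlf).
    by apply: emeasurable_funM => //; exact: (measurable_weight_segment H).
  - move=> t /segI It; rewrite muleA -ge0_muleDl; first last.
    + exact: complementary_ge0.
    + by apply: ephi_ge0 => //; exact: rearr_ge0.
    rewrite lee_wpmul2r ?(wl_weight_ge0 H)// (rearrZ H)// (gtr0_norm l0).
    have := ext_Young phiN (x := l%:E * rearr f t) (y := 1); rewrite mule1; apply => //.
    by rewrite mule_ge0 ?rearr_ge0// lee_fin ltW.
rewrite ge0_integralD//; first last.
- by apply: emeasurable_funM => //; exact: (measurable_weight_segment H).
- by move=> t /segI It; rewrite mule_ge0 ?(wl_weight_ge0 H)// complementary_ge0.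
- exact: measurable_funS segI (measurable_ephi_rearr mlf).
- by move=> t /segI; exact: ephi_rearr_ge0.
apply: lte_add_pinfty.
  apply: le_lt_trans ffin; apply: ge0_subset_integral => //; first exact: measurable_ephi_rearr.
  by move=> t; exact: ephi_rearr_ge0.
rewrite ge0_integralZl//; first last.
- exact: complementary_ge0.
- by move=> t /segI It; exact: wl_weight_ge0 H t It.
- exact: (measurable_weight_segment H).
rewrite lte_mul_pinfty ?complementary_ge0 ?complementary_fin//.
exact: wl_cumulated_fin H c.
Qed.

End Lorentz_norms.

(** * Indicators as test functions, and norms of bounded functions *)

Section test_functions.
Context {R : realType} {d} {T : measurableType d}.
Context {mu : {sigma_finite_measure set T -> \bar R}} {I : set T} {m w : T -> R}.
Context {phi : R -> R}.
Hypotheses (H : weighted_line mu I m w) (phiN : N_function phi).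
Local Open Scope ereal_scope.
Local Notation segment := (segment I m).
Local Notation superlevel := (superlevel I).
Local Notation rearr := (rearr mu I m).
Local Notation W := (cumulated_weight mu I m w).
Local Notation psi := (complementary phi).
Local Notation rho := (modular mu I m w (EFin \o phi)).
Local Notation rhos := (modular mu I m w psi).
Local Notation X := (Lorentz_space mu I m w phi).
Local Notation N := (Lorentz_norm mu I m w phi).
Local Notation pairing := (pairing mu I m w).
Local Notation Y := (order_continuous_part mu I X N).
Let mI := wl_dom H.
Let mseg c := measurable_segment H c.
Let mw : measurable_fun I (EFin \o w).
Proof. exact: (measurable_weight H mI). Qed.
Implicit Types (f g u : T -> R) (t : T) (c : \bar R) (E : set T).

Lemma rearr_indic E (v : R) t : measurable E -> E `<=` I -> (0 <= v)%R -> I t ->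
  rearr (v \*o \1_E)%R t = v%:E * (\1_(segment (mu E)) t)%:E.
Proof.
move=> mE EI v0 It.
have mu_ : measurable_fun I (v \*o \1_E)%R.
  by apply: measurable_funM => //; exact: measurable_indic.
have iv (A : set T) s : (v * \1_A s)%R = (if s \in A then v else 0%R).
  by rewrite indicE; case: (s \in A); rewrite ?mulr1 ?mulr0.
rewrite -EFinM; apply: eq_of_superlevel.
- exact: rearr_ge0.
- by rewrite lee_fin mulr_ge0.
move=> l l0; rewrite (rearr_gt H)// iv lte_fin.
have slE : superlevel (v \*o \1_E)%R l = if (l < v)%R then E else set0.
  apply/seteqP; split => s.
    move=> [Is]; rewrite /= iv; case: ifPn => [|_].
      by rewrite inE (ger0_norm v0) => Es ->.
    by rewrite normr0 ltNge l0.
  case: ifPn => // lv Es; split; first exact: EI.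
  by rewrite /= iv mem_set// (ger0_norm v0).
rewrite slE; case: ifPn => lv.
  have [tS|tS] := pselect (segment (mu E) t).
    by rewrite mem_set// lv; case: tS.
  rewrite memNset// (le_gtF l0); apply/negbTE/negP => mt; apply: tS; split => //.
rewrite measure0 lte_fin (ltNge _ 0%R) (wl_pos_ge0 H)//=.
by case: ifPn => _; [rewrite (negbTE lv)|rewrite (le_gtF l0)].
Qed.

Lemma modular_indic (G : R -> \bar R) E (v : R) : measurable E -> E `<=` I -> (0 <= v)%R ->
  G 0%R = 0 -> 0 <= G v ->
  modular mu I m w G (v \*o \1_E)%R = G v * W (mu E).
Proof.
move=> mE EI v0 G0 Gv.
have segI : segment (mu E) `<=` I by exact: segment_sub.
rewrite /cumulated_weight -ge0_integralZl//; first last.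
- by move=> t /segI It; exact: wl_weight_ge0 H t It.
- exact: (measurable_weight_segment H).
rewrite -[in RHS](setIidr segI) integral_mkcondr; apply: eq_integral => t; rewrite inE => It.
rewrite rearr_indic// patchE indicE; case: ifPn => _ /=; first by rewrite mulr1.
by rewrite mulr0 G0 mul0e.
Qed.

Lemma pairing_indic f E (v : R) : measurable_fun I f -> measurable E -> E `<=` I -> (0 <= v)%R ->
  pairing f (v \*o \1_E)%R = v%:E * \int[mu]_(t in segment (mu E)) (rearr f t * (w t)%:E).
Proof.
move=> mf mE EI v0.
have segI : segment (mu E) `<=` I by exact: segment_sub.
rewrite -ge0_integralZl ?lee_fin//; first last.
- by move=> t /segI; exact: rearr_weight_ge0.
- exact: measurable_funS segI (measurable_rearr_weight H mf).
rewrite -[in RHS](setIidr segI) integral_mkcondr; apply: eq_integral => t; rewrite inE => It.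
rewrite rearr_indic// patchE indicE; case: ifPn => _ /=; last by rewrite !mule0 mul0e.
by rewrite mule1 (muleC (rearr f t)) muleA.
Qed.

Lemma segment_rearr_le_norm f E (v : R) : measurable_fun I f -> measurable E -> E `<=` I ->
  (0 <= v)%R -> psi v * W (mu E) <= 1 ->
  v%:E * \int[mu]_(t in segment (mu E)) (rearr f t * (w t)%:E) <= N f.
Proof.
move=> mf mE EI v0 vW; rewrite -pairing_indic//; apply: ereal_sup_ubound.
exists (v \*o \1_E)%R => //; split => /=.
  by apply: measurable_funM => //; exact: measurable_indic.
by rewrite modular_indic ?complementary0 ?complementary_ge0.
Qed.

(** The Hardy-Littlewood inequality can be divided by [W (mu E)], which is positive unless [E] is
    null. *)
Lemma integrable_Lorentz f E : X f -> measurable E -> E `<=` I -> mu E < +oo ->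
  mu.-integrable E (EFin \o f).
Proof.
move=> Xf mE EI Eoo; have [mf _] := Xf.
apply/integrableP; split; first by apply/measurable_EFinP; exact: measurable_funS EI mf.
have [E0|E0] := eqVneq (mu E) 0.
  by rewrite (eq_measure_integral mzero) ?integral_measure_zero ?ltry// => A mA AE;
     apply: subset_measure0 E0.
have Egt0 : 0 < mu E by rewrite lt0e E0 measure_ge0.
have := Hardy_Littlewood H mf mE EI Eoo.
have Efin : mu E \is a fin_num by rewrite ge0_fin_numE.
rewrite -(@lte_pmul2l _ (W (mu E))); first last.
- exact: (cumulated_weight_gt0 H).
- exact: (cumulated_weight_fin H).
move=> /le_lt_trans; apply; rewrite gt0_muley ?(cumulated_weight_gt0 H)//.
rewrite lte_mul_pinfty// -(fineK Efin); exact: (rearr_segment_weight_fin H phiN).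
Qed.

Lemma Lorentz_space_bounded f E (M : R) : measurable_fun I f -> measurable E -> E `<=` I ->
  mu E < +oo -> (0 <= M)%R -> (forall t, I t -> (`|f t| <= M * \1_E t)%R) -> X f.
Proof.
move=> mf mE EI Eoo M0 fE.
have mi : measurable_fun I (M \*o \1_E)%R.
  by apply: measurable_funM => //; exact: measurable_indic.
apply: (@Lorentz_space_le _ _ _ _ _ _ _ _ H phiN _ (M \*o \1_E)%R) => //; last first.
  by move=> t It; rewrite [leRHS]ger0_norm ?mulr_ge0 ?fE.
split => //; exists 1%R => //; rewrite scale1r modular_indic//; first last.
- by rewrite lee_fin (Orlicz_ge0 phiN).
- by rewrite /= (Orlicz0 phiN).
rewrite lte_mul_pinfty ?lee_fin ?(Orlicz_ge0 phiN)// -ge0_fin_numE ?(cumulated_weight_ge0 H)//.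
exact: (cumulated_weight_fin H).
Qed.

(** The pairing is split at the mass of the set [S] where [|f| > e]. Before it the rearrangement is
    at most [M], and Young with [K] gives a test function integral of at most [2 / K]; after it the
    rearrangement is at most [e], and Young with 1 gives at most [b]. *)
Lemma Lorentz_norm_small f E (b M K e : R) : measurable_fun I f -> measurable E -> E `<=` I ->
  (0 < K)%R -> (0 <= M)%R -> (0 <= e)%R ->
  (forall t, I t -> (`|f t| <= M * \1_E t)%R) ->
  (phi K)%:E * W (mu (superlevel f e)) <= 1 ->
  (phi 1)%:E * W (mu E) + 1 <= b%:E ->
  N f <= (M * (2 / K) + e * b)%:E.
Proof.
move=> mf mE EI K0 M0 e0 fE KW bW; apply: ge_ereal_sup => _ [g [mg g1] <-].
set S := superlevel f e in KW.
pose G t := rearr g t * (w t)%:E.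
have mG : measurable_fun I G by exact: (measurable_rearr_weight H).
have G0 t : I t -> 0 <= G t by exact: rearr_weight_ge0.
have cG c (r : R) : (0 <= r)%R -> measurable_fun I ((fun t => r%:E * G t) \_ (segment c)).
  move=> r0; apply/(measurable_restrict _ (mseg c) mI).
  have mr : measurable_fun I (fun t => r%:E * G t) by exact: emeasurable_funM.
  exact: measurable_funS mI (@subIsetl _ _ _) mr.
have cG0 c (r : R) t : (0 <= r)%R -> I t -> 0 <= ((fun t => r%:E * G t) \_ (segment c)) t.
  by move=> r0 It; rewrite patchE; case: ifPn => // _; rewrite mule_ge0 ?G0.
have icG c (r : R) : (0 <= r)%R -> \int[mu]_(t in I) ((fun t => r%:E * G t) \_ (segment c)) t =
    r%:E * \int[mu]_(t in segment c) G t.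
  move=> r0; rewrite -integral_mkcondr setIidr; last exact: segment_sub.
  rewrite ge0_integralZl ?lee_fin//.
  - by apply: measurable_funS mG => //; exact: segment_sub.
  - by move=> t [It _]; exact: G0.
apply: (@le_trans _ _ (\int[mu]_(t in I) (((fun t => M%:E * G t) \_ (segment (mu S))) t +
     ((fun t => e%:E * G t) \_ (segment (mu E))) t))).
  apply: ge0_le_integral => //.
  - by move=> t; exact: pairing_term_ge0.
  - exact: (measurable_pairing H).
  - by apply: emeasurable_funD; exact: cG.
  move=> t It; rewrite -muleA -/(G t).
  have fE' : rearr f t <= M%:E * (\1_(segment (mu E)) t)%:E.
    rewrite -rearr_indic//; apply: (le_rearr_norm H) => //.
      by apply: measurable_funM => //; exact: measurable_indic.
    by move=> s Is /=; rewrite [leRHS]ger0_norm ?mulr_ge0 ?fE.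
  have [tS|tS] := pselect (segment (mu S) t).
    apply: (@le_trans _ _ (M%:E * G t)); last by rewrite [X in X + _]patchE mem_set// leeDl// cG0.
    rewrite lee_wpmul2r ?G0//; apply: (le_trans fE').
    by rewrite -EFinM lee_fin ler_piMr// indicE; case: (_ \in _).
  apply: (@le_trans _ _ (((fun t => e%:E * G t) \_ (segment (mu E))) t)); last by rewrite leeDr// cG0.
  rewrite patchE; case: ifPn => [_|].
    rewrite lee_wpmul2r ?G0// leNgt; apply/negP; rewrite (rearr_gt H)// => mt.
    by apply: tS; split.
  rewrite notin_setE => tE; rewrite (_ : rearr f t = 0) ?mul0e//.
  apply/eqP; rewrite eq_le rearr_ge0 andbT; apply: (le_trans fE').
  by rewrite indicE memNset// mule0.
rewrite ge0_integralD//; last 4 first.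
- by move=> t; exact: cG0.
- exact: cG.
- by move=> t; exact: cG0.
- exact: cG.
rewrite !icG// EFinD leeD//.
  rewrite mulrCA mulrC -mulrA EFinM; apply: (@le_trans _ _ (M%:E * (K^-1%:E * (1 + 1)))).
    rewrite lee_wpmul2l ?lee_fin// lee_pdivlMl//.
    by apply: le_trans (rearr_segment_weight_le H phiN _ mg K0 g1) _; rewrite leeD2r.
  by rewrite -EFinD -!EFinM.
rewrite EFinM lee_wpmul2l ?lee_fin//; apply: le_trans bW.
have := rearr_segment_weight_le H phiN (mu E) mg (ltr01) g1.
by rewrite mul1e.
Qed.

(** Absolute continuity of W at 0, where [w] may be unbounded: the part of [w] above a level [n]
    contributes at most [e / 2], and the rest at most [n] times the mass. *)
Lemma cumulated_weight_small E (e : R) : measurable E -> E `<=` I -> mu E < +oo -> (0 < e)%R ->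
  exists2 r : R, (0 < r)%R & forall F, measurable F -> F `<=` E -> mu F <= r%:E -> W (mu F) <= e%:E.
Proof.
move=> mE EI Eoo e0.
have segI : segment (mu E) `<=` I by exact: segment_sub.
have w0 t : segment (mu E) t -> 0 <= (EFin \o w) t.
  by move=> /segI It; exact: wl_weight_ge0 H t It.
have [|||n Hn] := @tail_integral_small _ _ _ mu _ _ (EFin \o w) (e / 2) (mseg (mu E))
    (measurable_weight_segment H (c := mu E)) w0 (measurable_weight_segment H (c := mu E)).
- by apply: aeW => t _; rewrite ltry.
- have := cumulated_weight_fin H Eoo.
  by rewrite ge0_fin_numE ?(cumulated_weight_ge0 H).
- by rewrite divr_gt0.
have n0 : (0 < n.+1%:R :> R)%R by [].
exists (e / 2 / n.+1%:R)%R; first by rewrite !divr_gt0.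
move=> F mF FE Fr.
have FI : F `<=` I by move=> t /FE /EI.
have FEmu : mu F <= mu E by apply: le_measure; rewrite ?inE.
set S := segment (mu F); set A := segment (mu E) `&` [set t | n%:R%:E < (EFin \o w) t] in Hn.
have mA : measurable A.
  by apply: emeasurable_fun_o_infty => //; exact: (measurable_weight_segment H).
apply: (@le_trans _ _ (\int[mu]_(t in S) (((EFin \o w) \_ A) t + (cst n%:R%:E) t))).
  apply: ge0_le_integral; first exact: mseg.
  - by move=> t [It _]; exact: wl_weight_ge0 H t It.
  - exact: (measurable_weight_segment H).
  - apply: emeasurable_funD => //; apply/(measurable_restrict _ mA (mseg _)).
    apply: measurable_funS mw => //; apply: subset_trans (@subIsetl _ _ _) _.
    exact: segment_sub.
  - move=> t [It mt]; rewrite patchE; case: ifPn => [_|].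
      by rewrite leeDl// lee_fin.
    rewrite notin_setE => nA; rewrite add0e leNgt; apply/negP => h; apply: nA.
    by split => //; split => //; exact: lt_le_trans mt FEmu.
rewrite ge0_integralD//; last 4 first.
- exact: mseg.
- move=> t [It _]; rewrite patchE; case: ifPn => // _; exact: wl_weight_ge0 H t It.
- apply/(measurable_restrict _ mA (mseg _)).
  apply: measurable_funS mw => //; apply: subset_trans (@subIsetl _ _ _) _.
  exact: segment_sub.
- by move=> t _; rewrite lee_fin.
rewrite (splitr e) EFinD leeD//.
  apply: le_trans Hn; rewrite -integral_mkcondr.
  apply: ge0_subset_integral => //.
  - by apply: measurableI => //; exact: mseg.
  - apply: measurable_funS mw => //; apply: subset_trans (@subIsetl _ _ _) _; exact: segI.
  - by move=> t [/w0].
rewrite integral_cst; last exact: mseg.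
have muS : mu S = mu F by exact: (wl_segment H).
apply: (@le_trans _ _ (n%:R%:E * (e / 2 / n.+1%:R)%:E)).
  by rewrite lee_wpmul2l ?lee_fin//; apply: le_trans Fr; rewrite le_eqVlt; apply/orP; left; exact/eqP.
rewrite -EFinM lee_fin mulrCA ler_piMr ?divr_ge0 ?(ltW e0)//.
by rewrite ler_pdivrMr// mul1r ler_nat.
Qed.

End test_functions.

(** * Order-continuous elements and the gap of the norm *)

Section bounded_functions.
Context {R : realType} {d} {T : measurableType d}.
Context {mu : {sigma_finite_measure set T -> \bar R}} {I : set T} {m w : T -> R}.
Context {phi : R -> R}.
Hypotheses (H : weighted_line mu I m w) (phiN : N_function phi).
Local Open Scope ereal_scope.
Local Notation superlevel := (superlevel I).
Local Notation W := (cumulated_weight mu I m w).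
Local Notation X := (Lorentz_space mu I m w phi).
Local Notation N := (Lorentz_norm mu I m w phi).
Local Notation Y := (order_continuous_part mu I X N).
Let mI := wl_dom H.
Implicit Types (f g u : T -> R) (t : T) (c : \bar R) (E : set T).

(** Pointwise decrease to 0 inside a set of finite mass gives convergence in measure. As the
    hypotheses on [u] hold only almost everywhere, superlevel sets lie in [E] only up to a null set;
    [F] is the part that does. *)
Lemma mu_superlevel_cvg0 f E (e : R) (u : nat -> T -> R) : measurable E -> mu E < +oo ->
  (forall n, measurable_fun I (u n)) -> (0 < e)%R ->
  (forall t, I t -> (`|f t| <= `|f t| * \1_E t)%R) ->
  (forall n, \forall t \ae mu, I t -> (0 <= u n t <= `|f t|)%R) ->
  (\forall t \ae mu, I t -> nonincreasing_seq (u ^~ t) /\ u n t @[n --> \oo] --> (0%R : R)) ->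
  forall r : R, (0 < r)%R -> exists n, exists2 F, measurable F /\ F `<=` E &
    mu (superlevel (u n) e) <= mu F /\ mu F <= r%:E.
Proof.
move=> mE Eoo mu_ e0 fE uf uc r r0.
have [Z [mZ Z0 sZ]] : \forall t \ae mu, I t -> (forall n, (0 <= u n t <= `|f t|)%R) /\
    nonincreasing_seq (u ^~ t) /\ u n t @[n --> \oo] --> (0%R : R).
  have : \forall t \ae mu, forall n, I t -> (0 <= u n t <= `|f t|)%R by exact: ae_foralln.
  by apply: filterS2 uc => t h1 h2 It; split; [move=> n; exact: h2|exact: h1].
have good t : I t -> ~ Z t -> (forall n, (0 <= u n t <= `|f t|)%R) /\
    nonincreasing_seq (u ^~ t) /\ u n t @[n --> \oo] --> (0%R : R).
  by move=> It nZ; apply: contrapT => h; apply: nZ; apply: sZ => /(_ It).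
pose F n := superlevel (u n) e `\` Z.
have mF n : measurable (F n) by apply: measurableD => //; exact: (measurable_superlevel H).
have FE n : F n `<=` E.
  move=> t [[It et] nZ]; have [uft _] := good t It nZ.
  have /andP[u0 ufn] := uft n.
  have := fE t It; rewrite indicE; have [|tE] := boolP (t \in E); first by rewrite inE.
  rewrite mulr0 normr_le0 => /eqP f0; move: et ufn; rewrite f0 normr0 (ger0_norm u0).
  by lra.
have ndF : nonincreasing_seq F.
  move=> a b ab; apply/subsetPset => t [[It et] nZ]; split => //; split => //.
  have [uft [nu _]] := good t It nZ.
  have /andP[ua _] := uft a; have /andP[ub _] := uft b.
  move: et; rewrite !ger0_norm// => /lt_le_trans; apply; exact: nu.
have capF : \bigcap_n F n = set0.
  apply/seteqP; split => // t Ft.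
  have [[It _] nZ] := Ft 0%N Logic.I.
  have [uft [_ /cvgrPdist_lt/(_ e e0)[n _ /(_ n (leqnn n))]]] := good t It nZ.
  have [[_ et] _] := Ft n Logic.I; rewrite /= sub0r normrN => ut.
  by move: (lt_trans et ut); rewrite ltxx.
have F0oo : mu (F 0%N) < +oo by apply: le_lt_trans Eoo; apply: le_measure; rewrite ?inE.
have cF : mu (F n) @[n --> \oo] --> 0.
  rewrite -(measure0 mu) -capF; apply: nonincreasing_cvg_mu => //.
  exact: bigcap_measurable.
have [n Fn] : exists n, mu (F n) <= r%:E.
  apply: contrapT => nex.
  have : r%:E <= lim (mu (F n) @[n --> \oo]).
    apply: lime_ge; first by apply/cvg_ex; eexists; exact: cF.
    by apply: nearW => n; rewrite leNgt; apply/negP => h; apply: nex; exists n; exact: ltW.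
  by rewrite (cvg_lim _ cF)// lee_fin leNgt r0.
exists n, (F n) => //; split => //.
rewrite -(measureU0 (mF n) mZ Z0); apply: le_measure; rewrite ?inE.
- exact: (measurable_superlevel H).
- exact: measurableU.
- by move=> t ut; have [Zt|nZ] := pselect (Z t); [right|left].
Qed.

(** Below a bounded [f] of finite support, [u n] exceeds a small level on a set of vanishing mass,
    hence of vanishing weight, and the preceding norm estimate applies. These [f] are the supply of
    order-continuous elements for truncations. *)
Lemma order_continuous_bounded f E (M : R) : measurable_fun I f -> measurable E -> E `<=` I ->
  mu E < +oo -> (0 <= M)%R -> (forall t, I t -> (`|f t| <= M * \1_E t)%R) -> Y f.
Proof.
move=> mf mE EI Eoo M0 fE; split; first exact: (Lorentz_space_bounded H phiN mf mE EI Eoo M0).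
move=> u Xu uf uc.
have mu_ n : measurable_fun I (u n) by case: (Xu n).
have nuN : nonincreasing_seq (N \o u).
  move=> a b ab /=; apply: (le_Lorentz_norm H) => //.
  apply: filterS2 uc (uf b) => t h1 h2 It; have [nu _] := h1 It.
  have /andP[ub _] := h2 It; rewrite (ger0_norm ub).
  by apply: le_trans (ler_norm _); exact: nu.
split => //.
have cN := ereal_nonincreasing_cvgn nuN.
have -> : 0 = ereal_inf (range (N \o u)); last exact: cN.
apply/eqP; rewrite eq_le; apply/andP; split.
  by apply: le_ereal_inf_tmp => _ [n _ <-]; exact: (Lorentz_norm_ge0 H phiN).
apply/lee_addgt0Pr => e e0; rewrite add0e.
have Wfin := cumulated_weight_fin H Eoo.
pose b := (phi 1 * fine (W (mu E)) + 1)%R.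
have b1 : (1 <= b)%R.
  by rewrite lerDr mulr_ge0 ?(Orlicz_ge0 phiN)// fine_ge0// (cumulated_weight_ge0 H).
(* With this [K] and the level [l] below, [M * (2 / K)] and [l * b] are each at most [e / 2];
   [M + 1] covers [M = 0]. *)
pose K := (4 * (M + 1) / e)%R.
have K0 : (0 < K)%R by rewrite divr_gt0// mulr_gt0//; lra.
pose l := (e / (2 * b))%R.
have l0 : (0 < l)%R by rewrite divr_gt0// mulr_gt0//; lra.
have Kle : (M * (2 / K) + l * b <= e)%R.
  have b0 : (b != 0)%R by rewrite gt_eqF//; lra.
  have M1 : (0 < M + 1)%R by lra.
  have -> : (l * b = e / 2)%R by rewrite /l invfM mulrA divfK.
  have -> : (M * (2 / K) = e / 2 * (M / (M + 1)))%R.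
    by rewrite /K; field; rewrite !gt_eqF.
  rewrite [leRHS](splitr e) lerD2r ler_piMr//; first by rewrite divr_ge0// ltW.
  by rewrite ler_pdivrMr// mul1r lerDl.
have pK := Orlicz_gt0 phiN K0.
have iK : (0 < (phi K)^-1)%R by rewrite invr_gt0.
have [r r0 Hr] := cumulated_weight_small H mE EI Eoo iK.
have fE1 t : I t -> (`|f t| <= `|f t| * \1_E t)%R.
  move=> It; have := fE t It; rewrite indicE; case: (t \in E); rewrite ?mulr1// ?mulr0//.
have [n [F [mF FE] [uF Fr]]] := mu_superlevel_cvg0 mE Eoo mu_ l0 fE1 uf uc r0.
apply: (@le_trans _ _ (N (u n))); first by apply: ereal_inf_lbound; exists n.
(* [u n] is dominated by [|f|] only almost everywhere; [v] has the bound at every point. *)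
pose v := fun t => Num.min (`|u n t|)%R (`|f t|)%R.
have nuv : \forall t \ae mu, I t -> (`|u n t| <= `|v t|)%R.
  apply: filterS (uf n) => t h It; have /andP[u0 uft] := h It.
  by rewrite /v (ger0_norm u0) (min_idPl uft) ger0_norm.
have mv : measurable_fun I v.
  by apply: measurable_minr; apply: measurableT_comp.
apply: (le_trans (le_Lorentz_norm H (phi := phi) (mu_ n) mv nuv)).
have v0 t : (0 <= v t)%R by rewrite /v le_min !normr_ge0.
have := @Lorentz_norm_small _ _ _ _ _ _ _ _ H phiN v E b M K l mv mE EI K0 M0 (ltW l0).
have vE t : I t -> (`|v t| <= M * \1_E t)%R.
  move=> It; rewrite ger0_norm//; apply: le_trans (fE t It).
  by rewrite /v ge_min lexx orbT.
move=> /(_ vE) h.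
have h1 : (phi K)%:E * W (mu (superlevel v l)) <= 1.
  have vF : mu (superlevel v l) <= mu F.
    apply: le_trans uF; apply: le_measure; rewrite ?inE; try exact: (measurable_superlevel H).
    move=> t [It lv]; split => //; apply: (lt_le_trans lv).
    by rewrite ger0_norm// /v ge_min lexx.
  rewrite -lee_pdivlMl// mule1; apply: le_trans (Hr F mF FE Fr).
  exact: le_cumulated_weight H _ _ vF.
have h2 : (phi 1)%:E * W (mu E) + 1 <= b%:E.
  by rewrite /b EFinD EFinM fineK.
apply: (le_trans (h h1 h2)); rewrite lee_fin.
exact: Kle.
Qed.

End bounded_functions.

(** * Enlarged test functions and truncation of values *)

Section norm_gap.
Context {R : realType} {d} {T : measurableType d}.
Context {mu : {sigma_finite_measure set T -> \bar R}} {I : set T} {m w : T -> R}.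
Context {phi : R -> R}.
Hypotheses (H : weighted_line mu I m w) (phiN : N_function phi).
Local Open Scope ereal_scope.
Local Notation segment := (segment I m).
Local Notation superlevel := (superlevel I).
Local Notation rearr := (rearr mu I m).
Local Notation W := (cumulated_weight mu I m w).
Local Notation psi := (complementary phi).
Local Notation rhos := (modular mu I m w psi).
Local Notation X := (Lorentz_space mu I m w phi).
Local Notation N := (Lorentz_norm mu I m w phi).
Local Notation pairing := (pairing mu I m w).
Local Notation Y := (order_continuous_part mu I X N).
Let mI := wl_dom H.
Let mseg c := measurable_segment H c.
Let mw : measurable_fun I (EFin \o w).
Proof. exact: (measurable_weight H mI). Qed.
Implicit Types (f g u y : T -> R) (t : T) (c : \bar R) (E : set T).

Lemma rearr_ae_fin y : measurable_fun I y -> rhos y < +oo ->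
  {ae mu, forall t, I t -> rearr y t \is a fin_num}.
Proof.
move=> my yoo.
have : mu.-integrable I (fun t => ext_at_infty psi (rearr y t) * (w t)%:E).
  apply/integrableP; split; first exact: (measurable_epsi_rearr H).
  apply: le_lt_trans yoo; rewrite le_eqVlt; apply/orP; left; apply/eqP.
  by apply: eq_integral => t; rewrite inE => It; rewrite gee0_abs// epsi_rearr_ge0.
move=> /(integrable_ae mI); apply: filterS => t h It.
have := h It; have := rearr_ge0 (mu := mu) (I := I) (m := m) y t.
case: (rearr y t) => [r| |]//= _.
by rewrite gt0_mulye ?lte_fin ?(wl_weight_gt0 H).
Qed.

Lemma superlevel_max (G1 G2 : T -> \bar R) (l : R) :
  I `&` [set t | l%:E < maxe (G1 t) (G2 t)] =
  (I `&` [set t | l%:E < G1 t]) `|` (I `&` [set t | l%:E < G2 t]).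
Proof.
apply/seteqP; split => t; last first.
  by move=> [[It /= h]|[It /= h]]; split => //=; rewrite lt_max h ?orbT.
by move=> [It]; rewrite /= lt_max => /orP[h|h]; [left|right].
Qed.

(** A maximum of two functions nonincreasing in the position is its own rearrangement. By convexity
    its modular is at most [psi eta * W (mu E)] plus [1 - tau] times that of [y], hence at most
    [tau + (1 - tau)]. *)
Lemma test_function_max y E (eta tau : R) : measurable_fun I y -> rhos y <= 1 ->
  measurable E -> E `<=` I -> (0 < eta)%R -> (0 <= tau < 1)%R ->
  psi eta * W (mu E) <= tau%:E ->
  exists u, [/\ measurable_fun I u, rhos u <= 1 & forall t, I t ->
    rearr u t = maxe (eta%:E * (\1_(segment (mu E)) t)%:E) ((1 - tau)%:E * rearr y t)].
Proof.
move=> my y1 mE EI eta0 /andP[tau0 tau1] etaW.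
have tau01 : (0 < 1 - tau)%R by lra.
pose G t := maxe (eta%:E * (\1_(segment (mu E)) t)%:E) ((1 - tau)%:E * rearr y t).
have G1_ge0 t : 0 <= eta%:E * (\1_(segment (mu E)) t)%:E.
  by rewrite mule_ge0 ?lee_fin ?(ltW eta0).
have G0 t : 0 <= G t by rewrite /G le_max G1_ge0.
have mG : measurable_fun I G.
  apply: measurable_maxe.
    by apply: emeasurable_funM => //; apply/measurable_EFinP; exact: measurable_indic.
  by apply: emeasurable_funM => //; exact: (measurable_rearr H).
(* [rearr y] may be infinite, but only on a null set because the modular of [y] is finite, so [u]
   represents [G] almost everywhere. *)
pose u t := fine (G t).
have mu_ : measurable_fun I u by apply: measurableT_comp => //; exact: fine_measurable.
(* The superlevel set of [G] at [l] is a union of two initial segments, hence the longer one, of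
   mass [c l]. *)
pose c l := maxe (if (l < eta)%R then mu E else 0) (mu (superlevel y (l / (1 - tau)))).
have Gc l : (0 <= l)%R -> I `&` [set s | l%:E < G s] = segment (c l).
  move=> l0; rewrite superlevel_max /c -segment_max; congr (_ `|` _).
    apply/seteqP; split => t [It /=].
      rewrite indicE; have [tS|_] := boolP (t \in _).
        by rewrite mule1 lte_fin => ->; move: tS; rewrite inE.
      by rewrite mule0 lte_fin ltNge l0.
    case: ifPn => le mt; split => //=.
      by rewrite indicE mem_set ?mule1 ?lte_fin.
    by move: mt; rewrite lte_fin ltNge (wl_pos_ge0 H).
  rewrite -(superlevel_rearr H)//; last by rewrite divr_ge0// ltW.
  have e : (l / (1 - tau))%:E = (1 - tau)^-1%:E * l%:E by rewrite -EFinM mulrC.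
  by apply/seteqP; split => t [It /= h]; split => //=; move: h; rewrite e lte_pdivrMl.
have cmu l : (0 <= l)%R -> mu (segment (c l)) = c l.
  move=> l0; rewrite /c.
  have h1 : mu (segment (if (l < eta)%R then mu E else 0)) = if (l < eta)%R then mu E else 0.
    by case: ifPn => _; [exact: (wl_segment H)|rewrite (segment0 H) measure0].
  have h2 : mu (segment (mu (superlevel y (l / (1 - tau))))) = mu (superlevel y (l / (1 - tau))).
    by apply: (wl_segment H); [exact: (measurable_superlevel H)|exact: superlevel_sub].
  by rewrite maxEle; case: ifPn => _; [exact: h2|exact: h1].
have uG : {ae mu, forall s, I s -> `|u s|%:E = G s}.
  have yoo : rhos y < +oo by exact: le_lt_trans y1 (ltry _).
  apply: filterS (rearr_ae_fin my yoo) => t h It; rewrite /u ger0_norm ?fine_ge0// fineK//.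
  rewrite /G maxEle; case: ifPn => _; last by rewrite fin_numM.
  by rewrite fin_numM// h.
have uE t : I t -> rearr u t = G t.
  move=> It; exact: (rearr_segment H mu_ (fun s _ => G0 s) uG Gc cmu It).
exists u; split; [exact: mu_| |exact: uE].
apply: (@le_trans _ _ (\int[mu]_(t in I) (((fun t => psi eta * (w t)%:E) \_ (segment (mu E))) t +
    (1 - tau)%:E * (ext_at_infty psi (rearr y t) * (w t)%:E)))).
  apply: ge0_le_integral => //.
  - by move=> t; exact: epsi_rearr_ge0.
  - exact: (measurable_epsi_rearr H).
  - apply: emeasurable_funD; last first.
      by apply: emeasurable_funM => //; exact: (measurable_epsi_rearr H).
    apply/(measurable_restrict _ (mseg _) mI).
    have mr : measurable_fun I (fun t => psi eta * (w t)%:E) by exact: emeasurable_funM.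
    exact: measurable_funS mI (@subIsetl _ _ _) mr.
  move=> t It; rewrite uE//.
  have p1 : 0 <= ((fun t => psi eta * (w t)%:E) \_ (segment (mu E))) t.
    by rewrite patchE; case: ifPn => // _; rewrite mule_ge0 ?(wl_weight_ge0 H)// complementary_ge0.
  have p2 : 0 <= (1 - tau)%:E * (ext_at_infty psi (rearr y t) * (w t)%:E).
    by rewrite mule_ge0 ?lee_fin ?(ltW tau01)// epsi_rearr_ge0.
  rewrite /G maxEle; case: ifPn => _.
    apply: (@le_trans _ _ ((1 - tau)%:E * (ext_at_infty psi (rearr y t) * (w t)%:E))).
      rewrite muleA lee_wpmul2r ?(wl_weight_ge0 H)//; apply: (epsi_scale phiN).
        by rewrite tau01/=; lra.
      exact: rearr_ge0.
    by rewrite leeDr.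
  apply: (@le_trans _ _ (((fun t => psi eta * (w t)%:E) \_ (segment (mu E))) t)); last by rewrite leeDl.
  rewrite patchE indicE; case: ifPn => _ /=; first by rewrite mulr1.
  by rewrite mulr0 complementary0// mul0e.
rewrite ge0_integralD//; last 4 first.
- move=> t It; rewrite patchE; case: ifPn => // _.
  by rewrite mule_ge0 ?(wl_weight_ge0 H)// complementary_ge0.
- apply/(measurable_restrict _ (mseg _) mI).
  have mr : measurable_fun I (fun t => psi eta * (w t)%:E) by exact: emeasurable_funM.
  exact: measurable_funS mI (@subIsetl _ _ _) mr.
- by move=> t It; rewrite mule_ge0 ?lee_fin ?(ltW tau01)// epsi_rearr_ge0.
- by apply: emeasurable_funM => //; exact: (measurable_epsi_rearr H).
have segI : segment (mu E) `<=` I by exact: segment_sub.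
rewrite -integral_mkcondr setIidr// ge0_integralZl//; last 3 first.
- exact: (measurable_weight_segment H).
- by move=> t /segI It; exact: wl_weight_ge0 H t It.
- exact: complementary_ge0.
rewrite ge0_integralZl ?lee_fin ?(ltW tau01)//; last 2 first.
- exact: (measurable_epsi_rearr H).
- by move=> t It; exact: epsi_rearr_ge0.
apply: (@le_trans _ _ (tau%:E + (1 - tau)%:E * 1)).
  by rewrite leeD// lee_wpmul2l// lee_fin ltW.
by rewrite mule1 -EFinD lee_fin; lra.
Qed.

(** Otherwise the rearrangement exceeds [e] everywhere while the total weight is infinite, and no
    modular of a positive multiple of [f] is finite. *)
Lemma mu_superlevel_fin f (e : R) : X f -> (0 < e)%R -> mu (superlevel f e) < +oo.
Proof.
move=> [mf [l l0 lfoo]] e0; rewrite ltey; apply/negP => /eqP foo.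
have mS : measurable (superlevel f e) by exact: (measurable_superlevel H).
have muI : mu I = +oo.
  apply/eqP; rewrite -leye_eq -foo; apply: le_measure; rewrite ?inE//.
  exact: superlevel_sub.
have p0 : (0 < phi (l * e))%R by apply: (Orlicz_gt0 phiN); rewrite mulr_gt0.
suff : +oo <= modular mu I m w (EFin \o phi) (l *: f)%R by rewrite leye_eq => /eqP h; rewrite h in lfoo.
apply: (@le_trans _ _ (\int[mu]_(t in I) ((phi (l * e))%:E * (w t)%:E))).
  rewrite ge0_integralZl ?lee_fin ?(ltW p0)//; last by move=> t It; exact: wl_weight_ge0 H t It.
  by rewrite (wl_cumulated_infty H muI) gt0_muley ?lte_fin.
apply: ge0_le_integral => //.
- by move=> t It; rewrite mule_ge0 ?(wl_weight_ge0 H)// lee_fin ltW.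
- exact: emeasurable_funM.
- by apply: (measurable_ephi_rearr H phiN); exact: measurable_funZ.
move=> t It; rewrite lee_wpmul2r ?(wl_weight_ge0 H)//.
rewrite -[leLHS]/(ext_at_infty (EFin \o phi) (l * e)%:E); apply: (ephi_le phiN).
  by rewrite lee_fin mulr_ge0 ?ltW.
rewrite (rearrZ H)// (gtr0_norm l0) EFinM lee_wpmul2l ?lee_fin ?(ltW l0)//.
by apply: ltW; rewrite (rearr_gt H) ?(ltW e0)// foo ltry.
Qed.

(** [g] erases the values of [f] with modulus between [e] and [n]. The erased part is bounded with
    support of finite mass, hence order continuous; what remains exceeds [e] only where
    [|f| > n]. *)
Lemma tail_part f (e : R) (n : nat) : X f -> (0 < e)%R ->
  exists g, [/\ X g, Y (f - g)%R, forall t, I t -> rearr g t <= rearr f t &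
    forall t, I t -> ~ segment (mu (superlevel f n%:R)) t -> rearr g t <= e%:E].
Proof.
move=> Xf e0; have [mf _] := Xf.
pose E := superlevel f e `&` ~` superlevel f n%:R.
have mE : measurable E.
  apply: measurableI; first exact: (measurable_superlevel H).
  by apply: measurableC; exact: (measurable_superlevel H).
have EI : E `<=` I by move=> t [[]].
have Eoo : mu E < +oo.
  apply: le_lt_trans (mu_superlevel_fin Xf e0); apply: le_measure; rewrite ?inE//.
    exact: (measurable_superlevel H).
  exact: subIsetl.
pose g := (f \* \1_(~` E))%R.
have mg : measurable_fun I g.
  by apply: measurable_funM => //; apply: measurable_indic; exact: measurableC.
have gE t : g t = if t \in E then 0%R else f t.
  rewrite /g /= indicE; have [|/negP tE] := boolP (t \in E).
    by rewrite inE => Et; rewrite memNset ?mulr0// => /(_ Et).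
  by rewrite mem_set ?mulr1// => Et; apply: tE; rewrite inE.
have gf t : (`|g t| <= `|f t|)%R by rewrite gE; case: ifPn => //; rewrite normr0.
have Xg : X g by apply: (Lorentz_space_le H phiN mg Xf) => t _.
have rgf t : I t -> rearr g t <= rearr f t.
  by move=> It; apply: (le_rearr_norm H) => // s _.
exists g; split; [exact: Xg| |exact: rgf|].
  apply: (@order_continuous_bounded _ _ _ _ _ _ _ _ H phiN _ E n%:R) => //.
    exact: measurable_funB.
  move=> t It; have -> : ((f - g) t = f t - g t)%R by [].
  rewrite gE indicE; have [|tE] := boolP (t \in E).
    rewrite inE => -[_ nf]; rewrite subr0 mulr1 leNgt; apply/negP => h; apply: nf.
    by split.
  by rewrite subrr normr0 mulr0.
move=> t It tS; rewrite leNgt; apply/negP; rewrite (rearr_gt H) ?(ltW e0)// => mt.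
apply: tS; split => //=; apply: (lt_le_trans mt); apply: le_measure; rewrite ?inE.
- exact: (measurable_superlevel H).
- exact: (measurable_superlevel H).
move=> s [Is]; rewrite gE; case: ifPn => [_|/negP nE es].
  by rewrite normr0 ltNge ltW.
by apply: contrapT => h; apply: nE; rewrite inE; split.
Qed.

End norm_gap.

(** * The uniform gap modulo order-continuous elements *)

Section gap.
Context {R : realType} {d} {T : measurableType d}.
Context {mu : {sigma_finite_measure set T -> \bar R}} {I : set T} {m w : T -> R}.
Context {phi : R -> R}.
Hypotheses (H : weighted_line mu I m w) (phiN : N_function phi).
Local Open Scope ereal_scope.
Local Notation segment := (segment I m).
Local Notation superlevel := (superlevel I).
Local Notation rearr := (rearr mu I m).
Local Notation W := (cumulated_weight mu I m w).
Local Notation psi := (complementary phi).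
Local Notation rhos := (modular mu I m w psi).
Local Notation X := (Lorentz_space mu I m w phi).
Local Notation N := (Lorentz_norm mu I m w phi).
Local Notation pairing := (pairing mu I m w).
Local Notation Y := (order_continuous_part mu I X N).
Let mI := wl_dom H.
Let mseg c := measurable_segment H c.
Implicit Types (f g u y : T -> R) (t : T) (c : \bar R) (E : set T).

Lemma measurable_patchZ (D : set T) (r : R) (G : T -> \bar R) : measurable D ->
  measurable_fun I G -> measurable_fun I ((fun t => r%:E * G t) \_ D).
Proof.
move=> mD mG; apply/(measurable_restrict _ mD mI).
have mr : measurable_fun I (fun t => r%:E * G t) by exact: emeasurable_funM.
exact: measurable_funS mI (@subIsetl _ _ _) mr.
Qed.

Lemma patchZ_ge0 (D : set T) (r : R) (G : T -> \bar R) t : (0 <= r)%R -> 0 <= G t ->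
  0 <= ((fun t => r%:E * G t) \_ D) t.
Proof. by move=> r0 Gt; rewrite patchE; case: ifPn => // _; rewrite mule_ge0. Qed.

Lemma integral_patchZ (D : set T) (r : R) (G : T -> \bar R) : measurable D -> D `<=` I ->
  (0 <= r)%R -> measurable_fun I G -> (forall t, I t -> 0 <= G t) ->
  \int[mu]_(t in I) ((fun t => r%:E * G t) \_ D) t = r%:E * \int[mu]_(t in D) G t.
Proof.
move=> mD DI r0 mG G0; rewrite -integral_mkcondr setIidr//.
rewrite ge0_integralZl ?lee_fin//; first exact: measurable_funS DI mG.
by move=> t /DI; exact: G0.
Qed.

(** The second segment is where [rearr f] exceeds [n]. So the large values of [f], which the
    truncation keeps, carry little of the integral over the first segment. *)
Lemma rearr_tail_small f E (e : R) : X f -> measurable E -> E `<=` I -> mu E < +oo ->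
  (0 < e)%R -> exists n : nat,
  \int[mu]_(t in segment (mu E) `&` segment (mu (superlevel f n%:R))) (rearr f t * (w t)%:E) <= e%:E.
Proof.
move=> Xf mE EI Eoo e0; have [mf _] := Xf.
have segI : segment (mu E) `<=` I by exact: segment_sub.
have mF : measurable_fun (segment (mu E)) (fun t => rearr f t * (w t)%:E).
  exact: measurable_funS segI (measurable_rearr_weight H mf).
have F0 t : segment (mu E) t -> 0 <= rearr f t * (w t)%:E.
  by move=> /segI It; exact: rearr_weight_ge0.
have mG : measurable_fun (segment (mu E)) (rearr f).
  exact: measurable_funS segI (measurable_rearr H mf).
have Ffin : \int[mu]_(t in segment (mu E)) (rearr f t * (w t)%:E) < +oo.
  have Efin : mu E \is a fin_num by rewrite ge0_fin_numE.
  by rewrite -(fineK Efin); exact: (rearr_segment_weight_fin H phiN).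
have Gfin : {ae mu, forall t, segment (mu E) t -> rearr f t < +oo}.
  have : mu.-integrable (segment (mu E)) (fun t => rearr f t * (w t)%:E).
    apply/integrableP; split => //.
    apply: le_lt_trans Ffin; rewrite le_eqVlt; apply/orP; left; apply/eqP.
    by apply: eq_integral => t; rewrite inE => St; rewrite gee0_abs// F0.
  move=> /(integrable_ae (mseg _)); apply: filterS => t h St.
  have := h St; rewrite ltey; apply: contraTneq => ->.
  by rewrite gt0_mulye// lte_fin (wl_weight_gt0 H)//; exact: segI.
have [n Hn] := tail_integral_small (mseg _) mF F0 mG Gfin Ffin e0.
exists n; apply: le_trans Hn; rewrite le_eqVlt; apply/orP; left; apply/eqP.
congr (integral _ _ _); rewrite -(superlevel_rearr H)//.
by apply/seteqP; split => t [St h]; [case: h => _ h|have It := segI _ St]; split.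
Qed.

(** For a test function [y] of [g], the enlarged [u] is tested against [f]. On the segment [S],
    outside the set [B] of large values, [rearr g <= del]: there the loss from replacing [rearr y]
    is at most [del * rearr y], whereas [eta * rearr f] is gained. Elsewhere
    [rearr u >= (1 - tau) * rearr y] loses nothing more. *)
Lemma norm_gap E (q : R) : measurable E -> E `<=` I -> mu E < +oo -> (0 < q)%R ->
  exists2 kappa : R, (0 < kappa < 1)%R & forall f, X f -> N f <= 1 ->
    q%:E <= \int[mu]_(t in segment (mu E)) (rearr f t * (w t)%:E) ->
    exists g, [/\ X g, Y (f - g)%R & N g <= (1 - kappa)%:E].
Proof.
move=> mE EI Eoo q0.
have Wfin := cumulated_weight_fin H Eoo.
pose Wr := fine (W (mu E)).
have Wr0 : (0 <= Wr)%R by rewrite fine_ge0// (cumulated_weight_ge0 H).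
(* Chosen so that [tau = e1 * Wr * eta], the price of inserting [eta], is at most both [eta * q / 8]
   and [1 / 2]. *)
pose e1 := (Num.min (q / 8) (1 / 2) / (Wr + 1))%R.
have mn0 : (0 < Num.min (q / 8) (1 / 2) :> R)%R by rewrite lt_min; apply/andP; split; lra.
have e10 : (0 < e1)%R by rewrite divr_gt0//; lra.
have e1W : (e1 * Wr <= Num.min (q / 8) (1 / 2))%R.
  rewrite /e1 mulrAC -mulrA ler_piMr ?(ltW mn0)//.
  by rewrite ler_pdivrMr; lra.
have [eta /andP[eta0 eta1] etapsi] := complementary_small phiN e10.
pose tau := (e1 * Wr * eta)%R.
have e1W0 : (0 <= e1 * Wr)%R by rewrite mulr_ge0// ltW.
have tau0 : (0 <= tau)%R by rewrite mulr_ge0// ltW.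
have tauq : (tau <= eta * q / 8)%R.
  have : (e1 * Wr <= q / 8)%R by apply: le_trans e1W _; rewrite ge_min lexx.
  by rewrite -(ler_pM2r eta0) -/tau; lra.
have tau2 : (tau <= 1 / 2)%R.
  have h : (e1 * Wr <= 1 / 2)%R by apply: le_trans e1W _; rewrite ge_min lexx orbT.
  by rewrite /tau; nra.
have tau01 : (0 <= tau < 1)%R by rewrite tau0/=; lra.
have etaW : psi eta * W (mu E) <= tau%:E.
  rewrite -(fineK Wfin) -/Wr /tau mulrAC EFinM lee_wpmul2r// lee_fin//.
have etaq0 : (0 < eta * q)%R by rewrite mulr_gt0.
pose kappa := Num.min (eta * q / 4)%R (1 / 2)%R.
have kappa0 : (0 < kappa)%R by rewrite lt_min; apply/andP; split; lra.
have kappa4 : (kappa <= eta * q / 4)%R by rewrite ge_min lexx.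
have kappa2 : (kappa <= 1 / 2)%R by rewrite ge_min lexx orbT.
exists kappa; first by rewrite kappa0/=; lra.
(* [C1] bounds the integral of [rearr y * w] over [S] for every test function [y]; [del] below makes
   the corresponding error [eta * q / 8]. *)
pose C1 := (phi 1 * Wr + 1)%R.
have C10 : (0 < C1)%R.
  by rewrite ltr_wpDl// mulr_ge0// (Orlicz_ge0 phiN).
pose del := (eta * q / (8 * C1))%R.
have del0 : (0 < del)%R by rewrite divr_gt0// mulr_gt0.
have delC : (del * C1 = eta * q / 8)%R by rewrite /del invfM mulrA divfK ?gt_eqF.
(* The premise says (1 - tau) P <= 1 - 3 eta q / 4, while tau + kappa <= 3 eta q / 8. *)
have arith (P : R) : ((1 - tau) * P + eta * q <= 1 + eta * (q / 8) + del * C1)%R ->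
    (P <= 1 - kappa)%R.
  rewrite delC => h.
  have h2 : ((1 - tau) * (1 - kappa) >= 1 - tau - kappa)%R by nra.
  have h3 : ((1 - tau) * P <= (1 - tau) * (1 - kappa))%R by lra.
  by rewrite -(ler_pM2l (_ : 0 < 1 - tau)%R)//; lra.
move=> f Xf Nf qf; have [mf _] := Xf.
have q8 : (0 < q / 8)%R by lra.
have [n Hn] := rearr_tail_small Xf mE EI Eoo q8.
have [g [Xg Yfg gf gd]] := tail_part H phiN n Xf del0.
have [mg _] := Xg.
exists g; split => //.
apply: ge_ereal_sup => _ [y [my y1] <-].
have [u [mu_ u1 uE]] := test_function_max H phiN my y1 mE EI eta0 tau01 etaW.
have fu : pairing f u <= 1 by apply: le_trans Nf; apply: ereal_sup_ubound; exists u.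
pose Ff t := rearr f t * (w t)%:E.
pose Fy t := rearr y t * (w t)%:E.
have mFf : measurable_fun I Ff by exact: (measurable_rearr_weight H).
have mFy : measurable_fun I Fy by exact: (measurable_rearr_weight H).
have Ff0 t : I t -> 0 <= Ff t by exact: rearr_weight_ge0.
have Fy0 t : I t -> 0 <= Fy t by exact: rearr_weight_ge0.
pose S := segment (mu E).
pose B := segment (mu E) `&` segment (mu (superlevel f n%:R)).
have mS : measurable S by exact: mseg.
have mB : measurable B by apply: measurableI; exact: mseg.
have SI : S `<=` I by exact: segment_sub.
have BI : B `<=` I by move=> t [[]].
have eta0' := ltW eta0; have del0' := ltW del0.
have tau1' : (0 <= 1 - tau)%R by lra.
have ineq : (1 - tau)%:E * pairing g y + eta%:E * \int[mu]_(t in S) Ff t <=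
    pairing f u + eta%:E * \int[mu]_(t in B) Ff t + del%:E * \int[mu]_(t in S) Fy t.
  rewrite -(integral_patchZ mS SI eta0' mFf Ff0) -(integral_patchZ mB BI eta0' mFf Ff0).
  rewrite -(integral_patchZ mS SI del0' mFy Fy0).
  rewrite -ge0_integralZl ?lee_fin//; last 2 first.
  - exact: (measurable_pairing H).
  - by move=> t It; exact: pairing_term_ge0.
  rewrite -ge0_integralD//; last 4 first.
  - by move=> t It; rewrite mule_ge0 ?lee_fin// pairing_term_ge0.
  - by apply: emeasurable_funM => //; exact: (measurable_pairing H).
  - by move=> t It; apply: patchZ_ge0 => //; exact: Ff0.
  - exact: measurable_patchZ.
  rewrite -ge0_integralD//; last 4 first.
  - by move=> t It; exact: pairing_term_ge0.
  - exact: (measurable_pairing H).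
  - by move=> t It; apply: patchZ_ge0 => //; exact: Ff0.
  - exact: measurable_patchZ.
  rewrite -ge0_integralD//; last 4 first.
  - by move=> t It; rewrite adde_ge0 ?pairing_term_ge0//; apply: patchZ_ge0 => //; exact: Ff0.
  - by apply: emeasurable_funD; [exact: (measurable_pairing H)|exact: measurable_patchZ].
  - by move=> t It; apply: patchZ_ge0 => //; exact: Fy0.
  - exact: measurable_patchZ.
  apply: ge0_le_integral => //.
  - move=> t It; rewrite adde_ge0//; first by rewrite mule_ge0 ?lee_fin// pairing_term_ge0.
    by apply: patchZ_ge0 => //; exact: Ff0.
  - apply: emeasurable_funD; last exact: measurable_patchZ.
    by apply: emeasurable_funM => //; exact: (measurable_pairing H).
  - apply: emeasurable_funD; last exact: measurable_patchZ.
    by apply: emeasurable_funD; [exact: (measurable_pairing H)|exact: measurable_patchZ].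
  move=> t It.
  have w0 := wl_weight_ge0 H It.
  have rf0 := rearr_ge0 (mu := mu) (I := I) (m := m) f t.
  have ry0 := rearr_ge0 (mu := mu) (I := I) (m := m) y t.
  have rg0 := rearr_ge0 (mu := mu) (I := I) (m := m) g t.
  have gfu : (1 - tau)%:E * (rearr g t * rearr y t * (w t)%:E) <= rearr f t * rearr u t * (w t)%:E.
    rewrite !muleA lee_wpmul2r// -muleA muleCA.
    apply: (@le_trans _ _ (rearr f t * ((1 - tau)%:E * rearr y t))).
      by rewrite lee_wpmul2r// ?gf// mule_ge0 ?lee_fin.
    by rewrite lee_wpmul2l// uE// le_max lexx orbT.
  have B0 := patchZ_ge0 B eta0' (Ff0 t It).
  have D0 := patchZ_ge0 S del0' (Fy0 t It).
  have P0 : 0 <= rearr f t * rearr u t * (w t)%:E by exact: pairing_term_ge0.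
  rewrite [X in _ + X <= _]patchE; case: ifPn => [|_]; last first.
    by rewrite adde0; apply: (le_trans gfu); rewrite -addeA leeDl// adde_ge0.
  rewrite inE => St.
  have [nt|nt] := pselect (segment (mu (superlevel f n%:R)) t).
    rewrite [X in _ + X + _]patchE mem_set; last by split.
    by rewrite -[leLHS]adde0 leeD// leeD2r.
  have h1 : eta%:E * Ff t <= rearr f t * rearr u t * (w t)%:E.
    rewrite /Ff muleA lee_wpmul2r// muleC lee_wpmul2l// uE// le_max.
    by rewrite indicE mem_set// mule1 lexx.
  have h2 : (1 - tau)%:E * (rearr g t * rearr y t * (w t)%:E) <= ((fun t => del%:E * Fy t) \_ S) t.
    rewrite patchE mem_set// /Fy -!muleA.
    apply: (@le_trans _ _ (rearr g t * (rearr y t * (w t)%:E))).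
      rewrite -[leRHS]mul1e lee_wpmul2r ?lee_fin ?mule_ge0//; lra.
    by rewrite lee_wpmul2r ?mule_ge0//; exact: gd.
  apply: (le_trans (leeD h2 h1)).
  by rewrite [leLHS]addeC leeD2r// leeDl.
have yb : \int[mu]_(t in S) Fy t <= C1%:E.
  have := rearr_segment_weight_le H phiN (mu E) my ltr01 y1.
  by rewrite mul1e /C1 EFinD EFinM fineK.
have hB : eta%:E * \int[mu]_(t in B) Ff t <= (eta * (q / 8))%:E.
  by rewrite EFinM lee_wpmul2l ?lee_fin.
have hD : del%:E * \int[mu]_(t in S) Fy t <= (del * C1)%:E.
  by rewrite [(del * C1)%:E]EFinM lee_wpmul2l ?lee_fin.
have {}ineq : (1 - tau)%:E * pairing g y + (eta * q)%:E <= (1 + eta * (q / 8) + del * C1)%:E.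
  apply: (@le_trans _ _ ((1 - tau)%:E * pairing g y + eta%:E * \int[mu]_(t in S) Ff t)).
    by rewrite leeD2l// [(eta * q)%:E]EFinM lee_wpmul2l ?lee_fin.
  apply: (le_trans ineq); rewrite !EFinD; apply: leeD; last exact: hD.
  by apply: leeD; [exact: fu|exact: hB].
have gy0 : 0 <= pairing g y by apply: integral_ge0 => t; exact: pairing_term_ge0.
move: gy0 ineq; case: (pairing g y) => [P| |]//= P0.
  by rewrite -EFinM -EFinD !lee_fin; exact: arith.
by rewrite gt0_muley ?lte_fin//; lra.
Qed.

End gap.

(** * The two functionals *)

Section functionals.
Context {R : realType} {d} {T : measurableType d}.
Context {mu : {sigma_finite_measure set T -> \bar R}} {I : set T} {m w : T -> R}.
Context {phi : R -> R}.
Hypotheses (H : weighted_line mu I m w) (phiN : N_function phi).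
Local Open Scope ereal_scope.
Local Notation segment := (segment I m).
Local Notation superlevel := (superlevel I).
Local Notation rearr := (rearr mu I m).
Local Notation W := (cumulated_weight mu I m w).
Local Notation psi := (complementary phi).
Local Notation rho := (modular mu I m w (EFin \o phi)).
Local Notation X := (Lorentz_space mu I m w phi).
Local Notation N := (Lorentz_norm mu I m w phi).
Local Notation Y := (order_continuous_part mu I X N).
Let mI := wl_dom H.
Implicit Types (f g u y : T -> R) (t : T) (E : set T).

Lemma Lorentz_space0 f : X f -> X (0%R : T -> R).
Proof.
move=> Xf; have m0 : measurable_fun I (0%R : T -> R) by exact: measurable_cst.
by apply: (Lorentz_space_le H phiN m0 Xf) => t _; rewrite [X in (X <= _)%R]normr0.
Qed.

Lemma Lorentz_spaceZ (c : R) f : X f -> X (c *: f)%R.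
Proof.
move=> Xf; rewrite -[X in Lorentz_space _ _ _ _ _ X]addr0.
exact: (Lorentz_space_lin H phiN c Xf (Lorentz_space0 Xf)).
Qed.

Lemma Lorentz_space_normalize f : X f -> exists2 c : R, (0 < c)%R & N (c *: f)%R <= 1.
Proof.
move=> Xf; have [mf _] := Xf; have Nfin := Lorentz_norm_fin H phiN Xf.
have N0 := Lorentz_norm_ge0 H phiN f.
have Nf : N f \is a fin_num by rewrite ge0_fin_numE.
have r0 : (0 <= fine (N f))%R by rewrite fine_ge0.
have [c c0 cN] : exists2 c : R, (0 < c)%R & (c * fine (N f) <= 1)%R.
  exists (fine (N f) + 1)^-1%R; first by rewrite invr_gt0; lra.
  by rewrite mulrC ler_pdivrMr; lra.
exists c; first exact: c0.
apply: le_trans (Lorentz_normZ_le H c mf) _; rewrite gtr0_norm//.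
by rewrite -(fineK Nf) -EFinM lee_fin.
Qed.

Section one_block.
Variables (E : set T) (u : R).
Hypotheses (mE : measurable E) (EI : E `<=` I) (E0 : 0 < mu E) (Eoo : mu E < +oo).
Hypothesis u0 : (0 < u)%R.
Hypothesis (uW : W (mu E) * (phi (2 * u))%:E <= 1) (Wu : (2^-1)%:E <= W (mu E) * (phi (2 * u))%:E).
Let b := fine (mu E).

Let b0 : (0 < b)%R. Proof. by apply: fine_gt0; rewrite E0 Eoo. Qed.
Let bE : mu E = b%:E. Proof. by rewrite fineK// ge0_fin_numE. Qed.

(** The test function [v * 1_E] with slope [v = phi (2 * u) / (2 * u)] is admissible, since
    [psi v <= phi (2 * u)]; Hardy-Littlewood passes from the rearrangement to [|f|]. The 4 is the 2
    of [2 * u] times the inverse of the lower bound 1/2. *)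
Lemma integral_block_le f : X f -> \int[mu]_(t in E) `|f t|%:E <= (4 * u * b)%:E * N f.
Proof.
move=> Xf; have [mf _] := Xf.
have u20 : (0 < 2 * u)%R by rewrite mulr_gt0.
have pu0 := Orlicz_gt0 phiN u20.
have Wfin := cumulated_weight_fin H Eoo.
pose Wr := fine (W (mu E)); have WE : W (mu E) = Wr%:E by rewrite fineK.
have Wr1 : (2^-1 <= Wr * phi (2 * u))%R by rewrite -lee_fin EFinM -WE.
have Wr0 : (0 < Wr)%R by have := pu0; nra.
pose v := (phi (2 * u) / (2 * u))%R; have v0 : (0 < v)%R by rewrite divr_gt0.
have vW : psi v * W (mu E) <= 1.
  apply: le_trans uW; rewrite muleC lee_wpmul2l// ?(cumulated_weight_ge0 H)//.
  exact: (complementary_slope phiN).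
have h1 := segment_rearr_le_norm H phiN mf mE EI (ltW v0) vW.
rewrite bE in h1.
have := Hardy_Littlewood H mf mE EI Eoo.
rewrite WE bE => h2; rewrite -(@lee_pmul2l _ Wr%:E)// ?lte_fin//.
apply: (le_trans h2).
set J := integral _ _ _ in h1 *.
have {}h1 : J <= v^-1%:E * N f by rewrite lee_pdivlMl.
apply: (@le_trans _ _ (b%:E * (v^-1%:E * N f))); first by rewrite lee_wpmul2l// lee_fin ltW.
rewrite !muleA -!EFinM lee_wpmul2r ?(Lorentz_norm_ge0 H phiN)// lee_fin.
have -> : (b * v^-1 = b * (2 * u) / phi (2 * u))%R by rewrite /v invfM invrK mulrA mulrAC.
rewrite ler_pdivrMr// (_ : Wr * (4 * u * b) * _ = b * (2 * u) * (2 * (Wr * phi (2 * u))))%R; last by ring.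
by apply: ler_peMr; [rewrite mulr_ge0// ltW|lra].
Qed.

Lemma normr_block_le f : X f -> `|\int[mu]_(t in E) f t|%R%:E <= (4 * u * b)%:E * N f.
Proof.
move=> Xf; have iF := integrable_Lorentz H phiN Xf mE EI Eoo.
rewrite EFin_normr_Rintegral//; apply: le_trans (integral_block_le Xf).
by apply: le_abse_integral => //; case/integrableP : iF.
Qed.

(** Membership in [X] is tested because [dual] demands the value 0 outside [X]. *)
Definition block f : R := if pselect (X f) then (\int[mu]_(t in E) f t)%R else 0%R.

Lemma blockE f : X f -> block f = (\int[mu]_(t in E) f t)%R.
Proof. by rewrite /block; case: pselect. Qed.

Lemma block_lin (a : R) f g : X f -> X g -> block (a *: f + g)%R = (a * block f + block g)%R.
Proof.
move=> Xf Xg; have Xafg := Lorentz_space_lin H phiN a Xf Xg.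
rewrite !blockE//; have iF := integrable_Lorentz H phiN Xf mE EI Eoo.
have iG := integrable_Lorentz H phiN Xg mE EI Eoo.
rewrite -RintegralZl// -RintegralD//.
by have := integrableZl mE a iF.
Qed.

Lemma block_le f : X f -> `|block f|%:E <= (4 * u * b)%:E * N f.
Proof. by move=> Xf; rewrite blockE//; exact: normr_block_le. Qed.

Lemma block_dual : dual X N block.
Proof.
split.
- exact: block_lin.
- by move=> f nXf; rewrite /block; case: pselect.
- apply: (@le_lt_trans _ _ ((4 * u * b)%:E * 1)); last by rewrite mule1 ltry.
  apply: dual_norm_le => f Xf Nf; apply: (le_trans (block_le Xf)).
  by rewrite lee_wpmul2l// lee_fin !mulr_ge0// ltW.
Qed.

Lemma Lorentz_space_block : X (\1_E : T -> R).
Proof.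
apply: (@Lorentz_space_bounded _ _ _ _ _ _ _ _ H phiN _ E 1%R) => //.
by move=> t _; rewrite mul1r ger0_norm.
Qed.

Lemma block_norm_gt0 : 0 < dual_norm X N block.
Proof.
have [c c0 Nc] := Lorentz_space_normalize Lorentz_space_block.
have Xc := Lorentz_spaceZ c Lorentz_space_block.
apply: lt_le_trans (dual_norm_ge block Xc Nc).
rewrite lte_fin normr_gt0 blockE// gt_eqF//.
rewrite (@eq_Rintegral _ _ _ _ _ (cst c)); last first.
  move=> t /set_mem Et; have -> : ((c *: (\1_E : T -> R)) t = c * \1_E t)%R by [].
  by rewrite indicE mem_set// mulr1.
by rewrite Rintegral_cst//= mulr_gt0.
Qed.

(** Restricting [f] to the part of [E] where [|f| <= n] yields an order-continuous element of no
    larger norm, and for large [n] the integral changes by at most [e]. *)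
Lemma block_attained f (e : R) : X f -> N f <= 1 -> (0 < e)%R ->
  exists g, [/\ X g, Y g, N g <= 1 & (`|block f| - e <= `|block g|)%R].
Proof.
move=> Xf Nf e0; have [mf _] := Xf.
have mabs : measurable_fun E (fun t => `|f t|%:E).
  by apply/measurable_EFinP; apply: measurableT_comp => //; exact: measurable_funS EI mf.
have iF := integrable_Lorentz H phiN Xf mE EI Eoo.
have abs0 t : E t -> 0 <= `|f t|%:E by rewrite lee_fin.
have absfin : {ae mu, forall t, E t -> `|f t|%:E < +oo} by apply: aeW => t _; rewrite ltry.
have absint : \int[mu]_(t in E) `|f t|%:E < +oo by case/integrableP : iF.
have [n Hn] := tail_integral_small mE mabs abs0 mabs absfin absint e0.
pose A := E `&` [set t | n%:R%:E < `|f t|%:E].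
have mA : measurable A by exact: emeasurable_fun_o_infty.
pose g := (f \* \1_(E `\` A))%R.
have mg : measurable_fun I g.
  by apply: measurable_funM => //; apply: measurable_indic; exact: measurableD.
have gE t : g t = if t \in E `\` A then f t else 0%R.
  by rewrite /g /= indicE; case: (_ \in _); rewrite ?mulr1 ?mulr0.
have gf t : (`|g t| <= `|f t|)%R by rewrite gE; case: ifPn => //; rewrite normr0.
have Xg : X g by apply: (Lorentz_space_le H phiN mg Xf) => t _.
exists g; split.
- exact: Xg.
- apply: (order_continuous_bounded H phiN mg mE EI Eoo (ler0n _ n)).
  move=> t It; rewrite gE; case: ifPn => [|_]; last by rewrite normr0 mulr_ge0.
  rewrite inE => -[Et nA]; rewrite indicE mem_set// mulr1 leNgt; apply/negP => h.
  by apply: nA; split => //=; rewrite lte_fin.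
- by apply: le_trans Nf; apply: (le_Lorentz_norm H) => //; apply: aeW => t _.
have : (`|block f - block g| <= e)%R.
  have -> : (block f - block g = block (- 1 *: g + f))%R by rewrite block_lin// mulN1r addrC.
  have Xgf := Lorentz_space_lin H phiN (-1)%R Xg Xf.
  rewrite blockE// -lee_fin EFin_normr_Rintegral//; last exact: (integrable_Lorentz H phiN).
  have [mgf _] := Xgf.
  apply: le_trans Hn; apply: (@le_trans _ _ (\int[mu]_(t in E) `|(((-1) *: g + f) t)%:E|)).
    by apply: le_abse_integral => //; apply/measurable_EFinP; exact: measurable_funS EI mgf.
  rewrite -/A -(setIidr (_ : A `<=` E)); last exact: subIsetl.
  rewrite integral_mkcondr le_eqVlt; apply/orP; left; apply/eqP; apply: eq_integral => t.
  rewrite inE => Et; rewrite patchE.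
  have -> : ((-1 *: g + f) t = f t - g t)%R by rewrite /= addrC; congr (_ + _)%R; exact: mulN1r.
  rewrite gE; case: ifPn => h1; case: ifPn => h2.
  - by exfalso; move: h1 h2; rewrite !inE => -[_] nA /nA.
  - by rewrite subrr abse0.
  - by rewrite subr0.
  - by exfalso; move: h1 h2; rewrite !notin_setE => h1 h2; apply: h1; split.
by move=> h; have := ler_normD (block f - block g)%R (block g); rewrite subrK; lra.
Qed.

(** The gap gives [g] with [s g = s f], as [s] vanishes on [f - g]; dividing [g] by [1 - kappa]
    returns it to the unit ball. *)
Lemma block_gap : exists2 kappa : R, (0 < kappa < 1)%R & forall s f,
  annihilator X N Y s -> X f -> N f <= 1 -> dual_norm X N block <= (2 * `|block f|)%:E ->
  exists2 g, X g /\ N g <= 1 & (`|s f| <= (1 - kappa) * `|s g|)%R.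
Proof.
have [_ _ Bfin] := block_dual; have B0 := block_norm_gt0.
have [B BE] : exists B, dual_norm X N block = B%:E.
  by exists (fine (dual_norm X N block)); rewrite fineK// ge0_fin_numE// ltW.
have {}B0 : (0 < B)%R by rewrite -lte_fin -BE.
pose Wr := fine (W (mu E)).
have WE : W (mu E) = Wr%:E by rewrite fineK// (cumulated_weight_fin H).
have Wr0 : (0 < Wr)%R by rewrite -lte_fin -WE (cumulated_weight_gt0 H).
(* If [|block f| >= B / 2], Hardy-Littlewood bounds the integral of [rearr f * w] over the segment
   below by this number, whatever [f] is. *)
have q0 : (0 < Wr * (B / 2) / b)%R by rewrite divr_gt0// mulr_gt0//; lra.
have [kappa /andP[k0 k1] gap] := norm_gap H phiN mE EI Eoo q0.
exists kappa; first by rewrite k0.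
move=> s f [[slin s0 _] sY] Xf Nf; rewrite BE lee_fin => Bf; have [mf _] := Xf.
have [g [Xg Yfg Ng]] : exists g, [/\ X g, Y (f - g)%R & N g <= (1 - kappa)%:E].
  apply: gap => //.
  have h := Hardy_Littlewood H mf mE EI Eoo.
  rewrite -(@lee_pmul2l _ b%:E)// ?lte_fin// -{2}bE; apply: le_trans h; rewrite WE.
  rewrite -EFinM mulrCA mulfV ?gt_eqF// mulr1 EFinM lee_wpmul2l ?lee_fin ?(ltW Wr0)//.
  apply: (@le_trans _ _ `|block f|%:E); first by rewrite lee_fin; lra.
  have iF := integrable_Lorentz H phiN Xf mE EI Eoo.
  rewrite blockE// EFin_normr_Rintegral//.
  by apply: le_abse_integral => //; case/integrableP : iF.
have k1' : (0 < 1 - kappa)%R by lra.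
have [mg _] := Xg.
have X0 := Lorentz_space0 Xf.
have s00 : s 0%R = 0%R.
  have := slin 1%R 0%R 0%R X0 X0; rewrite scale1r addr0 mul1r; lra.
have Xg' := Lorentz_spaceZ (1 - kappa)^-1 Xg.
have sg : s ((1 - kappa)^-1 *: g)%R = ((1 - kappa)^-1 * s g)%R.
  by have := slin (1 - kappa)^-1%R g 0%R Xg X0; rewrite addr0 s00 addr0.
have sf : s f = s g.
  have Xfg : X (f - g)%R by case: Yfg.
  have := slin 1%R _ _ Xfg Xg; rewrite scale1r subrK => ->.
  by rewrite sY// mul1r add0r.
exists ((1 - kappa)^-1 *: g)%R; first split; first exact: Xg'.
  apply: le_trans (Lorentz_normZ_le H _ mg) _; rewrite gtr0_norm ?invr_gt0//.
  by rewrite lee_pdivrMl// mule1.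
by rewrite sf sg normrM (gtr0_norm (_ : 0 < (1 - kappa)^-1)%R) ?invr_gt0// mulrA mulfV ?gt_eqF// mul1r.
Qed.

End one_block.
End functionals.

(** * The sum of disjoint blocks and the functionals that detect it *)

Section bump_sequence.
Context {R : realType} {d} {T : measurableType d}.
Context {mu : {sigma_finite_measure set T -> \bar R}} {I : set T} {m w : T -> R}.
Context {phi : R -> R}.
Hypotheses (H : weighted_line mu I m w) (phiN : N_function phi).
Local Open Scope ereal_scope.
Local Notation superlevel := (superlevel I).
Local Notation W := (cumulated_weight mu I m w).
Local Notation rho := (modular mu I m w (EFin \o phi)).
Local Notation X := (Lorentz_space mu I m w phi).
Local Notation N := (Lorentz_norm mu I m w phi).
Local Notation Y := (order_continuous_part mu I X N).
Let mI := wl_dom H.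
Implicit Types (f g y : T -> R) (t : T) (E : set T).

Variables (A : nat -> set T) (u : nat -> R).
Hypotheses (mA : forall k, measurable (A k)) (AI : forall k, A k `<=` I).
Hypotheses (A0 : forall k, 0 < mu (A k)) (Aoo : forall k, mu (A k) < +oo).
Hypotheses (tA : trivIset setT A) (u0 : forall k, (0 < u k)%R).
Hypothesis uW : forall k, W (mu (A k)) * (phi (2 * u k))%:E <= 1.
Hypothesis Wu : forall k, (2^-1)%:E <= W (mu (A k)) * (phi (2 * u k))%:E.
Hypothesis uphi : forall k, (phi (u k) * (2 ^ k.+1)%:R <= phi (2 * u k))%R.

Let b k := fine (mu (A k)).
Let b0 k : (0 < b k)%R. Proof. by apply: fine_gt0; rewrite A0 Aoo. Qed.

(** The pointwise sum of the [u k * 1_(A k)]; by disjointness the index chosen at [t] is the only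
    possible one. *)
Definition bump (t : T) : R :=
  if pselect (exists k, A k t) is left e then u (projT1 (cid e)) else 0%R.

Lemma bumpE k t : A k t -> bump t = u k.
Proof.
move=> Akt; rewrite /bump; case: pselect => [e|]; last by move=> []; exists k.
case: (cid e) => i /= Ait; congr u.
by apply: (tA Logic.I Logic.I); exists t.
Qed.

Lemma bump0 t : ~ (exists k, A k t) -> bump t = 0%R.
Proof. by move=> nA; rewrite /bump; case: pselect. Qed.

Lemma measurable_bump : measurable_fun I bump.
Proof.
move=> _ B mB.
have -> : I `&` bump @^-1` B = \bigcup_k (if u k \in B then A k else set0) `|`
    (if (0%R : R) \in B then I `\` \bigcup_k A k else set0).
  apply/seteqP; split => t.
    move=> [It Bt]; have [[k Akt]|nA] := pselect (exists k, A k t).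
      by left; exists k => //; rewrite mem_set// -(bumpE Akt).
    right; rewrite mem_set; last by rewrite -(bump0 nA).
    by split => // -[k _ Akt]; apply: nA; exists k.
  move=> [[k _]|]; case: ifPn => //.
    by rewrite inE => Bu Akt; split; [exact: (AI Akt)|rewrite /= (bumpE Akt)].
  rewrite inE => B0 [It nA]; split => //=; rewrite bump0// => -[k Akt].
  by apply: nA; exists k.
apply: measurableU.
  by apply: bigcup_measurable => k _; case: ifPn.
by case: ifPn => // _; apply: measurableD => //; exact: bigcup_measurable.
Qed.

(** The modular of the [k]-th block is [phi (u k) * W (mu (A k))], at most [2^-(k+1) * phi (2 * u k)
    * W (mu (A k)) <= 2^-(k+1)]. *)
Lemma bump_space : X bump.
Proof.
split; first exact: measurable_bump.
exists 1%R => //; rewrite scale1r.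
have mi k : measurable_fun I (u k \*o \1_(A k))%R.
  by apply: measurable_funM => //; exact: measurable_indic.
apply: (@le_lt_trans _ _ (\sum_(k <oo) rho (u k \*o \1_(A k))%R)).
  apply: (modular_le_series H phiN) => //; first exact: measurable_bump.
  move=> l l0 t [It lt]; have [[k Akt]|nA] := pselect (exists k, A k t).
    exists k => //; split => //=; rewrite indicE mem_set// mulr1.
    by move: lt; rewrite (bumpE Akt).
  by move: lt; rewrite (bump0 nA) normr0 ltNge l0.
apply: (@le_lt_trans _ _ (\sum_(k <oo) (1 / (2 ^ k.+1)%:R)%:E)); last first.
  by apply: le_lt_trans (epsilon_trick0 _ _) _ => //; rewrite ltry.
apply: lee_nneseries => [k _ _|k _].
  by apply: integral_ge0 => t It; exact: ephi_rearr_ge0.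
have pu := Orlicz_ge0 phiN (ltW (u0 k)).
rewrite (modular_indic H)//; [|exact: ltW|by rewrite /= (Orlicz0 phiN)].
have p2 : (0 < (2 ^ k.+1)%:R :> R)%R by rewrite ltr0n expn_gt0.
have -> : (1 / (2 ^ k.+1)%:R)%:E = (2 ^ k.+1)%:R^-1%:E * 1 :> \bar R by rewrite mule1 div1r.
rewrite lee_pdivlMl//; apply: le_trans (uW k).
rewrite muleA -EFinM muleC lee_wpmul2l ?(cumulated_weight_ge0 H)// lee_fin.
by rewrite mulrC.
Qed.

(** The average over [A k] divided by [u k], so that all of them agree on the multiples of
    [bump]. *)
Definition bump_functional k f : R := ((b k * u k)^-1 * block (phi := phi) (I := I) (m := m) (w := w) (mu := mu) (A k) f)%R.

Lemma bump_functional_le k f : X f -> `|bump_functional k f|%:E <= 4%:E * N f.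
Proof.
move=> Xf; have bu0 : (0 < b k * u k)%R by rewrite mulr_gt0.
rewrite normrM gtr0_norm ?invr_gt0// EFinM lee_pdivrMl// muleA -EFinM.
have := block_le H phiN (mA k) (@AI k) (A0 k) (Aoo k) (u0 k) (uW k) (Wu k) Xf.
by rewrite (_ : b k * u k * 4 = 4 * u k * fine (mu (A k)))%R//; rewrite -/(b k); ring.
Qed.

Lemma bump_functional_bump k (c : R) : X (c *: bump)%R -> bump_functional k (c *: bump)%R = c.
Proof.
move=> Xc; rewrite /bump_functional blockE//.
rewrite (@eq_Rintegral _ _ _ _ _ (cst (c * u k)%R)); last first.
  by move=> t /set_mem At; have -> : ((c *: bump) t = c * bump t)%R by []; rewrite (bumpE At).
rewrite Rintegral_cst//= -/(b k); have := b0 k; have := u0 k => hu hb.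
by rewrite mulrC -mulrA (mulrC (u k)) mulfK// mulf_neq0 ?gt_eqF.
Qed.

(** A point lies in at most one [A k], so the restrictions [v n] of [|y|] to the union of the [A i]
    with [i >= n] decrease to 0 pointwise, hence in norm. The [k]-th functional is controlled by
    [v k] alone. *)
Lemma bump_functional_cvg0 y : Y y -> bump_functional ^~ y @ \oo --> (0%R : R).
Proof.
move=> [Xy ycont]; have [my _] := Xy.
pose B n := \bigcup_(i in [set i | (n <= i)%N]) A i.
have mB n : measurable (B n) by exact: bigcup_measurable.
pose v n t := (`|y t| * \1_(B n) t)%R.
have mv n : measurable_fun I (v n).
  apply: measurable_funM; first exact: measurableT_comp.
  exact: measurable_indic.
have v01 n t : (0 <= v n t <= `|y t|)%R.
  rewrite /v indicE mulr_ge0//=; case: (_ \in _); rewrite ?mulr1// mulr0//.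
have Xv n : X (v n).
  apply: (Lorentz_space_le H phiN (mv n) Xy) => t _.
  by have /andP[v0 vy] := v01 n t; rewrite ger0_norm.
have [] := ycont v Xv.
- by move=> n; apply: aeW => t _.
- apply: aeW => t It; split.
    move=> n k nk; rewrite /v ler_wpM2l// !indicE.
    have [|] := boolP (t \in B k) => //; rewrite inE => -[i /= ki Ait].
    by rewrite mem_set//; exists i => //=; exact: leq_trans ki.
  have [[k Akt]|nA] := pselect (exists k, A k t).
    apply: cvg_near_cst; exists k.+1 => // n /= kn.
    rewrite /v indicE memNset ?mulr0// => -[i /= ni Ait].
    have ik : i = k by apply: (tA Logic.I Logic.I); exists t.
    by move: (leq_trans kn ni); rewrite ik ltnn.
  apply: cvg_near_cst; exists 0%N => // n _.
  rewrite /v indicE memNset ?mulr0// => -[i _ Ait]; apply: nA; by exists i.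
move=> _ /fine_cvgP[[n0 _ Hn0] cN].
have bl k : `|bump_functional k y|%:E <= 4%:E * N (v k).
  have bu0 : (0 < b k * u k)%R by rewrite mulr_gt0.
  rewrite normrM gtr0_norm ?invr_gt0// EFinM lee_pdivrMl// muleA -EFinM.
  have := integral_block_le H phiN (mA k) (@AI k) (A0 k) (Aoo k) (u0 k) (uW k) (Wu k) (Xv k).
  rewrite (_ : b k * u k * 4 = 4 * u k * fine (mu (A k)))%R; last by rewrite -/(b k); ring.
  apply: le_trans.
  have iy := integrable_Lorentz H phiN Xy (mA k) (@AI k) (Aoo k).
  rewrite blockE// EFin_normr_Rintegral//.
  have miy : measurable_fun (A k) (EFin \o y) by case/integrableP : iy.
  apply: (le_trans (le_abse_integral mu (mA k) miy)).
  rewrite le_eqVlt; apply/orP; left; apply/eqP; apply: eq_integral => t /set_mem At.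
  rewrite /v indicE mem_set ?mulr1; last by exists k => /=.
  by rewrite normr_id.
apply/cvgrPdist_le => e e0.
have e4 : (0 < e / 4)%R by rewrite divr_gt0.
have [n1 _ Hn1] := (cvgrPdist_le _ _).1 cN _ e4.
exists (maxn n0 n1) => // k /=; rewrite geq_max => /andP[nk0 nk1].
rewrite sub0r normrN -lee_fin; apply: (le_trans (bl k)).
have Nf : N (v k) \is a fin_num := Hn0 k nk0.
rewrite -(fineK Nf) -EFinM lee_fin.
have := Hn1 k nk1; rewrite /= sub0r normrN => /(le_trans (ler_norm _)).
lra.
Qed.

(** The block over [A 0] is the functional attained on [Y], and the ultralimit of the
    [bump_functional k] is the one that vanishes there. *)
Lemma bump_not_M_ideal : ~ M_ideal X N Y.
Proof.
have [c c0 Nc] := Lorentz_space_normalize H phiN bump_space.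
have Xc := Lorentz_spaceZ H phiN c bump_space.
have bf_lin k : forall (a : R) f g, X f -> X g ->
    bump_functional k (a *: f + g)%R = (a * bump_functional k f + bump_functional k g)%R.
  move=> a f g Xf Xg; rewrite /bump_functional (block_lin H phiN (mA k) (@AI k) (Aoo k) _ Xf Xg).
  by ring.
have [s sY s0] : exists2 s, annihilator X N Y s & 0 < dual_norm X N s.
  apply: (@ultralimit_annihilator _ _ X N Y bump_functional 4 (c *: bump)%R).
  - by move=> a f g; exact: Lorentz_space_lin.
  - exact: bf_lin.
  - move=> f Xf; exists (4 * fine (N f))%R => k.
    rewrite -lee_fin; apply: (le_trans (bump_functional_le k Xf)).
    have Nfin := Lorentz_norm_fin H phiN Xf; have N0 := Lorentz_norm_ge0 H phiN f.
    by rewrite EFinM fineK// ge0_fin_numE.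
  - move=> k f Xf Nf; rewrite -lee_fin; apply: (le_trans (bump_functional_le k Xf)).
    by rewrite -[leRHS]mule1 lee_wpmul2l.
  - by move=> y Yy; split; [case: Yy|exact: bump_functional_cvg0].
  - exact: Xc.
  - exact: Nc.
  - by apply/funext => k; rewrite !bump_functional_bump.
  - by rewrite bump_functional_bump// gt_eqF.
have [kappa k01 gap] := block_gap H phiN (mA 0%N) (@AI 0%N) (A0 0%N) (Aoo 0%N) (u0 0%N) (uW 0%N) (Wu 0%N).
apply: (M_ideal_obstruction k01 (block_dual H phiN (mA 0%N) (@AI 0%N) (A0 0%N) (Aoo 0%N) (u0 0%N) (uW 0%N) (Wu 0%N)) sY _ s0).
- exact: (block_norm_gt0 H phiN (mA 0%N) (@AI 0%N) (A0 0%N) (Aoo 0%N)).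
- move=> f e Xf Nf e0.
  exact: (block_attained H phiN (mA 0%N) (@AI 0%N) (Aoo 0%N) Xf Nf e0).
- by move=> f Xf Nf hf; exact: gap.
Qed.

End bump_sequence.

(** * Choice of heights and masses when Delta_2 fails *)

Section selection.
Context {R : realType} {phi : R -> R}.
Hypothesis phiN : N_function phi.
Variable a : nat -> R.

(** Here [a j] stands for the cumulated weight of the [j]-th candidate set. Once [u] is small enough
    for [a J * phi (2 * u) <= 1], take the last [j] before this product exceeds 1; as [a] at most
    doubles, the product at [j] is above 1/2. *)
Lemma selection_zero : 0 < a 0 -> {homo a : j k / (j <= k)%N >-> j <= k} ->
  (forall j, a j.+1 <= 2 * a j) -> (forall M : R, exists j, M < a j) ->
  ~ Delta2_zero phi -> forall (K : R) (J : nat), exists u j,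
    [/\ 0 < u, (J <= j)%N, K * phi u <= phi (2 * u) & 2^-1 <= a j * phi (2 * u) <= 1].
Proof.
move=> a0 nda a2 ay nD K J.
have aJ : 0 < a J by apply: lt_le_trans a0 (nda _ _ _).
have p1 := Orlicz_gt0 phiN (ltr01 : 0 < 1 :> R).
(* For [2 * u <= 1] convexity gives [phi (2 * u) <= 2 * u * phi 1], so [u <= u0] forces
   [a J * phi (2 * u) <= 1]. *)
pose u0 := Num.min (1 / 2) (1 / (2 * phi 1 * a J)).
have u00 : 0 < u0 by rewrite lt_min !divr_gt0// !mulr_gt0.
have [u [/andP[uu0 uu] Ku]] : exists u, 0 < u <= u0 /\ K * phi u < phi (2 * u).
  apply: contrapT => nex; apply: nD; exists (Num.max K 1), u0; split => //.
    by rewrite lt_max ltr01 orbT.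
  move=> u /andP[ugt ule]; rewrite leNgt; apply/negP => h; apply: nex; exists u.
  split; first by rewrite ugt.
  apply: le_lt_trans h; rewrite ler_wpM2r ?(Orlicz_ge0 phiN) ?(ltW ugt)//.
  by rewrite le_max lexx.
have u20 : 0 < 2 * u by rewrite mulr_gt0.
have p2 := Orlicz_gt0 phiN u20.
have aJ1 : a J * phi (2 * u) <= 1.
  have ule1 : u <= 1 / 2 by apply: le_trans uu _; rewrite ge_min lexx.
  have ule2 : u <= 1 / (2 * phi 1 * a J) by apply: le_trans uu _; rewrite ge_min lexx orbT.
  have := @Orlicz_scale _ phi phiN (2 * u) 1; rewrite mulr1 => /(_ _ ler01) h.
  have {}h : phi (2 * u) <= 2 * u * phi 1 by apply: h; lra.
  have : a J * phi (2 * u) <= a J * (2 * u * phi 1) by rewrite ler_pM2l.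
  move/le_trans; apply; move: ule2; rewrite ler_pdivlMr ?mulr_gt0//; lra.
have ex : exists j, (J <= j)%N && (1 < a j.+1 * phi (2 * u)).
  have [j Hj] := ay (phi (2 * u))^-1; exists (maxn J j); rewrite leq_maxl/=.
  rewrite -ltr_pdivrMr// mul1r; apply: (lt_le_trans Hj); apply: nda.
  by rewrite (leq_trans (leq_maxr J j)).
case: (ex_minnP ex) => j /andP[Jj aj] jmin.
exists u, j; split => //; first exact: ltW.
have a2j : a j.+1 * phi (2 * u) <= 2 * a j * phi (2 * u) by rewrite ler_pM2r.
apply/andP; split; first by lra.
have [<-//|ltJj] := eqVneq J j.
have j0 : (J < j)%N by rewrite ltn_neqAle ltJj.
rewrite leNgt; apply/negP => h.
have := jmin j.-1; rewrite (ltn_predK j0) h andbT -ltnS (ltn_predK j0) j0 => /(_ isT).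
by rewrite leqNgt -ltnS (ltn_predK j0) ltnS leqnn.
Qed.

(** The mirror image: for large [u] the product [a J * phi (2 * u)] is above 1, and the first [j]
    that brings it to at most 1 leaves it above 1/2, since one step at most halves [a]. *)
Lemma selection_infty : (forall j, 0 < a j) ->
  (forall j, a j <= 2 * a j.+1) -> (forall M : R, 0 < M -> forall J, exists2 j, (J <= j)%N & a j <= M) ->
  ~ Delta2_infty phi -> forall (K : R) (J : nat), exists u j,
    [/\ 0 < u, (J <= j)%N, K * phi u <= phi (2 * u) & 2^-1 <= a j * phi (2 * u) <= 1].
Proof.
move=> a0 a2 ay nD K J.
have [v v1 Hv] := Orlicz_unbounded phiN (a J)^-1.
have [u [uv Ku]] : exists u, v <= u /\ K * phi u < phi (2 * u).
  apply: contrapT => nex; apply: nD; exists (Num.max K 1), v; split => //.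
  - by rewrite lt_max ltr01 orbT.
  - lra.
  move=> u vu; rewrite leNgt; apply/negP => h; apply: nex; exists u.
  split => //; apply: le_lt_trans h; rewrite ler_wpM2r ?(Orlicz_ge0 phiN)//; first lra.
  by rewrite le_max lexx.
have u0 : 0 < u by lra.
have u20 : 0 < 2 * u by rewrite mulr_gt0.
have p2 := Orlicz_gt0 phiN u20.
have aJ1 : 1 < a J * phi (2 * u).
  have : (a J)^-1 * (2 * u) <= phi (2 * u) by apply: Hv; lra.
  rewrite -(ler_pM2l (a0 J)) mulrA mulfV ?gt_eqF// mul1r => h; lra.
have ex : exists j, (J <= j)%N && (a j * phi (2 * u) <= 1).
  have [|j Jj Hj] := ay (phi (2 * u))^-1 _ J; first by rewrite invr_gt0.
  by exists j; rewrite Jj/= -ler_pdivlMr// mul1r.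
case: (ex_minnP ex) => j /andP[Jj aj] jmin.
exists u, j; split => //; first exact: ltW.
rewrite aj andbT; have [E|ltJj] := eqVneq J j; first by move: aj; rewrite -E leNgt aJ1.
have j0 : (J < j)%N by rewrite ltn_neqAle ltJj.
have : 1 < a j.-1 * phi (2 * u).
  rewrite ltNge; apply/negP => h.
  have := jmin j.-1; rewrite h andbT -ltnS (ltn_predK j0) j0 => /(_ isT).
  by rewrite leqNgt -ltnS (ltn_predK j0) ltnS leqnn.
have a2j : a j.-1 * phi (2 * u) <= 2 * a j * phi (2 * u).
  by rewrite ler_pM2r// -{2}(ltn_predK j0).
lra.
Qed.

End selection.

(** * Failure of the M-ideal property from sets of dyadic masses *)

Section not_M_ideal.
Context {R : realType} {d} {T : measurableType d}.
Context {mu : {sigma_finite_measure set T -> \bar R}} {I : set T} {m w : T -> R}.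
Context {phi : R -> R}.
Hypotheses (H : weighted_line mu I m w) (phiN : N_function phi).
Local Open Scope ereal_scope.
Local Notation segment := (segment I m).
Local Notation W := (cumulated_weight mu I m w).
Local Notation X := (Lorentz_space mu I m w phi).
Local Notation N := (Lorentz_norm mu I m w phi).
Local Notation Y := (order_continuous_part mu I X N).
Variable D : nat -> set T.
Hypotheses (mD : forall j, measurable (D j)) (DI : forall j, D j `<=` I).
Hypotheses (D0 : forall j, 0 < mu (D j)) (Doo : forall j, mu (D j) < +oo).
Hypothesis (tD : trivIset setT D).
Let a j := fine (W (mu (D j))).

Let WE j : W (mu (D j)) = (a j)%:E.
Proof. by rewrite fineK// (cumulated_weight_fin H). Qed.

Let a0 j : (0 < a j)%R.
Proof. by rewrite -lte_fin -WE (cumulated_weight_gt0 H). Qed.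

Lemma selection_not_M_ideal : (forall (K : R) (J : nat), exists u j,
    [/\ (0 < u)%R, (J <= j)%N, (K * phi u <= phi (2 * u))%R &
        (2^-1 <= a j * phi (2 * u) <= 1)%R]) -> ~ M_ideal X N Y.
Proof.
move=> sel.
pose P (p : nat * nat) (q : R * nat) := [/\ (0 < q.1)%R, (p.2 <= q.2)%N,
  ((2 ^ p.1.+1)%:R * phi q.1 <= phi (2 * q.1))%R & (2^-1 <= a q.2 * phi (2 * q.1) <= 1)%R].
have Pex p : exists q, P p q.
  by case: p => k J; have [u [j h]] := sel (2 ^ k.+1)%:R J; exists (u, j).
have [F HF] := choice Pex.
(* Each selection starts past the index of the preceding one, so the indices are distinct and the
   chosen sets are disjoint. *)
pose p := fix p k := if k is k'.+1 then F (k, (p k').2.+1) else F (0%N, 0%N).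
have Hp k : exists J, p k = F (k, J) by case: k => [|k]; eexists.
have pmono k : ((p k).2 < (p k.+1).2)%N by have [_ + _ _] := HF (k.+1, (p k).2.+1).
have pinj k l : (p k).2 = (p l).2 -> k = l.
  have lt : {homo (fun k => (p k).2) : i j / (i < j)%N >-> (i < j)%N}.
    by apply: homo_ltn => //; exact: ltn_trans.
  by have [/lt|/lt|//] := ltngtP k l => + e; rewrite e ltnn.
apply: (@bump_not_M_ideal _ _ _ _ _ _ _ _ H phiN (fun k => D (p k).2) (fun k => (p k).1)).
- by move=> k; exact: mD.
- by move=> k; exact: DI.
- by move=> k; exact: D0.
- by move=> k; exact: Doo.
- by move=> k l _ _ kl; apply: pinj; exact: tD.
- by move=> k; have [J ->] := Hp k; have [] := HF (k, J).
- by move=> k; have [J ->] := Hp k; have [_ _ _ /andP[]] := HF (k, J); rewrite WE -EFinM lee_fin.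
- by move=> k; have [J ->] := Hp k; have [_ _ _ /andP[]] := HF (k, J); rewrite WE -EFinM lee_fin.
- by move=> k; have [J ->] := Hp k; have [_ _ h _] := HF (k, J); rewrite mulrC.
Qed.

Let segD j : mu (segment (mu (D j))) = mu (D j).
Proof. exact: (wl_segment H). Qed.

(** Concavity turns doubling masses into weights that at most double, and the infinite total weight
    makes them unbounded. Large sets carry the small heights at which Delta_2 fails near 0. *)
Lemma tail_not_M_ideal : mu I = +oo -> (forall j, mu (D j) = (2 ^+ j)%:E) ->
  ~ Delta2_zero phi -> ~ M_ideal X N Y.
Proof.
move=> Ioo muD nD; apply: selection_not_M_ideal.
have leD i j : (i <= j)%N -> mu (D i) <= mu (D j).
  by move=> ij; rewrite !muD lee_fin ler_weXn2l// ler1n.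
apply: (selection_zero phiN) => //.
- by move=> i j ij; rewrite -lee_fin -!WE; apply: le_cumulated_weight H _ _ (leD _ _ ij).
- move=> j; have := cumulated_weight_concave H (mD j) (@DI j) (mD j.+1) (@DI j.+1)
    (leD _ _ (leqnSn j)) (Doo j.+1).
  rewrite !WE !muD -!EFinM lee_fin exprSr -mulrA ler_pM2l// exprn_gt0//.
- move=> M; apply: contrapT => nM.
  have mS j : measurable (segment (mu (D j))) by exact: measurable_segment H _.
  have SI j : segment (mu (D j)) `<=` I by exact: segment_sub.
  have ndS : nondecreasing_seq (fun j => segment (mu (D j))).
    by move=> i j ij; apply/subsetPset; apply: le_segment; exact: leD.
  have WM j : W (mu (segment (mu (D j)))) <= M%:E.
    by rewrite segD WE lee_fin leNgt; apply/negP => h; apply: nM; exists j.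
  have := cumulated_weight_bigcup_le H mS SI ndS WM.
  rewrite (_ : \bigcup_j _ = I).
    by rewrite Ioo (cumulated_weight_infty H Ioo) leNgt ltry.
  apply/seteqP; split => t; first by move=> [j _ []].
  move=> It; exists (Num.truncn (m t)).+1 => //; split => //=.
  rewrite muD lte_fin; apply: (lt_le_trans (truncnS_gt _)).
  by rewrite -natrX ler_nat ltnW// ltn_expl.
Qed.

(** Halving masses give weights that at most halve and tend to 0 by absolute continuity. Small sets
    carry the large heights at which Delta_2 fails near infinity. *)
Lemma blowup_not_M_ideal (c : R) : (0 < c)%R -> (forall j, mu (D j) = (c / 2 ^+ j)%:E) ->
  ~ Delta2_infty phi -> ~ M_ideal X N Y.
Proof.
move=> c0 muD nD; apply: selection_not_M_ideal.
have p2 j : (0 < 2 ^+ j :> R)%R by rewrite exprn_gt0.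
have leD i j : (i <= j)%N -> mu (D j) <= mu (D i).
  move=> ij; rewrite !muD lee_fin ler_pM2l// lef_pV2 ?posrE//.
  by rewrite ler_weXn2l// ler1n.
apply: (selection_infty phiN) => //.
- move=> j; have := cumulated_weight_concave H (mD j.+1) (@DI j.+1) (mD j) (@DI j)
    (leD _ _ (leqnSn j)) (Doo j).
  rewrite !WE !muD -!EFinM lee_fin exprS invfM.
  rewrite (_ : c * (2^-1 * (2 ^+ j)^-1) * a j = c / 2 ^+ j * (2^-1 * a j))%R; last by ring.
  by rewrite ler_pM2l ?divr_gt0//; lra.
- move=> M M0 J.
  have mS j : measurable (segment (mu (D j))) by exact: measurable_segment H _.
  have SI j : segment (mu (D j)) `<=` I by exact: segment_sub.
  have S0oo : mu (segment (mu (D 0%N))) < +oo by rewrite segD.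
  have [r r0 Hr] := cumulated_weight_small H (mS 0%N) (@SI 0%N) S0oo M0.
  pose j := maxn J (Num.truncn (c / r)).+1.
  exists j; first exact: leq_maxl.
  rewrite -lee_fin -WE -segD; apply: Hr => //.
    by apply: le_segment; exact: leD.
  rewrite segD muD lee_fin ler_pdivrMr// mulrC -ler_pdivrMr//.
  apply: (le_trans (ltW (truncnS_gt _))); rewrite -natrX ler_nat.
  apply: (leq_trans (leq_maxr J _)); exact/ltnW/ltn_expl.
Qed.

End not_M_ideal.

(** * Sequence spaces *)

HB.instance Definition _ (R : realType) :=
  @Measure_isSigmaFinite.Build _ nat R (@counting nat R) (sigma_finite_counting R).

Section sequence_instance.
Context {R : realType}.
Variable w : nat -> R.
Hypothesis hw : weight_sequence w.
Local Open Scope ereal_scope.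
Local Notation mu := (@counting nat R).
Local Notation pos := (fun i : nat => i%:R : R).

Lemma counting_ord (n : nat) : mu `I_n = n%:R%:E.
Proof. by rewrite /counting asboolT// (@card_fset_set _ _ n). Qed.

Lemma counting_setT : mu [set: nat] = +oo.
Proof. by rewrite /counting asboolF//; exact: infinite_nat. Qed.

Lemma counting_or (A : set nat) : mu A = +oo \/ exists n : nat, mu A = n%:R%:E.
Proof. by rewrite /counting; case: ifPn => _; [right; eexists|left]. Qed.

Lemma segment_nat (n : nat) : segment [set: nat] pos n%:R%:E = `I_n.
Proof.
by apply/seteqP; split => i; [move=> [_] /=|move=> /= ?; split => //=]; rewrite lte_fin ltr_nat.
Qed.

Lemma weighted_line_nat : weighted_line mu [set: nat] pos w.
Proof.
case: hw => w0 wd winf; split => //.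
- move=> E mE _; change (mu (segment [set: nat] pos (mu E)) = mu E).
  have [Eoo|[n En]] := counting_or E.
    by rewrite Eoo (_ : segment _ _ _ = setT) ?counting_setT//; apply/seteqP; split => // i _; split => //=; rewrite ltry.
  by rewrite En segment_nat counting_ord.
- move=> c; rewrite /cumulated_weight.
  have [n cn] : exists n : nat, (c < n%:R)%R by exists (Num.truncn c).+1; exact: truncnS_gt.
  apply: (@le_lt_trans _ _ (\int[mu]_(t in `I_n) (cst (w 0%N)%:E) t)).
    apply: (@le_trans _ _ (\int[mu]_(t in `I_n) (w t)%:E)).
      apply: ge0_subset_integral => //; first by move=> t _; rewrite lee_fin ltW.
      by move=> i [_ /=]; rewrite lte_fin => /lt_trans/(_ cn); rewrite ltr_nat.
    by apply: ge0_le_integral => // i _; rewrite lee_fin; [exact: ltW|exact: wd].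
  by rewrite integral_cst// [X in _ * X]counting_ord -EFinM ltry.
- by move=> _; rewrite ge0_integral_count// => i; rewrite lee_fin ltW.
move=> c c0.
have ex : exists n : nat, (c <= n%:R)%R by exists (Num.truncn c).+1; exact/ltW/truncnS_gt.
(* [k] is the first index at position at least [c], so [w k] separates the weights before and after
   [c]. *)
case: (ex_minnP ex) => k ck kmin.
exists (w k); split; first exact: ltW.
  by move=> t _ ct; apply: wd; exact: kmin.
apply: aeW => t _ tc; apply: wd; rewrite leqNgt; apply/negP => kt.
by have := lt_le_trans tc ck; rewrite ltr_nat ltnNge ltnW.
Qed.

(** Cardinals are integers or infinite, so the strict bound by [i + 1] is the large bound by [i],
    the mass located before the index [i]. *)
Lemma seq_rearrangementE (x : nat -> R) : seq_rearrangement x = rearr mu [set: nat] pos x.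
Proof.
apply/funext => i; rewrite /seq_rearrangement /rearr; congr (ereal_inf (image _ _)).
have sE l : superlevel [set: nat] x l = [set i | (l < `|x i|)%R].
  by apply/seteqP; split => j; [case|].
have lt_le (A : set nat) : (mu A < i.+1%:R%:E) = (mu A <= i%:R%:E).
  by have [->|[n ->]] := counting_or A; rewrite ?lte_fin ?lee_fin ?ltr_nat ?ler_nat// leye_eq ltNge leey.
by apply/seteqP; split => l /= [l0]; rewrite sE /seq_distribution lt_le.
Qed.

Lemma alphaE (psi : R -> \bar R) : (forall x, 0 <= x -> 0 <= ext_at_infty psi x) ->
  alpha w psi = modular mu [set: nat] pos w psi.
Proof.
move=> psi0; apply/funext => x; rewrite /alpha /modular seq_rearrangementE ge0_integral_count// => i.
by rewrite mule_ge0 ?psi0 ?rearr_ge0// lee_fin; case: hw => /(_ i)/ltW.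
Qed.

Variables (phi : R -> R) (phiN : N_function phi).

Lemma seq_Orlicz_Lorentz_spaceE :
  seq_Orlicz_Lorentz_space w phi = Lorentz_space mu [set: nat] pos w phi.
Proof.
rewrite /seq_Orlicz_Lorentz_space /Lorentz_space alphaE; last by move=> x; exact: ephi_ge0.
by apply/seteqP; split => x; [split|case].
Qed.

Lemma seq_Orlicz_Lorentz_normE :
  seq_Orlicz_Lorentz_norm w phi = Lorentz_norm mu [set: nat] pos w phi.
Proof.
apply/funext => x; rewrite /seq_Orlicz_Lorentz_norm /Lorentz_norm alphaE; last first.
  by move=> y _; exact: epsi_ge0.
have pE y : \sum_(0 <= i <oo)
    (seq_rearrangement x i * seq_rearrangement y i * (w i)%:E) = pairing mu [set: nat] pos w x y.
  rewrite /pairing !seq_rearrangementE ge0_integral_count// => i.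
  by rewrite !mule_ge0 ?rearr_ge0// lee_fin; case: hw => /(_ i)/ltW.
congr ereal_sup; apply/seteqP; split => z [y].
  by move=> y1 <-; exists y; [split|rewrite -pE].
by move=> [_ y1] <-; exists y; [|rewrite -pE].
Qed.

Lemma seq_Orlicz_Lorentz_not_M_ideal : ~ Delta2_zero phi ->
  ~ M_ideal (seq_Orlicz_Lorentz_space w phi) (seq_Orlicz_Lorentz_norm w phi)
            (seq_Orlicz_Lorentz_oc w phi).
Proof.
move=> nD; rewrite /seq_Orlicz_Lorentz_oc seq_Orlicz_Lorentz_spaceE seq_Orlicz_Lorentz_normE.
(* Disjoint dyadic blocks, the [j]-th having exactly [2 ^ j] elements. *)
pose D j := [set i | (2 ^ j <= i < 2 ^ j.+1)%N].
have muD j : mu (D j) = (2 ^+ j)%:E.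
  have e : D j `|` `I_(2 ^ j) = `I_(2 ^ j.+1).
    apply/seteqP; split => i; rewrite /D /=.
      by move=> [/andP[]//|/leq_trans]; apply; rewrite leq_exp2l.
    by move=> ij; have [ij'|ij'] := leqP (2 ^ j) i; [left; apply/andP|right].
  have /= := @measureU _ _ _ mu (D j) `I_(2 ^ j).
  have d0 : D j `&` `I_(2 ^ j) = set0.
    by apply/seteqP; split => // i [/andP[ij _]] /=; rewrite ltnNge ij.
  move=> /(_ Logic.I Logic.I d0); rewrite e !counting_ord.
  have [->|[n ->]] := counting_or (D j); first by [].
  move=> [] /eqP; rewrite -natrD eqr_nat expnS mul2n -addnn eqn_add2r => /eqP <-.
  by rewrite natrX.
apply: (@tail_not_M_ideal _ _ _ _ _ _ _ _ weighted_line_nat phiN D).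
- by [].
- by [].
- by move=> j; change (0 < mu (D j)); rewrite muD lte_fin exprn_gt0.
- by move=> j; change (mu (D j) < +oo); rewrite muD ltry.
- move=> i j _ _ [t [/andP[it ti] /andP[jt tj]]].
  apply/eqP; rewrite eqn_leq; apply/andP; split; rewrite -ltnS -(@ltn_exp2l 2)//.
    exact: leq_ltn_trans it tj.
  exact: leq_ltn_trans jt ti.
- exact: counting_setT.
- exact: muD.
- exact: nD.
Qed.

End sequence_instance.

(** * Function spaces *)

Section completed_lebesgue.
Context {R : realType}.
Local Open Scope ereal_scope.
Local Notation leb := (@lebesgue_measure R).
Local Notation cleb := (@completed_lebesgue_measure R).
Local Notation BR := (measurableTypeR R).
Local Notation CR := (caratheodory_type (@wlength R idfun)^*%mu).

Lemma measurable_completed (A : set R) : measurable (A : set BR) -> measurable (A : set CR).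
Proof. exact: sub_caratheodory. Qed.

Lemma measurable_fun_completed d' (U : measurableType d') (D : set R) (f : R -> U) :
  measurable_fun (D : set BR) f -> measurable (D : set BR) -> measurable_fun (D : set CR) f.
Proof. by move=> mf mD _ B mB; apply: measurable_completed; exact: mf. Qed.

Lemma ge0_integral_completed (D : set R) (f : R -> \bar R) : measurable (D : set BR) ->
  measurable_fun (D : set BR) f -> (forall t, D t -> 0 <= f t) ->
  \int[leb]_(t in D) f t = \int[cleb]_(t in D) f t.
Proof.
move=> mD mf f0.
have mid : measurable_fun [set: CR] (idfun : CR -> BR).
  by move=> _ B mB; rewrite setTI; exact: measurable_completed.
have := ge0_integral_pushforward mid cleb mD mf.
move=> /(_ (fun t Dt => f0 t (set_mem Dt))) <-.
by apply: eq_measure_integral => A mA _.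
Qed.

Lemma completed_ae (P : set R) :
  {ae leb, forall t, P t} <-> {ae cleb, forall t, P t}.
Proof.
split=> [[N [mN N0 PN]]|[N [mN N0 PN]]].
  by exists N; split => //; exact: measurable_completed.
have : (completed_algebra_gen leb).-sigma.-measurable N.
  by rewrite completed_caratheodory_measurable.
rewrite g_sigma_completed_algebra_genE => -[A /= mA [M negM] AMN].
have [Z [mZ Z0 MZ]] := negM.
(* A null set of the completion is a Borel set [A], itself null, together with a subset of a Borel
   null set [Z]. *)
exists (A `|` Z); split.
- exact: measurableU.
- have lA : leb A <= 0.
    rewrite -[leRHS]N0; change (cleb A <= cleb N).
    apply: le_measure; rewrite ?inE//; first exact: measurable_completed.
    by rewrite -AMN; exact: subsetUl.
  rewrite measureU0//; apply/eqP; rewrite -measure_le0; exact: lA.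
- by apply: (subset_trans PN); rewrite -AMN; exact: setUS.
Qed.

(** The sigma-algebra generated by adding null sets coincides with the Caratheodory one, on which
    the completed measure lives. *)
Lemma L0E (gamma : \bar R) (f : R -> R) :
  L0 gamma f <-> measurable_fun (domain gamma : set CR) f.
Proof.
have e := @completed_caratheodory_measurable R.
split=> mf mD B mB.
  have mD' : (completed_algebra_gen leb).-sigma.-measurable (domain gamma) by rewrite e.
  have h : (completed_algebra_gen leb).-sigma.-measurable (domain gamma `&` f @^-1` B).
    exact: mf mD' B mB.
  by move: h; rewrite e.
have mD' : (@wlength R idfun)^*%mu.-cara.-measurable (domain gamma) by rewrite -e.
have h : (@wlength R idfun)^*%mu.-cara.-measurable (domain gamma `&` f @^-1` B).
  exact: mf mD' B mB.
by move: h; rewrite -e.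
Qed.

End completed_lebesgue.

(** * The interval as a weighted line *)

Section function_instance.
Context {R : realType}.
Variables (gamma : \bar R) (w : R -> R).
Hypotheses (gamma0 : (0 < gamma)%E) (hw : weight_function gamma w).
Local Open Scope ereal_scope.
Local Notation leb := (@lebesgue_measure R).
Local Notation cleb := (@completed_lebesgue_measure R).
Local Notation BR := (measurableTypeR R).
Local Notation CR := (caratheodory_type (@wlength R idfun)^*%mu).
Local Notation I := (domain gamma).

Lemma measurable_ray (x : \bar R) : measurable ([set t : R | (0 <= t)%R /\ t%:E < x] : set BR).
Proof.
have -> : [set t : R | (0 <= t)%R /\ t%:E < x] = `[0%R, +oo[%classic `&` (EFin @^-1` `]-oo, x[%classic).
  by apply/seteqP; split => t /=; rewrite in_itv/= ?andbT.
apply: measurableI; first exact: measurable_itv.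
by rewrite -[X in measurable X]setTI; apply: EFin_measurable => //; exact: emeasurable_itv.
Qed.

Let mI : measurable (I : set BR). Proof. exact: measurable_ray. Qed.
Let mIc : measurable (I : set CR). Proof. exact: measurable_completed. Qed.

Lemma cleb_domain : cleb I = gamma.
Proof. by change (leb I = gamma); rewrite lebesgue_ray// ltW. Qed.

Lemma measurable_weight_function : measurable_fun (I : set BR) (EFin \o w).
Proof.
case: hw => _ wd _ _.
have mI0 : measurable ((I `&` `]0%R, +oo[%classic) : set BR).
  by apply: measurableI => //; exact: measurable_itv.
have -> : I = [set 0%R] `|` (I `&` `]0%R, +oo[%classic) :> set R.
  apply/seteqP; split => t; last first.
    by move=> [->|[]//]; split => //=.
  move=> [t0 tg]; have [->|tn0] := eqVneq t 0%R; [by left|right; split => //=].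
  by rewrite in_itv/= andbT lt_neqAle eq_sym tn0.
apply/measurable_funU => //; split; first exact: measurable_fun_set1.
apply: (@measurable_antitone R _ BR _ id) => //.
move=> s t [Is]; rewrite /= in_itv/= andbT => s0 [It _] st.
by rewrite lee_fin; apply: wd.
Qed.

Lemma domain_inner : exists2 t0 : R, (0 < t0)%R & I t0.
Proof.
case: gamma gamma0 => [r| |]// r0.
  exists (r / 2)%R; first by rewrite divr_gt0.
  split; first by rewrite divr_ge0// ltW.
  by rewrite lte_fin; move: r0; rewrite lte_fin => r0; lra.
by exists 1%R => //; split; rewrite ?ltry.
Qed.

Lemma weighted_line_domain : weighted_line cleb (I : set CR) id w.
Proof.
case: (hw) => w0 wd wloc winf.
have mw := measurable_weight_function.
have mwc : measurable_fun (I : set CR) (EFin \o w) by exact: measurable_fun_completed.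
have ww t : I t -> 0 <= (EFin \o w) t by move=> It; rewrite lee_fin ltW// w0.
split.
- exact: mIc.
- by apply: measurable_fun_completed => //; exact: measurable_id.
- by move=> t [].
- exact/measurable_EFinP.
- exact: w0.
- move=> E mE EI.
  have Eg : cleb E <= gamma by rewrite -cleb_domain; apply: le_measure; rewrite ?inE.
  have e : segment I (id : R -> R) (cleb E) = [set t : R | (0 <= t)%R /\ t%:E < cleb E].
    apply/seteqP; split => t; first by move=> [[]].
    by move=> [t0 tE]; split => //; split => //; exact: lt_le_trans Eg.
  apply: (@eq_trans _ _ (leb [set t : R | (0 <= t)%R /\ t%:E < cleb E])).
    by rewrite -e.
  by rewrite lebesgue_ray.
(* Local integrability only reaches points of the domain. Past an interior point [t0] the weight is
   at most [w t0], on a set of finite length. *)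
- move=> c; have [t0 t00 It0] := domain_inner.
  pose A := `[0%R, t0]%classic : set R; pose B := segment I id c%:E `\` A.
  have mA : measurable (A : set BR) by exact: measurable_itv.
  have AI : A `<=` I.
    move=> t; rewrite /A /= in_itv/= => /andP[tge tle]; split => //.
    by apply: le_lt_trans It0.2; rewrite lee_fin.
  have mS : measurable (segment I id c%:E : set BR).
    rewrite (_ : segment I id c%:E = I `&` [set t : R | (0 <= t)%R /\ t%:E < c%:E]).
      by apply: measurableI => //; exact: measurable_ray.
    by apply/seteqP; split => t [[tge tg] h]; split => //; case: h.
  have mB : measurable (B : set BR) by exact: measurableD.
  have BI : B `<=` I by move=> t [[]].
  rewrite /cumulated_weight -ge0_integral_completed//; last 2 first.
  + by apply: measurable_funS mw => // t [].
  + by move=> t [It _]; exact: ww.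
  apply: (@le_lt_trans _ _ (\int[leb]_(t in A `|` B) (w t)%:E)).
    apply: ge0_subset_integral => //; first exact: measurableU.
    + by apply: measurable_funS mw => // t [/AI|/BI].
    + by move=> t [/AI|/BI] /ww.
    + by move=> t St; have [At|nA] := pselect (A t); [left|right].
  rewrite ge0_integral_setU//; last 3 first.
  + by apply: measurable_funS mw => // t [/AI|/BI].
  + by move=> t [/AI|/BI] /ww.
  + by rewrite disj_set2E setDIK.
  apply: lte_add_pinfty; first exact: wloc.
  apply: (@le_lt_trans _ _ (\int[leb]_(t in B) (cst (w t0)%:E t))).
    apply: ge0_le_integral => //.
    + by move=> t /BI /ww.
    + exact: measurable_funS mw.
    + move=> t [[It _] nA]; rewrite lee_fin; apply: wd => //.
      rewrite leNgt; apply/negP => tt0; apply: nA; rewrite /A /= in_itv/=.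
      by case: It => -> _; rewrite ltW.
  rewrite integral_cst//; apply: lte_mul_pinfty => //; first by rewrite lee_fin ltW// w0.
  apply: (@le_lt_trans _ _ (leb [set t : R | (0 <= t)%R /\ t%:E < (`|c|%R)%:E])).
    apply: le_measure; rewrite ?inE//; first exact: measurable_ray.
    move=> t [[[tge _] tc] _]; split => //; apply: (lt_le_trans tc).
    by rewrite lee_fin ler_norm.
  by rewrite lebesgue_ray ?ltry// lee_fin.
- move=> Ioo; rewrite -ge0_integral_completed//; apply: winf.
  by rewrite -cleb_domain.
(* Inside the domain the threshold is [w c], with exceptional set [{0}], where monotonicity is not
   assumed. Otherwise no position reaches [c] and 0 will do. *)
move=> c c0; have [cg|cg] := ltP c%:E gamma.
  have Ic : I c by split => //; exact: ltW.
  exists (w c); split; first by rewrite ltW// w0.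
    by move=> t It ct; exact: wd.
  exists [set 0%R]; split.
  + by apply: measurable_completed; exact: measurable_set1.
  + by change (leb [set 0%R] = 0); rewrite lebesgue_measure_set1.
  move=> t /= h; apply: contrapT => t0; apply: h => It tc; apply: wd => //; last exact: ltW.
  by case: It => tge _; rewrite lt_neqAle tge andbT; apply/eqP => e; apply: t0.
exists 0%R; split => //.
  by move=> t [_ tg] ct; move: (lt_le_trans tg cg); rewrite lte_fin ltNge ct.
by apply: aeW => t It _; rewrite ltW// w0.
Qed.

Local Notation H := weighted_line_domain.

Lemma measurable_borel_decr (G : R -> \bar R) :
  (forall s t, I s -> I t -> (s <= t)%R -> G t <= G s) -> measurable_fun (I : set BR) G.
Proof. by move=> dG; apply: (@measurable_antitone R _ BR _ id). Qed.

(** Even for a merely Lebesgue measurable [f] the integrand is Borel, since the rearrangement is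
    monotone in [t]. *)
Lemma rhoE (psi : R -> \bar R) (f : R -> R) : L0 gamma f ->
  (forall x, 0 <= x -> 0 <= ext_at_infty psi x) ->
  (forall x y, 0 <= x -> x <= y -> ext_at_infty psi x <= ext_at_infty psi y) ->
  rho gamma w psi f = modular cleb (I : set CR) id w psi f.
Proof.
move=> /L0E mf psi0 psile; apply: ge0_integral_completed => //.
  apply: emeasurable_funM; last exact: measurable_weight_function.
  apply: measurable_borel_decr => s t Is It st; apply: psile; first exact: rearr_ge0.
  exact: (rearr_decr H mf).
move=> t It; rewrite mule_ge0 ?psi0//; first exact: rearr_ge0.
by case: hw => w0 _ _ _; rewrite lee_fin ltW// w0.
Qed.

Variables (phi : R -> R) (phiN : N_function phi).

Lemma Orlicz_Lorentz_spaceE :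
  Orlicz_Lorentz_space gamma w phi = Lorentz_space cleb (I : set CR) id w phi.
Proof.
have e l f : measurable_fun (I : set CR) (f : R -> R) ->
    rho gamma w (EFin \o phi) (l *: f)%R = modular cleb (I : set CR) id w (EFin \o phi) (l *: f)%R.
  move=> mf; apply: rhoE.
  - by apply/L0E; exact: measurable_funZ.
  - by move=> x; exact: ephi_ge0.
  - by move=> x y; exact: ephi_le.
apply/seteqP; split => f.
  by move=> [/L0E mf [l l0 h]]; split => //; exists l => //; rewrite -e.
by move=> [mf [l l0 h]]; split; [exact/L0E|exists l => //; rewrite e].
Qed.

Lemma Orlicz_Lorentz_normE (f : R -> R) : L0 gamma f ->
  Orlicz_Lorentz_norm gamma w phi f = Lorentz_norm cleb (I : set CR) id w phi f.
Proof.
move=> /L0E mf.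
have re g : measurable_fun (I : set CR) g ->
    rho gamma w (complementary phi) g = modular cleb (I : set CR) id w (complementary phi) g.
  move=> mg; apply: rhoE; first exact/L0E.
  - by move=> x _; exact: epsi_ge0.
  - by move=> x y; exact: epsi_le.
have pe g : measurable_fun (I : set CR) g ->
    \int[leb]_(t in I) (rearrangement gamma f t * rearrangement gamma g t * (w t)%:E) =
    pairing cleb (I : set CR) id w f g.
  move=> mg; apply: ge0_integral_completed => //.
    apply: emeasurable_funM; last exact: measurable_weight_function.
    by apply: emeasurable_funM; apply: measurable_borel_decr => s t Is It st; exact: (rearr_decr H).
  move=> t It; rewrite !mule_ge0 ?rearr_ge0//.
  by case: hw => w0 _ _ _; rewrite lee_fin ltW// w0.
congr ereal_sup; apply/seteqP; split => z [g].
  by move=> [/L0E mg g1] <-; exists g; [split; rewrite -?re|rewrite pe].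
by move=> [mg g1] <-; exists g; [split; [exact/L0E|rewrite re]|rewrite pe].
Qed.

End function_instance.

(** Needed because the concrete and the generic norm are identified on measurable functions only. *)
Lemma eq_M_ideal {R : realType} {V : lmodType R} (X : set V) (N N' : V -> \bar R) (Y : set V) :
  (forall x, X x -> N x = N' x) -> M_ideal X N Y = M_ideal X N' Y.
Proof.
move=> NN'; have e : dual_norm X N = dual_norm X N'.
  apply/funext => l; congr ereal_sup; congr image.
  by apply/seteqP; split => x [Xx]; [rewrite NN'|rewrite -NN'].
by rewrite /M_ideal /annihilator /dual e.
Qed.

Section function_not_M_ideal.
Context {R : realType}.
Variables (gamma : \bar R) (w phi : R -> R).
Hypotheses (gamma0 : (0 < gamma)%E) (hw : weight_function gamma w) (phiN : N_function phi).
Local Open Scope ereal_scope.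
Local Notation leb := (@lebesgue_measure R).
Local Notation cleb := (@completed_lebesgue_measure R).
Local Notation BR := (measurableTypeR R).
Local Notation CR := (caratheodory_type (@wlength R idfun)^*%mu).
Local Notation I := (domain gamma).
Local Notation X := (Lorentz_space cleb (I : set CR) id w phi).
Local Notation N := (Lorentz_norm cleb (I : set CR) id w phi).
Local Notation H := (weighted_line_domain gamma0 hw).

Let XN f : X f -> Orlicz_Lorentz_norm gamma w phi f = N f.
Proof. by move=> [mf _]; apply: Orlicz_Lorentz_normE => //; exact/L0E. Qed.

Lemma Orlicz_Lorentz_ocE :
  Orlicz_Lorentz_oc gamma w phi = order_continuous_part cleb (I : set CR) X N.
Proof.
rewrite /Orlicz_Lorentz_oc Orlicz_Lorentz_spaceE//.
pose tends0 (v : nat -> \bar R) := nonincreasing_seq v /\ v n @[n --> \oo] --> 0.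
have e (u : nat -> CR -> R) : (forall n, X (u n)) ->
    N \o u = Orlicz_Lorentz_norm gamma w phi \o u.
  by move=> Xu; apply/funext => n; exact: (esym (XN (Xu n))).
apply/seteqP; split => x [Xx Yx]; (split; [exact: Xx|move=> u Xu u0 ud]).
  suff: tends0 (N \o u) by exact.
  rewrite e; last exact: Xu.
  exact: Yx u Xu (fun n => (completed_ae _).2 (u0 n)) ((completed_ae _).2 ud).
suff: tends0 (Orlicz_Lorentz_norm gamma w phi \o u) by exact.
rewrite -e; last exact: Xu.
exact: Yx u Xu (fun n => (completed_ae _).1 (u0 n)) ((completed_ae _).1 ud).
Qed.

(** An interval of length [a]; those attached to [a = 2 ^+ j], or to [a = c / 2 ^+ j], are pairwise
    disjoint. *)
Let J (a : R) : set R := `[a, (2 * a)%R[%classic.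

Let mJ a : measurable (J a : set CR).
Proof. by apply: measurable_completed; exact: measurable_itv. Qed.

Let muJ (a : R) : (0 < a)%R -> cleb (J a) = a%:E.
Proof.
move=> a0; change (leb (J a) = a%:E).
rewrite lebesgue_measure_itv/= lte_fin ifT; last by lra.
by rewrite -EFinB; congr EFin; lra.
Qed.

Let JI (a : R) : (0 < a)%R -> (2 * a)%:E <= gamma -> J a `<=` I.
Proof.
move=> a0 ag t; rewrite /J /= in_itv/= => /andP[ta tb]; split; first by lra.
by apply: lt_le_trans ag; rewrite lte_fin.
Qed.

Let function_tail : gamma = +oo -> ~ Delta2_zero phi ->
  ~ M_ideal X N (order_continuous_part cleb (I : set CR) X N).
Proof.
move=> goo nD.
have p2 j : (0 < 2 ^+ j :> R)%R by rewrite exprn_gt0.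
apply: (@tail_not_M_ideal _ _ _ _ _ _ _ _ H phiN (fun j => J (2 ^+ j))).
- by move=> j; exact: mJ.
- by move=> j; apply: JI => //; rewrite goo leey.
- by move=> j; change (0 < cleb (J (2 ^+ j))); rewrite muJ// lte_fin.
- by move=> j; change (cleb (J (2 ^+ j)) < +oo); rewrite muJ// ltry.
- have le i j (t : R) : J (2 ^+ i) t -> J (2 ^+ j) t -> (i <= j)%N.
    rewrite /J /= !in_itv/= -!exprS => /andP[it _] /andP[_ tj].
    by rewrite -ltnS -(@ltr_eXn2l R 2) ?ltr1n//; exact: le_lt_trans it tj.
  move=> i j _ _ [t [it jt]]; apply/eqP; rewrite eqn_leq; apply/andP.
  by split; [exact: le it jt|exact: le jt it].
- by rewrite -goo; exact: cleb_domain.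
- by move=> j; exact: muJ.
- exact: nD.
Qed.

Let function_blowup : ~ Delta2_infty phi ->
  ~ M_ideal X N (order_continuous_part cleb (I : set CR) X N).
Proof.
move=> nD.
have [c c0 cg] : exists2 c : R, (0 < c)%R & (2 * c)%:E <= gamma.
  have [t t0 [_ tg]] := domain_inner gamma0.
  exists (t / 2)%R; first by lra.
  by rewrite (_ : 2 * (t / 2) = t)%R ?ltW//; lra.
have p2 j : (0 < c / 2 ^+ j :> R)%R by rewrite divr_gt0// exprn_gt0.
apply: (@blowup_not_M_ideal _ _ _ _ _ _ _ _ H phiN (fun j => J (c / 2 ^+ j)) _ _ _ _ _ c c0).
- by move=> j; exact: mJ.
- move=> j; apply: JI => //; apply: le_trans cg; rewrite lee_fin ler_pM2l//.
  by rewrite ler_pdivrMr ?exprn_gt0// ler_peMr ?exprn_ege1 ?ler1n// ltW.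
- by move=> j; change (0 < cleb (J (c / 2 ^+ j))); rewrite muJ// lte_fin.
- by move=> j; change (cleb (J (c / 2 ^+ j)) < +oo); rewrite muJ// ltry.
- have le i j (t : R) : J (c / 2 ^+ i) t -> J (c / 2 ^+ j) t -> (i <= j)%N.
    rewrite /J /= !in_itv/= => /andP[_ ti] /andP[jt _].
    have := le_lt_trans jt ti; rewrite mulrCA ltr_pM2l// -[X in (X * _)%R]invrK -invfM.
    rewrite ltf_pV2 ?posrE ?exprn_gt0 ?mulr_gt0 ?invr_gt0 ?exprn_gt0// mulrC ltr_pdivrMr// -exprSr.
    by rewrite ltr_eXn2l ?ltr1n// ltnS.
  move=> i j _ _ [t [it jt]]; apply/eqP; rewrite eqn_leq; apply/andP.
  by split; [exact: le it jt|exact: le jt it].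
- by move=> j; exact: muJ.
- exact: nD.
Qed.

Lemma Orlicz_Lorentz_not_M_ideal :
  (gamma = +oo /\ ~ Delta2 phi) \/ (gamma < +oo /\ ~ Delta2_infty phi) ->
  ~ M_ideal (Orlicz_Lorentz_space gamma w phi) (Orlicz_Lorentz_norm gamma w phi)
            (Orlicz_Lorentz_oc gamma w phi).
Proof.
move=> nD; rewrite Orlicz_Lorentz_ocE Orlicz_Lorentz_spaceE//.
rewrite (eq_M_ideal _ XN).
(* On the half-line Delta_2 fails near 0 or near infinity; long intervals serve in the first case,
   short ones in the second. *)
case: nD => [[goo nD]|[_ nD]]; last exact: function_blowup nD.
have [D0|nD0] := pselect (Delta2_zero phi); last exact: function_tail goo nD0.
exact/function_blowup/(Delta2_failure phiN nD D0).
Qed.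

End function_not_M_ideal.

Theorem corollary3p8 (R : realType) (phi : R -> R) (hphi : N_function phi) :
  (forall (gamma : \bar R) (w : R -> R),
     (0 < gamma)%E -> weight_function gamma w ->
     (gamma = +oo%E /\ ~ Delta2 phi) \/
     ((gamma < +oo)%E /\ ~ Delta2_infty phi) ->
     ~ M_ideal (Orlicz_Lorentz_space gamma w phi)
               (Orlicz_Lorentz_norm gamma w phi)
               (Orlicz_Lorentz_oc gamma w phi))
  /\
  (forall w : nat -> R,
     weight_sequence w -> ~ Delta2_zero phi ->
     ~ M_ideal (seq_Orlicz_Lorentz_space w phi)
               (seq_Orlicz_Lorentz_norm w phi)
               (seq_Orlicz_Lorentz_oc w phi)).
Proof.
split=> [gamma w gamma0 hw nD|w hw nD].
  exact: Orlicz_Lorentz_not_M_ideal gamma0 hw hphi nD.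
exact (seq_Orlicz_Lorentz_not_M_ideal hw hphi nD).
Qed.
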